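(* Consider $\min_{x\in\mathbb{R}^n}f(x)$ with $f(x)=\mathbb{E}_{\xi\sim\mathcal{D}}[f(x;\xi)]$ and $p\ge2$, where $f$ is convex, $p$ times differentiable and attains its minimum at $x^*$. Assume that $\nabla^if$ is $L_i$-Lipschitz for $i=0,1,\dots,p$ (with $\nabla^0f=f$), that $\|\nabla^if(x,\xi)-\nabla^if(x)\|\le M_i$ for all $i=1,\dots,p$, all $\xi$ and all $x\in\mathbb{R}^n$, and that there is $\bar R>0$ such that the iterates of the method satisfy $\|x_1-x_0\|\le\bar R$, $\|x_t-x^*\|\le\bar R$, $\|y_t-x^*\|\le\bar R$ for all $t\ge1$. Then for every target accuracy $\varepsilon>0$ and $\delta\in(0,1)$ one can choose the sizes of the sample sets $\mathcal{S}_i$ to be $$n_1=|\mathcal{S}_1|=\tilde{\mathcal{O}}\big((L_0+M_1)^2\cdot\varepsilon^{-2}\big),\qquad n_i=|\mathcal{S}_i|=\tilde{\mathcal{O}}\Big((L_{i-1}+M_i)^2\cdot\varepsilon^{-2\frac{p-i+1}{p+1}}\Big),\quad i=2,\dots,p,$$ so that, with probability at least $1-\delta$, the Accelerated Stochastic Tensor Method (defined in the context) has complexity $T=O\big(\varepsilon^{-1/(p+1)}\big)$, i.e. it finds a point $x$ with $f(x)-f(x^* )\le\varepsilon$ within $O(\varepsilon^{-1/(p+1)})$ iterations.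
   Context: $\|\cdot\|$ is the Euclidean norm on vectors; for $i$-th order tensors $\|T\|=\max_{\|s_1\|=\dots=\|s_i\|=1}|T[s_1,\dots,s_i]|$, and this norm is used in the Lipschitz conditions $\|\nabla^if(x)-\nabla^if(y)\|\le L_i\|x-y\|$. $d_k(x)=\frac1k\|x\|^k$ for $k\ge2$. At each point $x$ where derivatives are required, i.i.d. samples $\xi_j\sim\mathcal{D}$ forming sample sets $\mathcal{S}_1,\dots,\mathcal{S}_p$ are drawn and $G_{x,i}=\frac1{|\mathcal{S}_i|}\sum_{j\in\mathcal{S}_i}\nabla^if(x,\xi_j)$; set $\phi_{x,q}(y)=f(x)+\sum_{i=1}^q\frac1{i!}G_{x,i}[y-x]^i$. Accelerated Stochastic Tensor Method: given $x_0$, suitably chosen $\delta_1,\dots,\delta_p>0$, $\sigma\ge\max\{1,3/p\}L_p$, $\eta_i\ge3$ ($i=2,\dots,p$), $\alpha_t=\frac{p+1}{t+p+1}$ ($t\ge 0$), $A_t=\prod_{j=1}^t(1-\alpha_j)$, $A_0=1$, and $\bar\kappa_i^t=\frac p2\big(\frac{6(i-1)}{i\sqrt5}\big)^{i-1}(\eta_i+2)\frac{\alpha_t^i}{A_t}\delta_i$ ($i=2,\dots,p$), $\bar\kappa_{p+1}^t=\frac p2\big(\frac{6p}{\sqrt5(p+1)}\big)^p\frac{\alpha_t^{p+1}}{A_t}(2L_p+p\sigma)$. Precomputation: $$x_1\in\arg\min_x\Big\{\phi_{x_0,p}(x)+\sum_{i=2}^p\frac{\delta_i}{(i-1)!}d_i(x-x_0)+\frac{\sigma}{(p-1)!}d_{p+1}(x-x_0)\Big\},$$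 $$y_1\in\arg\min_x\Big\{\psi_1(x):=f(x_1)+\sum_{i=2}^{p+1}\frac{\bar\kappa_i^0}{(i-1)!}d_i(x-x_0)\Big\}.$$ For $t\ge1$: $v_t=(1-\alpha_t)x_t+\alpha_ty_t$, $$x_{t+1}\in\arg\min_x\Big\{\phi_{v_t,p}(x)+\sum_{i=2}^p\frac{\eta_i\delta_i}{(i-1)!}d_i(x-v_t)+\frac{\sigma}{(p-1)!}d_{p+1}(x-v_t)\Big\},$$ $$y_{t+1}\in\arg\min_x\Big\{\psi_{t+1}(x):=\psi_t(x)+\sum_{i=2}^{p+1}\frac{\bar\kappa_i^t-\bar\kappa_i^{t-1}}{(i-1)!}d_i(x-x_0)+\frac{\alpha_t}{A_t}\phi_{x_{t+1},1}(x)\Big\}.$$ $\tilde{\mathcal{O}}$ hides logarithmic factors (in $1/\delta$, $1/\varepsilon$), and both $\tilde{\mathcal{O}}$ and $O$ hide constants depending on $p$, the dimension $n$, $L_p$, $\sigma$, the $\eta_i$, $\|x_0-x^*\|$ and $\bar R$, where $\bar R$ does not depend on $\varepsilon$ or on the samples. *)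

(* Defs.v *)
From HB Require Import structures.
From mathcomp Require Import all_boot all_order all_algebra finmap.
From mathcomp Require Import all_classical all_reals all_analysis.

Set Implicit Arguments.
Unset Strict Implicit.
Unset Printing Implicit Defensive.

Import Order.TTheory GRing.Theory Num.Theory.
Import numFieldNormedType.Exports.

Local Open Scope classical_set_scope.
Local Open Scope ring_scope.

Section Calculus.
Context {R : realType} {n : nat}.
Local Notation V := 'rV[R]_n.

(* The library norm of 'rV[R]_n is the sup norm; it induces the same topology
   and the same derivatives as the Euclidean norm used for all estimates. *)
Definition enorm (x : V) : R := Num.sqrt (\sum_j x ord0 j ^+ 2).

Definition tensor (i : nat) := i.-tuple V -> R.

Definition tpow (i : nat) (T : tensor i) (h : V) : R := T (nseq_tuple i h).

(* The supremum is a maximum for multilinear T. *)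
Definition tnorm (i : nat) (T : tensor i) : R :=
  sup [set `|T s| | s in [set s : i.-tuple V | forall j, enorm (tnth s j) = 1]].

(* In finite dimension x |-> 'd f x is k times differentiable iff all the
   partial functions x |-> 'd f x v = 'D_v f x are. *)
Fixpoint times_differentiable (k : nat) (f : V -> R) : Prop :=
  if k is k'.+1 then
    (forall x, differentiable f x) /\
    (forall v, times_differentiable k' ('D_v f))
  else True.

(* nabla i f x [s_1, ..., s_i] = 'D_s_1 (... ('D_s_i f)) x *)
Definition nabla (i : nat) (f : V -> R) (x : V) : tensor i :=
  fun s => foldr (fun v (g : V -> R) => 'D_v g : V -> R) f s x.

Definition is_argmin (g : V -> R) (x : V) : Prop := forall y, g x <= g y.

Definition dreg (k : nat) (x : V) : R := k%:R^-1 * enorm x ^+ k.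

End Calculus.

Section Method.
Context {R : realType} {n : nat}.
Local Notation V := 'rV[R]_n.
Variables (p : nat) (Lp sigma : R) (eta delta : nat -> R).

Definition alpha (t : nat) : R := p.+1%:R / (t + p.+1)%N%:R.

Definition Aprod (t : nat) : R := \prod_(1 <= j < t.+1) (1 - alpha j).

(* For 2 <= i <= p + 1. *)
Definition kappa (t i : nat) : R :=
  p%:R / 2 * (6 * i.-1%:R / (i%:R * Num.sqrt 5)) ^+ i.-1
  * (alpha t ^+ i / Aprod t)
  * (if i == p.+1 then 2 * Lp + p%:R * sigma else (eta i + 2) * delta i).

Variable f : V -> R.

(* A derivative estimate at a point: one tensor for each order. *)
Definition estimate := forall i : nat, @tensor R n i.

Definition taylor (x : V) (G : estimate) (q : nat) (y : V) : R :=
  f x + \sum_(1 <= i < q.+1) (i`!%:R)^-1 * tpow (G i) (y - x).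

Definition reg_model (x : V) (G : estimate) (c : nat -> R) (y : V) : R :=
  taylor x G p y
  + \sum_(2 <= i < p.+1) c i / (i.-1)`!%:R * dreg i (y - x)
  + sigma / (p.-1)`!%:R * dreg p.+1 (y - x).

Variable x0 : V.

(* Derivatives are estimated at the successive query points: query number 2t
   takes place at x_0 if t = 0 and at v_t if t >= 1; query number 2t+1 takes
   place at x_(t+1).  G q is the estimator made from the samples of query q. *)
Variables (G : nat -> V -> estimate) (x y : nat -> V).

Definition vpt (t : nat) : V := (1 - alpha t) *: x t + alpha t *: y t.

(* psi t is the estimating function of index t >= 1; psi 0 is a dummy. *)
Fixpoint psi (t : nat) (z : V) : R :=
  if t is s.+1 then
    if s == 0%N then
      f (x 1%N) + \sum_(2 <= i < p.+2) kappa 0 i / (i.-1)`!%:R * dreg i (z - x0)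
    else
      psi s z
      + \sum_(2 <= i < p.+2)
          (kappa s i - kappa s.-1 i) / (i.-1)`!%:R * dreg i (z - x0)
      + alpha s / Aprod s * taylor (x s.+1) (G s.*2.+1 (x s.+1)) 1 z
  else 0.

Definition astm_run : Prop :=
  [/\ is_argmin (reg_model x0 (G 0 x0) delta) (x 1%N),
      is_argmin (psi 1) (y 1%N)
    & forall t, (1 <= t)%N ->
        is_argmin (reg_model (vpt t) (G t.*2 (vpt t))
                             (fun i => eta i * delta i)) (x t.+1)
        /\ is_argmin (psi t.+1) (y t.+1)].

Definition iterates_bounded (xs : V) (Rbar : R) : Prop :=
  enorm (x 1%N - x0) <= Rbar /\
  forall t, (1 <= t)%N -> enorm (x t - xs) <= Rbar /\ enorm (y t - xs) <= Rbar.

End Method.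

Section Sampling.
Context {R : realType} {n : nat}.
Local Notation V := 'rV[R]_n.

(* S i is the set of indices of the samples used for the order i; samples may
   be shared between orders. *)
Definition sample_mean (Xi : Type) (F : V -> Xi -> R) (S : nat -> {fset nat})
    (z : nat -> Xi) (x : V) : estimate :=
  fun i s => #|` S i|%:R^-1 * \sum_(j <- S i) nabla (F^~ (z j)) x s.

Context (d d' : measure_display) (Omega : measurableType d)
  (Xi : measurableType d') (P : probability Omega R) (D : probability Xi R).

(* xi q j is the j-th sample drawn at query q. *)
Variable xi : nat -> nat -> {RV P >-> Xi}.

Definition mutually_independent : Prop :=
  forall (J : {fset nat * nat}) (A : nat * nat -> set Xi),
    (forall k, measurable (A k)) ->
    P (\bigcap_(k in [set` J]) (xi k.1 k.2 @^-1` A k))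
    = (\prod_(k <- J) P (xi k.1 k.2 @^-1` A k))%E.

Definition iid_samples : Prop :=
  (forall q j A, measurable A -> distribution P (xi q j) A = D A)
  /\ mutually_independent.

(* The sigma-algebra of the samples of the first k queries. *)
Definition past (k : nat) : set (set Omega) :=
  <<s \bigcup_(q in `I_k) \bigcup_j
        preimage_set_system setT (xi q j) measurable >>.

Definition determined_by (A : set (set Omega)) (X : Omega -> V) : Prop :=
  forall U : set V, open U -> A (X @^-1` U).

(* x_t depends on the queries 0, ..., 2(t-1), and y_t on the queries
   0, ..., 2(t-1)+1. *)
Definition adapted (x y : nat -> Omega -> V) : Prop :=
  forall t, (1 <= t)%N ->
    determined_by (past t.*2.-1) (x t) /\ determined_by (past t.*2) (y t).

End Sampling.

Section Complexity.
Context {R : realType}.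
Variables (p : nat) (eps : R).

(* The factor hidden by a soft O is a power of this quantity. *)
Definition logfactor (dlt : R) : R := 1 + ln (1 + eps^-1) + ln (1 + dlt^-1).

(* The exponent of order 1 is not the value at i = 1 of the general formula. *)
Definition sample_rate (i : nat) : R :=
  if i == 1%N then eps `^ (- 2)
  else eps `^ (- (2 * (p.+1 - i)%N%:R / p.+1%:R)).

Definition iteration_rate : R := eps `^ (- (p.+1%:R)^-1).

End Complexity.

(* Main.v *)
(* On the event where all derivative estimates at the queries 0, ..., 2T-1 are accurate
   (order i up to delta_i, order 1 up to tau), the estimating-sequence inequality
   f(x_t)/A_(t-1) - errors <= min psi_t holds along the run; comparing with
   psi_T at the minimizer and taking delta_i = d T^i bounds f(x_T) - min f by
   rate1 d + rate2/T^(p+1) + rate3 tau + tau^2/d, so that d and tau of order eps and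
   T of order eps^(-1/(p+1)) suffice.
   That event is likely: the query point is determined by the earlier samples, the
   derivatives of F - f are bounded and centered, so by independence the moment
   generating function of a sum of fresh samples factors.  Chernoff's bound for each
   query, order and tuple of basis vectors, and a union bound over them, conclude. *)

(* Two mismatches shape the deterministic part. Growth: [psi] is affine plus multiples of ‖z -
   x0‖^i, so its growth around the minimizer has to come from Clarkson's inequality, and the
   constant obtained must beat the factor (6(i-1)/(i sqrt 5))^(i-1) in [kappa]. One midpoint is
   enough for i >= 3; for i = 2 three bisections are used, two being too few when p = 2. Index:
   [psi] at time t carries [kappa] of index t-1, while the step is paid in powers of alpha_t. The
   passage costs A_t/A_(t-1) = 1 - alpha_t, which is at least 9/10 only from t = 9(p+1) on; the
   earlier steps pay a fixed price that the final factor A_(T-1) damps. The scale T^i of the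
   tolerances is dictated by the last regularizer: A_(T-1) kappa_i is of order delta_i
   alpha_(T-1)^i, hence of order d. First-order noise gets no such help: the errors tau alpha_t/A_t
   add up to order tau/A_(T-1), where A_(T-1) cancels. The estimator of order i is the i-th
   derivative of a single function, the empirical mean over S_i, so iterated directional derivatives
   replace multilinear algebra throughout. *)
Require Import Defs.
From HB Require Import structures.
From mathcomp Require Import all_boot all_order all_algebra finmap.
From mathcomp Require Import all_classical all_reals all_analysis.
From mathcomp Require Import measurable_realfun ring lra zify.

Set Implicit Arguments.
Unset Strict Implicit.
Unset Printing Implicit Defensive.

Import Order.TTheory GRing.Theory Num.Theory.
Import numFieldNormedType.Exports.

Local Open Scope classical_set_scope.
Local Open Scope ring_scope.

(** * Iterated directional derivatives and their symmetry *)

Section IteratedDerivatives.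
Context {R : realType} {n : nat}.
Local Notation V := 'rV[R]_n.
Implicit Types (f g : V -> R) (s : seq V).

(** The fold inside [nabla], on lists of any length: concatenation and induction then need no tuples
    of matching length, and [nabla] is convertible to it. *)
Definition dseq s f : V -> R := foldr (fun v (g : V -> R) => 'D_v g : V -> R) f s.

Lemma dseq_cat s1 s2 f : dseq (s1 ++ s2) f = dseq s1 (dseq s2 f).
Proof. exact: foldr_cat. Qed.

Lemma tdiffS k f : times_differentiable k.+1 f -> times_differentiable k f.
Proof.
elim: k f => [//|k IH] f [df Df]; split=> // v.
exact: IH (Df v).
Qed.

Lemma tdiffW k l f : (k <= l)%N ->
  times_differentiable l f -> times_differentiable k f.
Proof.
move=> /subnKC <-; elim: (l - k)%N => [|j IH]; first by rewrite addn0.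
by rewrite addnS => /tdiffS.
Qed.

Lemma tdiff_dseq k s f :
  times_differentiable (size s + k) f -> times_differentiable k (dseq s f).
Proof.
elim: s k => [//|v s IH] k df.
by have [|_] := IH k.+1; [rewrite addnS|exact].
Qed.

Lemma tdiff_differentiable k f : (0 < k)%N -> times_differentiable k f ->
  forall x, differentiable f x.
Proof. by case: k => // k _ []. Qed.

Lemma dseq_differentiable k s f x : times_differentiable k f ->
  (size s < k)%N -> differentiable (dseq s f) x.
Proof.
move=> df sk; apply: (@tdiff_differentiable 1) => //.
by apply: tdiff_dseq; apply: tdiffW df; rewrite addn1.
Qed.

Lemma derive_dirD g x u v a : differentiable g x ->
  'D_(a *: u + v) g x = a * 'D_u g x + 'D_v g x.
Proof. by move=> dg; rewrite !deriveE // linearP. Qed.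

Lemma derive_dirZ g x u a : differentiable g x -> 'D_(a *: u) g x = a * 'D_u g x.
Proof. by move=> dg; rewrite !deriveE // linearZ. Qed.

Lemma derive_lin g1 g2 (a : R) : (forall x, differentiable g1 x) ->
  (forall x, differentiable g2 x) -> forall v,
  'D_v (fun x => a * g1 x + g2 x) = (fun x => a * 'D_v g1 x + 'D_v g2 x).
Proof.
move=> d1 d2 v; apply/funext => x.
have e1 : derivable g1 x v by exact: diff_derivable.
have e2 : derivable g2 x v by exact: diff_derivable.
have e1' : derivable (a \*: g1) x v by exact: derivableZ.
exact: etrans (deriveD e1' e2) (congr1 (+%R^~ _) (deriveZ a e1)).
Qed.

Lemma tdiff_lin k g1 g2 (a : R) : times_differentiable k g1 ->
  times_differentiable k g2 -> times_differentiable k (fun x => a * g1 x + g2 x).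
Proof.
elim: k g1 g2 => [//|k IH] g1 g2 [d1 D1] [d2 D2]; split=> [x|v].
  have e1 : differentiable (a \*: g1) x by exact: differentiableZ.
  exact: differentiableD e1 (d2 x).
by rewrite (derive_lin a d1 d2 v); exact: IH (D1 v) (D2 v).
Qed.

Lemma dseq_lin s g1 g2 (a : R) : times_differentiable (size s) g1 ->
  times_differentiable (size s) g2 ->
  dseq s (fun x => a * g1 x + g2 x) = (fun x => a * dseq s g1 x + dseq s g2 x).
Proof.
elim/last_ind: s g1 g2 => [//|s v IH] g1 g2.
rewrite size_rcons => -[d1 D1] [d2 D2].
by rewrite -!cats1 !dseq_cat /= (derive_lin a d1 d2 v) (IH _ _ (D1 v) (D2 v)).
Qed.

Lemma tdiff_cst k (c : R) : times_differentiable k (cst c : V -> R).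
Proof.
elim: k c => // k IH c; split=> [x|v]; first exact: differentiable_cst.
rewrite (_ : 'D_v (cst c : V -> R) = cst 0); first exact: IH.
by apply/funext => x; rewrite derive_cst.
Qed.

Lemma dseq0 s : dseq s (cst 0 : V -> R) = cst 0.
Proof.
elim: s => //= v s ->; apply/funext => x; exact: derive_cst.
Qed.

Lemma derive_scale_at g (a : R) x v : differentiable g x ->
  'D_v (fun x => a * g x) x = a * 'D_v g x.
Proof.
move=> dg; have e : derivable g x v by exact: diff_derivable.
have e' : 'D_v (a \*: g) x = a *: 'D_v g x by exact: deriveZ.
exact: e'.
Qed.

Lemma derive_scale g (a : R) : (forall x, differentiable g x) -> forall v,
  'D_v (fun x => a * g x) = (fun x => a * 'D_v g x).
Proof. by move=> dg v; apply/funext => x; exact: derive_scale_at. Qed.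

Lemma tdiff_scale k g (a : R) : times_differentiable k g ->
  times_differentiable k (fun x => a * g x).
Proof.
elim: k g => [//|k IH] g [d D]; split=> [x|v].
  exact: (@differentiableZ _ _ _ g a x (d x)).
by rewrite (derive_scale a d v); exact: IH (D v).
Qed.

Lemma dseq_scale s g (a : R) : times_differentiable (size s) g ->
  dseq s (fun x => a * g x) = (fun x => a * dseq s g x).
Proof.
elim/last_ind: s g => [//|s v IH] g; rewrite size_rcons => -[d D].
by rewrite -!cats1 !dseq_cat /= (derive_scale a d v) (IH _ (D v)).
Qed.

Lemma tdiff_sum k (I : Type) (r : seq I) (c : R) (g : I -> V -> R) :
  (forall i, times_differentiable k (g i)) ->
  times_differentiable k (fun x => c * \sum_(i <- r) g i x).
Proof.
move=> dg; elim: r => [|i r IH].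
  by under [X in times_differentiable _ X]funext do rewrite big_nil mulr0;
    exact: tdiff_cst.
under [X in times_differentiable _ X]funext do rewrite big_cons mulrDr.
exact: tdiff_lin.
Qed.

Lemma dseq_sum s (I : Type) (r : seq I) (c : R) (g : I -> V -> R) x :
  (forall i, times_differentiable (size s) (g i)) ->
  dseq s (fun y => c * \sum_(i <- r) g i y) x = c * \sum_(i <- r) dseq s (g i) x.
Proof.
move=> dg; elim: r => [|i r IH].
  rewrite big_nil mulr0.
  by under [X in dseq _ X]funext do rewrite big_nil mulr0; rewrite dseq0.
under [X in dseq _ X]funext do rewrite big_cons mulrDr.
rewrite (dseq_lin (g1 := g i) c) ?big_cons ?mulrDr -?IH //.
exact: tdiff_sum.
Qed.

Lemma tdiffB k g1 g2 : times_differentiable k g1 ->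
  times_differentiable k g2 -> times_differentiable k (g1 \- g2).
Proof.
move=> d1 d2; rewrite (_ : _ \- _ = (fun x => -1 * g2 x + g1 x)); last first.
  by apply/funext => x; rewrite mulN1r addrC.
exact: tdiff_lin.
Qed.

Lemma dseqB s g1 g2 x : times_differentiable (size s) g1 ->
  times_differentiable (size s) g2 ->
  dseq s (g1 \- g2) x = dseq s g1 x - dseq s g2 x.
Proof.
move=> d1 d2; rewrite (_ : _ \- _ = (fun x => -1 * g2 x + g1 x)); last first.
  by apply/funext => y; rewrite mulN1r addrC.
by rewrite dseq_lin // mulN1r addrC.
Qed.

Lemma is_derive_line g (x h : V) (t : R) :
  differentiable g (x + t *: h) ->
  is_derive t 1 (fun s : R => g (x + s *: h)) ('D_h g (x + t *: h)).
Proof.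
move=> /(@diff_derivable _ _ _ _ _ h) dg.
have E : (fun k : R => k^-1 *: (((fun s : R => g (x + s *: h)) \o shift t) (k *: 1)
    - g (x + t *: h)))
  = (fun k => k^-1 *: ((g \o shift (x + t *: h)) (k *: h) - g (x + t *: h))).
  apply/funext => k /=; congr (_ *: (g _ - _)).
  by rewrite [k *: 1]mulr1 scalerDl addrCA.
by apply: DeriveDef; rewrite /derivable/derive E.
Qed.

Lemma MVT0 (phi dphi : R -> R) (t : R) : 0 < t ->
  (forall y : R, is_derive y 1 phi (dphi y)) ->
  exists2 c, 0 < c < t & phi t - phi 0 = dphi c * t.
Proof.
move=> t0 dphiE.
have cphi : {within `[0, t], continuous phi}.
  apply: continuous_subspaceT => y; apply: differentiable_continuous.
  by apply/derivable1_diffP; case: (dphiE y).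
have [c] := @MVT R phi dphi 0 t t0 (fun y _ => dphiE y) cphi.
by rewrite in_itv /= subr0 => ct E; exists c.
Qed.

Lemma differentiable_near g x (e : R) : differentiable g x -> 0 < e ->
  exists2 d, 0 < d & forall w, `|w| < d ->
    `|g (x + w) - g x - 'D_w g x| <= e * `|w|.
Proof.
move=> dg e0; have /eqaddoP/(_ e e0) := diff_locally dg.
rewrite -nbhs_nearE => /nbhs_normP [d d0 H]; exists d => // w wd.
have /= := H w; rewrite /ball_ /= sub0r normrN => /(_ wd).
rewrite -![(_ + _ : _ -> _) _]/(_ + _) -![(- _ : _ -> _) _]/(- _) /=.
by rewrite deriveE // opprD addrA [w + x]addrC.
Qed.

(* Both mixed derivatives are limits of the same second difference quotient. *)
Lemma second_difference g (x a b : V) (e : R) : times_differentiable 2 g -> 0 < e ->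
  exists2 d, 0 < d & forall t, 0 < t < d ->
  `|(g (x + t *: a + t *: b) - g (x + t *: a) - g (x + t *: b) + g x) / t ^+ 2
    - 'D_b ('D_a g) x| <= e.
Proof.
move=> [dg Dg] e0; have [dag _] := Dg a.
(* With both remainders of the form e / C times an increment, the increments add up to at most t *
   C; the summand 1 makes [C] positive. *)
set C := 2 * `|a| + `|b| + 1.
have b0 := normr_ge0 b; have a0 := normr_ge0 a.
have C0 : 0 < C by rewrite /C; lra.
have C1 : `|b| + `|a| <= C by rewrite /C; lra.
have C2 : `|a| <= C by rewrite /C; lra.
have C3 : `|b| + `|a| + `|a| <= C by rewrite /C; lra.
have [d d0 Hd] := differentiable_near (dag x) (divr_gt0 e0 C0).
exists (d / C); first exact: divr_gt0.
move=> t /andP[t0]; rewrite ltr_pdivlMr // => td.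
(* The second difference is an increment of [phi]. The mean value theorem turns it into a difference
   of values of ['D_a g], and expanding both values at [x] leaves ['D_b ('D_a g) x]. *)
pose phi (s : R) := g (x + t *: b + s *: a) - g (x + s *: a).
have [|c /andP[c0 ct] E] := @MVT0 phi
   (fun s : R => 'D_a g (x + t *: b + s *: a) - 'D_a g (x + s *: a)) t t0.
  by move=> s; apply: is_deriveB; exact: is_derive_line.
have phiE : g (x + t *: a + t *: b) - g (x + t *: a) - g (x + t *: b) + g x = phi t - phi 0.
  by rewrite /phi !scale0r !addr0 (addrAC x (t *: a)); ring.
rewrite phiE E expr2 invfM mulrA mulfK ?gt_eqF //.
have n1 : `|t *: b + c *: a| <= t * (`|b| + `|a|).
  apply: le_trans (ler_normD _ _) _; rewrite !normrZ !gtr0_norm // mulrDr.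
  by rewrite lerD2l ler_wpM2r // ltW.
have n2 : `|c *: a| <= t * `|a|.
  by rewrite normrZ gtr0_norm // ler_wpM2r // ltW.
have h1 := Hd (t *: b + c *: a); have h2 := Hd (c *: a).
have l1 : t * (`|b| + `|a|) < d.
  by apply: le_lt_trans td; rewrite ler_pM2l.
have l2 : t * `|a| < d.
  by apply: le_lt_trans td; rewrite ler_pM2l.
have {}h1 : `|'D_a g (x + (t *: b + c *: a)) - 'D_a g x - 'D_(t *: b + c *: a) ('D_a g) x| <= e / C * (t * (`|b| + `|a|)).
  apply: le_trans (h1 (le_lt_trans n1 l1)) _.
  by rewrite ler_wpM2l // divr_ge0 // ltW.
have {}h2 : `|'D_a g (x + c *: a) - 'D_a g x - 'D_(c *: a) ('D_a g) x| <= e / C * (t * `|a|).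
  apply: le_trans (h2 (le_lt_trans n2 l2)) _.
  by rewrite ler_wpM2l // divr_ge0 // ltW.
rewrite derive_dirD ?derive_dirZ // in h1; rewrite derive_dirZ // in h2.
rewrite !addrA in h1.
set D1 := 'D_a g _ in h1 *; set D2 := 'D_a g (x + c *: a) in h2 *.
set Db := 'D_b ('D_a g) x in h1 *; set Da := 'D_a ('D_a g) x in h1 h2.
rewrite (_ : _ - Db = ((D1 - D2) - t * Db) / t); last first.
  by rewrite [RHS]mulrBl [t * Db]mulrC mulfK ?gt_eqF.
rewrite normrM normfV (gtr0_norm t0) ler_pdivrMr //.
have -> : D1 - D2 - t * Db = (D1 - 'D_a g x - (t * Db + c * Da)) -
   (D2 - 'D_a g x - c * Da) by ring.
apply: le_trans (ler_normB _ _) _.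
apply: le_trans (lerD h1 h2) _.
rewrite -mulrDr -mulrDr mulrAC ler_pdivrMr // [e * t]mulrC [e * _]mulrC -!mulrA.
by rewrite ler_pM2l // mulrC ler_pM2l.
Qed.

(** The quotient in [second_difference] is symmetric in [a] and [b], so one small step brings both
    mixed derivatives within e / 2 of the same number. *)
Lemma schwarz_at g a b x : times_differentiable 2 g ->
  'D_a ('D_b g) x = 'D_b ('D_a g) x.
Proof.
move=> dg; apply/eqP; rewrite -subr_eq0 -normr_le0.
apply/ler_addgt0Pl => e e0; rewrite addr0.
have e2 : 0 < e / 2 by rewrite divr_gt0.
have [d1 d10 h1] := second_difference x a b dg e2.
have [d2 d20 h2] := second_difference x b a dg e2.
pose t := Num.min d1 d2 / 2.
have m0 : 0 < Num.min d1 d2 by rewrite lt_min d10.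
have t0 : 0 < t by rewrite divr_gt0.
have tm : t < Num.min d1 d2 by rewrite /t; lra.
have [t1 t2] : t < d1 /\ t < d2 by move: tm; rewrite lt_min => /andP[].
have {h1} := h1 t; have {h2} := h2 t; rewrite t0 t1 t2 => /(_ isT) h2 /(_ isT) h1.
have E : g (x + t *: a + t *: b) - g (x + t *: a) - g (x + t *: b) + g x =
   g (x + t *: b + t *: a) - g (x + t *: b) - g (x + t *: a) + g x.
  by rewrite (addrAC x (t *: a)); ring.
rewrite -E in h2; move: h1 h2; set q := _ / _.
move: ('D_a ('D_b g) x) ('D_b ('D_a g) x) => u v h1 h2.
have -> : u - v = (q - v) - (q - u) by ring.
by apply: le_trans (ler_normB _ _) _; rewrite [leRHS]splitr; exact: lerD.
Qed.

Lemma schwarz g a b : times_differentiable 2 g ->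
  'D_a ('D_b g) = 'D_b ('D_a g) :> (V -> R).
Proof. by move=> dg; apply/funext => x; exact: schwarz_at. Qed.

(** A Taylor expansion of ['D_u f] has [u] innermost, differentiating the model puts it outermost;
    [taylor_gradient] needs the two to agree. *)
Lemma dseq_nseq_rcons f j h u : times_differentiable j.+1 f ->
  dseq (rcons (nseq j h) u) f = dseq (u :: nseq j h) f.
Proof.
elim: j => // j IH df.
rewrite [nseq _ _]/= rcons_cons [LHS]/= -/(dseq _ f) IH; last exact: tdiffS.
rewrite /= -/(dseq _ f); apply: schwarz; apply: tdiff_dseq.
by rewrite size_nseq addn2.
Qed.

End IteratedDerivatives.

(** * The Euclidean norm and its powers *)

Section Euclid.
Context {R : realType} {n : nat}.
Local Notation V := 'rV[R]_n.
Implicit Types (a b c u v w : V).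

Definition dot a b : R := \sum_j a ord0 j * b ord0 j.

Lemma dotC a b : dot a b = dot b a.
Proof. by apply: eq_bigr => j _; rewrite mulrC. Qed.

Lemma dotDl a b c : dot (a + b) c = dot a c + dot b c.
Proof. by rewrite -big_split; apply: eq_bigr => j _; rewrite mxE mulrDl. Qed.

Lemma dotZl k a b : dot (k *: a) b = k * dot a b.
Proof. by rewrite mulr_sumr; apply: eq_bigr => j _; rewrite mxE mulrA. Qed.

Lemma dotDr a b c : dot a (b + c) = dot a b + dot a c.
Proof. by rewrite !(dotC a) dotDl. Qed.

Lemma dotZr k a b : dot a (k *: b) = k * dot a b.
Proof. by rewrite !(dotC a) dotZl. Qed.

Lemma dotNr a b : dot a (- b) = - dot a b.
Proof. by rewrite -scaleN1r dotZr mulN1r. Qed.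

Lemma dot_ge0 a : 0 <= dot a a.
Proof. by apply: sumr_ge0 => j _; rewrite -expr2 sqr_ge0. Qed.

Lemma enorm_ge0 a : 0 <= enorm a.
Proof. exact: sqrtr_ge0. Qed.

Lemma enorm_sqr a : enorm a ^+ 2 = dot a a.
Proof.
rewrite sqr_sqrtr; last by apply: sumr_ge0 => j _; rewrite sqr_ge0.
by apply: eq_bigr => j _; rewrite expr2.
Qed.

Lemma enormZ k a : enorm (k *: a) = `|k| * enorm a.
Proof.
apply/eqP; rewrite -(@eqrXn2 _ 2) ?mulr_ge0 ?enorm_ge0 //.
by rewrite exprMn !enorm_sqr dotZl dotZr real_normK ?num_real // mulrA expr2.
Qed.

Lemma enormN a : enorm (- a) = enorm a.
Proof. by rewrite -scaleN1r enormZ normrN1 mul1r. Qed.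

Lemma enormB a b : enorm (a - b) = enorm (b - a).
Proof. by rewrite -enormN opprB. Qed.

Lemma enorm0 : enorm (0 : V) = 0.
Proof. by rewrite -(scale0r (0 : V)) enormZ normr0 mul0r. Qed.

Lemma enorm_eq0 a : enorm a = 0 -> a = 0.
Proof.
move=> a0; have /eqP := enorm_sqr a; rewrite a0 expr0n /= eq_sym.
rewrite /dot psumr_eq0; last by move=> j _; rewrite -expr2 sqr_ge0.
move=> /allP h; apply/rowP => j; rewrite mxE.
by have := h j (mem_index_enum j); rewrite /= mulf_eq0 orbb => /eqP.
Qed.

Lemma enorm_sqrD a b : enorm (a + b) ^+ 2 = enorm a ^+ 2 + 2 * dot a b + enorm b ^+ 2.
Proof. by rewrite !enorm_sqr dotDl !dotDr (dotC b a); ring. Qed.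

Lemma cauchy_schwarz a b : `|dot a b| <= enorm a * enorm b.
Proof.
have [/enorm_eq0 ->|b0] := eqVneq (enorm b) 0.
  by rewrite -(scale0r (0 : V)) dotZr enormZ normr0 !mul0r mulr0 normr0.
rewrite -(@ler_pXn2r _ 2) ?nnegrE ?mulr_ge0 ?enorm_ge0 //.
rewrite real_normK ?num_real // exprMn.
have := dot_ge0 (enorm b ^+ 2 *: a - dot a b *: b).
rewrite -scaleNr -enorm_sqr enorm_sqrD !enormZ !exprMn dotZl dotZr.
rewrite !real_normK ?num_real // sqrrN -(@ler_pM2l _ (enorm b ^+ 2)) ?exprn_even_gt0 //.
lra.
Qed.

Lemma enormD a b : enorm (a + b) <= enorm a + enorm b.
Proof.
rewrite -(@ler_pXn2r _ 2) ?nnegrE ?addr_ge0 ?enorm_ge0 // enorm_sqrD sqrrD.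
have := cauchy_schwarz a b; move/(le_trans (ler_norm _)); lra.
Qed.

Lemma enorm_triangle c a b : enorm (a - b) <= enorm (a - c) + enorm (c - b).
Proof. by apply: le_trans (enormD _ _); rewrite addrA subrK. Qed.

Lemma coord_le_enorm a j : `|a ord0 j| <= enorm a.
Proof.
rewrite -sqrtr_sqr; apply: ler_wsqrtr.
by rewrite (bigD1 j) //= lerDl; apply: sumr_ge0 => k _; rewrite sqr_ge0.
Qed.

Lemma enorm_delta j : enorm (delta_mx 0 j : V) = 1.
Proof.
apply/eqP; rewrite -(@eqrXn2 _ 2) ?enorm_ge0 // enorm_sqr expr1n.
rewrite /dot (bigD1 j) //= !mxE !eqxx mulr1 big1 ?addr0 // => k kj.
by rewrite !mxE (negPf kj) andbF mulr0.
Qed.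

(* The error of the first-order expansion of X^k in the variable X^2. *)
Lemma pow_expansion (k : nat) (A B : R) : 0 <= A -> 0 <= B ->
  exists2 Q, 0 <= Q & forall b : R, 0 <= b <= B ->
    0 <= b ^+ k.+2 - A ^+ k.+2 - k.+2%:R / 2 * A ^+ k * (b ^+ 2 - A ^+ 2)
      <= Q * (b - A) ^+ 2.
Proof.
move=> A0 B0; elim: k => [|k [Q Q0 IH]].
  by exists 0 => // b _; rewrite divff ?pnatr_eq0 // expr0 !mul1r subrr mul0r lexx.
exists (B * Q + A ^+ k * (k.+2%:R * B + k.+1%:R * A) / 2) => [|b bB].
  by rewrite addr_ge0 ?mulr_ge0 ?exprn_ge0 ?addr_ge0 ?mulr_ge0.
have /andP[b0 bleB] := bB; have /andP[e0 eQ] := IH b bB.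
(* A recursion for the error: both terms on the right are nonnegative, and on [0, B] both are at
   most a constant times (b - A)^2. *)
have -> : b ^+ k.+3 - A ^+ k.+3 - k.+3%:R / 2 * A ^+ k.+1 * (b ^+ 2 - A ^+ 2) =
  b * (b ^+ k.+2 - A ^+ k.+2 - k.+2%:R / 2 * A ^+ k * (b ^+ 2 - A ^+ 2)) +
  A ^+ k * (k.+2%:R * b + k.+1%:R * A) / 2 * (b - A) ^+ 2.
  by rewrite !exprS expr0 -!natr1; field.
have s0 : 0 <= (b - A) ^+ 2 by exact: sqr_ge0.
apply/andP; split.
  apply: addr_ge0; first exact: mulr_ge0.
  apply: mulr_ge0 => //; apply: mulr_ge0 => //; apply: mulr_ge0.
    exact: exprn_ge0.
  by apply: addr_ge0; apply: mulr_ge0.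
rewrite [leRHS]mulrDl; apply: lerD.
  apply: le_trans (ler_wpM2l b0 eQ) _; rewrite mulrA ler_wpM2r //.
  by rewrite ler_wpM2r.
rewrite ler_wpM2r // ler_pM2r ?invr_gt0 // ler_wpM2l ?exprn_ge0 //.
by rewrite lerD2r ler_wpM2l.
Qed.

(** Convexity of X^(k+2) as a function of X^2. The variable is the square because that is what the
    parallelogram law controls. *)
Lemma pow_tangent (k : nat) (A b : R) : 0 <= A -> 0 <= b ->
  A ^+ k.+2 + k.+2%:R / 2 * A ^+ k * (b ^+ 2 - A ^+ 2) <= b ^+ k.+2.
Proof.
move=> A0 b0; have [Q _ H] := pow_expansion k A0 b0.
have /H/andP[+ _] : 0 <= b <= b by rewrite b0 lexx.
by rewrite -addrA -opprD subr_ge0.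
Qed.

(** Let c^2 be the sum of the two squares on the left. By the parallelogram law it is the mean of
    the squared norms of [a] and [b]. Both norms on the left are at most c, so their k-th powers sum
    to at most c^k, and c^k is at most the mean of the k-th powers by [pow_tangent]. *)
Lemma clarkson (k : nat) a b : (2 <= k)%N ->
  enorm (2^-1 *: (a + b)) ^+ k + enorm (2^-1 *: (a - b)) ^+ k
  <= (enorm a ^+ k + enorm b ^+ k) / 2.
Proof.
case: k => [|[|k]] // _.
set P := enorm (2^-1 *: (a + b)); set Q := enorm (2^-1 *: (a - b)).
have P0 : 0 <= P by exact: enorm_ge0.
have Q0 : 0 <= Q by exact: enorm_ge0.
have PQ : P ^+ 2 + Q ^+ 2 = (enorm a ^+ 2 + enorm b ^+ 2) / 2.
  rewrite /P /Q !enormZ !exprMn !enorm_sqrD enormN dotNr normfV ger0_norm //.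
  by field.
set c := Num.sqrt (P ^+ 2 + Q ^+ 2).
have c0 : 0 <= c by exact: sqrtr_ge0.
have cE : c ^+ 2 = P ^+ 2 + Q ^+ 2 by rewrite sqr_sqrtr // addr_ge0 ?sqr_ge0.
have le_c x : 0 <= x -> x ^+ 2 <= c ^+ 2 -> x ^+ k.+2 <= x ^+ 2 * c ^+ k.
  move=> x0 xc; rewrite -addn2 exprD mulrC ler_wpM2l ?sqr_ge0 //.
  rewrite lerXn2r ?nnegrE //.
  by rewrite -(@ler_pXn2r _ 2).
have h1 : P ^+ k.+2 + Q ^+ k.+2 <= c ^+ k.+2.
  rewrite -[X in c ^+ X]addn2 [c ^+ (_ + _)]exprD [leRHS]mulrC cE mulrDl.
  by apply: lerD; apply: le_c; rewrite // cE ?lerDl ?lerDr sqr_ge0.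
apply: le_trans h1 _.
have := lerD (pow_tangent k c0 (enorm_ge0 a)) (pow_tangent k c0 (enorm_ge0 b)).
rewrite cE PQ; move: (c ^+ k.+2) (enorm a ^+ k.+2) (enorm b ^+ k.+2) => x y z.
move: (k.+2%:R / 2 * c ^+ k) (enorm a ^+ 2) (enorm b ^+ 2) => T a2 b2; lra.
Qed.

(** Lets the derivative of a norm power be read off an algebraic estimate, with no separate
    treatment of the zero vector. *)
Lemma is_derive_quad (phi : R -> R) (d K : R) :
  (forall s, `|s| <= 1 -> `|phi s - phi 0 - s * d| <= K * s ^+ 2) ->
  is_derive (0 : R) (1 : R) phi d.
Proof.
move=> H.
suff cv : (fun h : R => h^-1 * (phi (h *: (1 : R^o) + 0) - phi 0)) @ 0^' --> d.
  by apply: DeriveDef; [apply/cvg_ex; exists d | exact: cvg_lim cv].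
apply/cvgrPdist_le => /= e e0.
have K1 : 0 < `|K| + 1 by rewrite ltr_pwDr.
near=> h.
have h0 : h != 0 by near: h; exact: nbhs_dnbhs_neq.
have hs : `|h| <= Num.min 1 (e / (`|K| + 1)).
  near: h; apply: dnbhs0_le; first by rewrite lt_min ltr01 divr_gt0.
move: hs; rewrite le_min => /andP[h1 h2].
rewrite [h *: 1]mulr1 /= addr0 -[d](mulKf h0) -mulrBr normrM normfV.
rewrite ler_pdivrMl ?normr_gt0 // distrC.
apply: le_trans (H h h1) _.
rewrite -real_normK ?num_real // expr2 mulrCA ler_wpM2l //.
apply: le_trans (_ : `|K| * `|h| <= _); first by rewrite ler_wpM2r // ler_norm.
move: h2; rewrite ler_pdivlMr //; apply: le_trans; rewrite mulrC ler_wpM2l //; lra.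
Unshelve. all: by end_near. Qed.

(** The squared norm is a quadratic polynomial in [s], and [pow_expansion] transfers its expansion
    to the power [k] at quadratic cost. This covers [a = 0], where the norm itself need not be
    differentiable. *)
Lemma is_derive_enorm_pow (k : nat) a u : (2 <= k)%N ->
  is_derive (0 : R) 1 (fun s : R => enorm (a + s *: u) ^+ k)
    (k%:R * enorm a ^+ (k - 2) * dot a u).
Proof.
case: k => [|[|k]] // _; rewrite subSS subSS subn0.
have B0 : 0 <= enorm a + enorm u by rewrite addr_ge0 ?enorm_ge0.
have [Q Q0 HQ] := pow_expansion k (enorm_ge0 a) B0.
apply: (@is_derive_quad _ _ ((Q + k.+2%:R / 2 * enorm a ^+ k) * enorm u ^+ 2)) => s s1.
rewrite scale0r addr0; set b := enorm (a + s *: u).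
have bl : `|b - enorm a| <= `|s| * enorm u.
  rewrite -enormZ ler_norml; apply/andP; split.
    rewrite lerNl opprB lerBlDr -(enormN (s *: u)).
    by apply: le_trans (enormD _ _); rewrite addrC addrK.
  by rewrite lerBlDr addrC; exact: enormD.
have bB : 0 <= b <= enorm a + enorm u.
  rewrite enorm_ge0; apply: le_trans (enormD _ _) _; rewrite lerD2l enormZ.
  by rewrite ler_piMl ?enorm_ge0.
have := HQ b bB; have -> : b ^+ 2 - enorm a ^+ 2 = 2 * s * dot a u + s ^+ 2 * enorm u ^+ 2.
  by rewrite /b enorm_sqrD dotZr enormZ exprMn real_normK ?num_real //; ring.
set X := b ^+ _ - _; set A := enorm a ^+ k => /andP[l1 l2].
have sq : (b - enorm a) ^+ 2 <= s ^+ 2 * enorm u ^+ 2.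
  rewrite -[leLHS]real_normK ?num_real // -[s ^+ 2]real_normK ?num_real // -exprMn.
  by rewrite lerXn2r ?nnegrE ?mulr_ge0 ?enorm_ge0.
have {l2} l2 := le_trans l2 (ler_wpM2l Q0 sq).
have A0 : 0 <= k.+2%:R / 2 * A by rewrite mulr_ge0 ?exprn_ge0 ?enorm_ge0.
have p0 : 0 <= k.+2%:R / 2 * A * (s ^+ 2 * enorm u ^+ 2).
  by rewrite mulr_ge0 // -exprMn sqr_ge0.
move: l1 l2 p0 (mulr_ge0 Q0 (sqr_ge0 (s * enorm u))); rewrite exprMn.
set k2 := k.+2%:R => l1 l2 p0 q0; rewrite ler_norml; apply/andP; split.
  lra.
lra.
Qed.

End Euclid.

(** * Derivative tensors, Taylor bounds and optimality *)

Section Tensors.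
Context {R : realType} {n : nat}.
Local Notation V := 'rV[R]_n.
Implicit Types (f g : V -> R) (h u v w : V) (s : seq V).

Definition bvec (j : 'I_n) : V := delta_mx ord0 j.

Lemma derive_basis g x v : differentiable g x ->
  'D_v g x = \sum_j v ord0 j * 'D_(bvec j) g x.
Proof.
move=> dg; rewrite deriveE // {1}(row_sum_delta v) raddf_sum.
apply: eq_bigr => j _; rewrite -derive_dirZ // deriveE //.
Qed.

Lemma gradient g x : differentiable g x ->
  exists G : V, forall w, 'D_w g x = dot G w.
Proof.
move=> dg; exists (\row_j 'D_(bvec j) g x) => w; rewrite derive_basis //.
by apply: eq_bigr => j _; rewrite mxE mulrC.
Qed.

(** Each slot is expanded in the basis with coordinates at most its norm, which costs a factor n per
    slot. It reduces the control of a random tensor to finitely many random numbers. *)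
Lemma dseq_basis_bound (k : nat) g x (m : R) : times_differentiable k g ->
  (forall kap : seq 'I_n, size kap = k -> `|dseq (map bvec kap) g x| <= m) ->
  forall s, size s = k -> `|dseq s g x| <= m * \prod_(v <- s) (n%:R * enorm v).
Proof.
move=> dg H.
(* The slots in [kap] already hold basis vectors; the induction runs over the slots still to be
   expanded. *)
suff main s (kap : seq 'I_n) : (size kap + size s = k)%N ->
    `|dseq (map bvec kap ++ s) g x| <= m * \prod_(v <- s) (n%:R * enorm v).
  by move=> s; exact: (main s [::]).
elim: s kap => [|v s IH] kap; first by rewrite addn0 cats0 big_nil mulr1; exact: H.
move=> sk; rewrite dseq_cat.
have ds (z : V) : differentiable (dseq s g) z.
  by apply: dseq_differentiable dg _; rewrite -sk /= addnS ltnS leq_addl.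
have dgj j : times_differentiable (size (map bvec kap)) (dseq (bvec j :: s) g).
  apply: tdiff_dseq; rewrite size_map.
  by have -> : (size (bvec j :: s) + size kap = k)%N by rewrite addnC -sk.
rewrite (_ : dseq (v :: s) g = fun z => 1 * \sum_(j <- enum 'I_n) (v ord0 j * dseq (bvec j :: s) g z)).
  have dj j := tdiff_scale (v ord0 j) (dgj j).
  rewrite (dseq_sum _ _ _ dj) mul1r big_enum /=.
  rewrite big_cons [leRHS](_ : _ = \sum_(j < n) (enorm v * (m * \prod_(j0 <- s) (n%:R * enorm j0)))); last first.
    by rewrite sumr_const card_ord -mulr_natl; ring.
  apply: le_trans (ler_norm_sum _ _ _) _; apply: ler_sum => j _.
  have -> : dseq (map bvec kap) (fun z => v ord0 j * dseq (bvec j :: s) g z) x =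
    v ord0 j * dseq (map bvec (rcons kap j) ++ s) g x.
    by rewrite map_rcons -cats1 -catA !dseq_cat (dseq_scale _ (dgj j)).
  rewrite normrM; apply: ler_pM => //; first exact: coord_le_enorm.
  by apply: IH; rewrite size_rcons addSn -addnS.
apply/funext => z; rewrite mul1r big_enum /=; exact: derive_basis.
Qed.

(** Used with 1/‖v‖ to normalize all slots at once, and with the indicator of v != 0 to see that a
    zero slot kills the derivative. *)
Lemma dseq_homogeneous s g (c : V -> R) x : times_differentiable (size s) g ->
  dseq (map (fun v => c v *: v) s) g x = (\prod_(v <- s) c v) * dseq s g x.
Proof.
move=> dg; elim: s x dg => [|v s IH] x dg; first by rewrite big_nil mul1r.
have ds (z : V) : differentiable (dseq s g) z by exact: dseq_differentiable dg _.
have dm : dseq (map (fun v => c v *: v) s) g =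
    fun z => (\prod_(v <- s) c v) * dseq s g z.
  by apply/funext => z; rewrite IH //; exact: tdiffS dg.
rewrite big_cons /= -!/(dseq _ g) dm.
have dd : differentiable (fun z => (\prod_(v <- s) c v) * dseq s g z) x.
  exact: (@differentiableZ _ _ _ (dseq s g) _ x (ds x)).
by rewrite (derive_dirZ _ _ dd) (derive_scale_at _ _ (ds x)) mulrA.
Qed.

(** Normalizing the slots extends a bound over unit vectors to all vectors. *)
Lemma tnorm_bound (k : nat) g1 g2 x y (B : R) :
  times_differentiable k g1 -> times_differentiable k g2 ->
  tnorm (nabla (i := k) g1 x \- nabla g2 y) <= B ->
  forall s, size s = k ->
  `|dseq s g1 x - dseq s g2 y| <= B * \prod_(v <- s) enorm v.
Proof.
move=> d1 d2 hB s sk.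
(* A zero slot cannot be normalized, but then both derivatives vanish. *)
have [s0|s0] := boolP (0 \in s).
  have z g : times_differentiable k g -> forall x, dseq s g x = 0.
    move=> dg z; have -> : s = map (fun v => (v != 0)%:R *: v) s.
      rewrite -[LHS]map_id; apply: eq_map => v /=.
      by case: eqP => [->|_]; rewrite ?scaler0 ?scale1r.
    rewrite dseq_homogeneous ?sk // (big_rem 0) //= eqxx !mul0r //.
  by rewrite !z // subrr normr0 (big_rem 0) //= enorm0 mul0r mulr0.
pose c v := (enorm v)^-1 : R.
have nz v : v \in s -> enorm v != 0.
  by move=> vs; apply/eqP => /enorm_eq0 v0; move: s0; rewrite -v0 vs.
have prodc : \prod_(v <- s) c v = (\prod_(v <- s) enorm v)^-1 by rewrite prodfV.
have P0 : 0 < \prod_(v <- s) enorm v.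
  by rewrite big_seq; apply: prodr_gt0 => v vs; rewrite lt_def nz ?enorm_ge0.
rewrite -ler_pdivrMr // -[X in _ / X]gtr0_norm // -normfV -normrM mulrC -prodc.
rewrite mulrBr -!dseq_homogeneous ?sk //; apply: le_trans hB.
have szt : size (map (fun v => c v *: v) s) == k by rewrite size_map sk.
rewrite /tnorm; apply: ub_le_sup; last first.
  exists (Tuple szt) => //= j; have js : (j < size s)%N by rewrite sk.
  rewrite (tnth_nth 0) /= (nth_map 0) // enormZ ger0_norm ?invr_ge0 ?enorm_ge0 //.
  by rewrite mulVf // nz // mem_nth.
(* [sup] has a default value on unbounded sets, so boundedness over unit tuples must be proved
   before [tnorm] says anything; the basis expansion provides it. *)
have bnd g z : times_differentiable k g -> exists m : R, forall t : k.-tuple V,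
    (forall j, enorm (tnth t j) = 1) -> `|dseq t g z| <= m.
  move=> dg; exists ((\sum_(kap : k.-tuple 'I_n) `|dseq (map bvec kap) g z|) * n%:R ^+ k).
  move=> t t1; apply: le_trans (dseq_basis_bound (m := \sum_(kap : k.-tuple 'I_n) `|dseq (map bvec kap) g z|) dg _ _) _.
  - move=> kap /eqP sk'; rewrite (bigD1 (Tuple sk')) //= lerDl.
    exact: sumr_ge0.
  - exact: size_tuple.
  rewrite (_ : \prod_(v <- t) _ = n%:R ^+ k) //.
  rewrite big_tuple (eq_bigr (fun=> n%:R)) => [|j _]; last by rewrite t1 mulr1.
  by rewrite prodr_const card_ord.
have [m1 h1] := bnd g1 x d1; have [m2 h2] := bnd g2 y d2.
exists (m1 + m2) => _ [t t1 <-].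
by apply: le_trans (ler_normB _ _) _; apply: lerD; [exact: h1 | exact: h2].
Qed.

(** Normalized monomials: each is the derivative of the next, which keeps factorials out of the
    induction in [taylor_1d]. *)
Definition dpow (j : nat) (t : R) : R := t ^+ j / j`!%:R.

Lemma is_derive_dpow j (t : R) : is_derive t 1 (dpow j.+1) (dpow j t).
Proof.
have dX : is_derive t 1 (fun x : R => x ^+ j.+1) (j.+1%:R * t ^+ j).
  apply: DeriveDef; first exact: exprn_derivable.
  by rewrite exp_derive /= [_ *: _]mulr1.
have := is_deriveZ (j.+1)`!%:R^-1 dX.
rewrite (_ : _ \*: _ = dpow j.+1); last by apply/funext => x; rewrite /dpow mulrC.
move=> h; apply: is_derive_eq h _.
transitivity ((j.+1 * j`!)%N%:R^-1 * (j.+1%:R * t ^+ j)); first by rewrite -factS.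
by rewrite natrM invfM mulrACA mulVf ?pnatr_eq0 // mul1r mulrC.
Qed.

(** [g j] stands for the j-th derivative of [g 0]. The induction hypothesis bounds the derivative of
    the remainder; the mean value theorem for [L \*: dpow k.+2] plus and minus the remainder then
    plays the role of integration. *)
Lemma taylor_1d (k : nat) (g : nat -> R -> R) (L : R) :
  (forall j (t : R), (j < k)%N -> is_derive t 1 (g j) (g j.+1 t)) ->
  (forall t, 0 <= t -> `|g k t - g k 0| <= L * t) ->
  forall t, 0 <= t ->
    `|g 0%N t - \sum_(j < k.+1) g j 0 * dpow j t| <= L * dpow k.+1 t.
Proof.
elim: k g => [|k IH] g dg gL t t0.
  rewrite big_ord_recl big_ord0 /dpow expr0 divr1 mulr1 addr0 expr1 divr1.
  exact: gL.
have [->|tn0] := eqVneq t 0.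
  rewrite big_ord_recl big1 => [|j _]; last by rewrite /dpow expr0n mul0r mulr0.
  by rewrite /dpow !expr0n /= divr1 mulr1 addr0 subrr normr0 mul0r mulr0.
have {t0 tn0}t0 : 0 < t by rewrite lt_def tn0.
pose psi' (x : R) := g 1%N x - \sum_(j < k.+1) g j.+1 0 * dpow j x.
pose psi (x : R) := g 0%N x - \sum_(j < k.+2) g j 0 * dpow j x.
have dpsi (x : R) : is_derive x 1 psi (psi' x).
  have ds : is_derive x 1 (fun y => \sum_(j < k.+2) g j 0 * dpow j y)
      (\sum_(j < k.+1) g j.+1 0 * dpow j x).
    have hj (j : 'I_k.+1) : is_derive x 1 (g j.+1 0 \*: dpow j.+1) (g j.+1 0 * dpow j x).
      exact: is_deriveZ (is_derive_dpow j x).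
    have -> : (fun y => \sum_(j < k.+2) g j 0 * dpow j y) =
        cst (g 0%N 0) + \sum_(j < k.+1) (g j.+1 0 \*: dpow j.+1).
      apply/funext => y; rewrite big_ord_recl [X in _ * X]/dpow expr0 divr1 mulr1.
      by rewrite fctE fct_sumE.
    rewrite -[X in is_derive _ _ _ X]add0r.
    exact: is_deriveD (is_derive_cst (g 0%N 0 : R) x 1) (is_derive_sum hj).
  exact: is_deriveB (dg 0%N x isT) ds.
have bnd (x : R) : 0 <= x -> `|psi' x| <= L * dpow k.+1 x.
  by apply: (IH (fun j => g j.+1)) => [j y jk|]; [exact: dg|exact: gL].
have psi0 : psi 0 = 0.
  rewrite /psi big_ord_recl big1 => [|j _]; last by rewrite /dpow expr0n mul0r mulr0.
  by rewrite /dpow expr0 divr1 mulr1 addr0 subrr.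
have dPhi (x : R) : is_derive x 1 (L \*: dpow k.+2) (L * dpow k.+1 x).
  exact: is_deriveZ (is_derive_dpow _ _).
have Phi0 : (L \*: dpow k.+2) 0 = 0.
  by rewrite /= /dpow expr0n mul0r; exact: mulr0.
rewrite -/(psi t) ler_norml; apply/andP; split.
  have [c /andP[c0 ct] E] := MVT0 t0 (fun x => is_deriveD (dPhi x) (dpsi x)).
  have : 0 <= L * dpow k.+2 t + psi t.
    have -> : L * dpow k.+2 t + psi t = (L * dpow k.+1 c + psi' c) * t.
      by rewrite -E !fctE Phi0 psi0 !addr0 subr0.
    apply: mulr_ge0; last exact: ltW.
    have := bnd c (ltW c0); rewrite ler_norml => /andP[].
    by move=> l _; rewrite -lerBlDl sub0r.
  by rewrite -lerBlDl sub0r.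
have [c /andP[c0 ct] E] := MVT0 t0 (fun x => is_deriveB (dPhi x) (dpsi x)).
rewrite -subr_ge0.
have -> : L * dpow k.+2 t - psi t = (L * dpow k.+1 c - psi' c) * t.
  by rewrite -E !fctE Phi0 psi0 !subr0.
apply: mulr_ge0; last exact: ltW.
rewrite subr_ge0; have := bnd c (ltW c0).
by rewrite ler_norml => /andP[].
Qed.

Lemma taylor_line (k : nat) g x h (L : R) : times_differentiable k g ->
  (forall t, 0 <= t ->
    `|dseq (nseq k h) g (x + t *: h) - dseq (nseq k h) g x| <= L * t) ->
  `|g (x + h) - \sum_(j < k.+1) dseq (nseq j h) g x / j`!%:R| <= L / (k.+1)`!%:R.
Proof.
move=> dg gL.
have := @taylor_1d k (fun j (t : R) => dseq (nseq j h) g (x + t *: h)) L.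
rewrite scale0r addr0 => H; have {H} := H _ gL 1 ler01.
rewrite scale1r /dpow expr1n div1r.
under eq_bigr do rewrite expr1n div1r; apply => j t jk.
apply: is_derive_line.
by apply: dseq_differentiable dg _; rewrite size_nseq.
Qed.

(* Along h + s *: u the form is a polynomial in s with the coefficients c. *)
Lemma is_derive_tpow (k i : nat) f x h u : times_differentiable k f ->
  (0 < i <= k)%N ->
  is_derive (0 : R) 1 (fun s : R => dseq (nseq i (h + s *: u)) f x)
    (i%:R * dseq (u :: nseq i.-1 h) f x).
Proof.
move=> df /andP[i0 ik].
suff: exists c : nat -> V -> R, [/\ forall j, times_differentiable (k - i) (c j),
    c 0%N = dseq (nseq i h) f,
    forall y, (0 < i)%N -> c 1%N y = i%:R * dseq (u :: nseq i.-1 h) f y,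
    forall j, (i < j)%N -> c j = cst 0 &
    forall (r : R) y, dseq (nseq i (h + r *: u)) f y = \sum_(j < i.+1) r ^+ j * c j y].
  move=> [c [_ _ c1 _ cE]].
  under eq_fun do rewrite cE; rewrite -c1 //.
  have -> : (fun s : R => \sum_(j < i.+1) s ^+ j * c j x) =
      horner (\poly_(j < i.+1) c j x).
    by apply/funext => s; rewrite horner_poly; apply: eq_bigr => j _; rewrite mulrC.
  apply: DeriveDef; first exact: derivable_horner.
  rewrite -derive1E -derivE horner_coef0 coef_deriv coef_poly ltnS.
  by rewrite i0.
elim: i ik {i0} => [_|i IH ik].
  exists (fun j => if j == 0%N then f else cst 0); split => //.
  - by rewrite subn0 => -[|j]//; exact: tdiff_cst.
  - by move=> [].
  - by move=> s y; rewrite big_ord_recl big_ord0 mul1r addr0.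
have [c [dc c0 c1 cz cE]] := IH (ltnW ik).
have dS : forall j, times_differentiable (k - i.+1).+1 (c j).
  by move=> j; rewrite subnSK.
have dcd j (y : V) : differentiable (c j) y by have [+ _] := dS j; exact.
exists (fun j => if j is j'.+1 then (fun y => 1 * 'D_h (c j'.+1) y + 'D_u (c j') y)
  else 'D_h (c 0%N)); split.
- case=> [|j]; first by have [_] := dS 0%N; exact.
  by apply: tdiff_lin; [have [_] := dS j.+1; exact | have [_] := dS j; exact].
- by rewrite c0.
- move=> y _; rewrite mul1r c0.
  case: i IH ik c1 cz {dc c0 cE dS dcd} => [|i] IH ik c1 cz.
    by rewrite cz // derive_cst add0r mul1r.
  have -> : c 1%N = (fun z => i.+1%:R * dseq (u :: nseq i h) f z).
    by apply/funext => z; rewrite c1.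
  have dd z : differentiable (dseq (u :: nseq i h) f) z.
    by apply: dseq_differentiable df _; rewrite /= size_nseq.
  rewrite (derive_scale_at _ _ (dd y)).
  (* [h] is the newest direction; moved behind [u], its i+1 copies join the single one that comes
     from ['D_u (c 0)]. *)
  have -> : 'D_h (dseq (u :: nseq i h) f) y = dseq [:: u, h & nseq i h] f y.
    apply: schwarz_at; apply: tdiff_dseq; rewrite size_nseq addn2.
    exact: tdiffW ik df.
  by rewrite -[i.+2%:R]natr1 mulrDl mul1r.
- case=> [//|j] ij; rewrite (cz j.+1) ?(cz j) //; last by rewrite ltnW.
  by apply/funext => y; rewrite !derive_cst mulr0 addr0.
move=> s y; rewrite [LHS]/= -/(dseq _ f).
have -> : dseq (nseq i (h + s *: u)) f = fun z => 1 * \sum_(j <- enum 'I_i.+1) s ^+ j * c j z.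
  by apply/funext => z; rewrite cE mul1r big_enum.
have dj (j : 'I_i.+1) : times_differentiable 1 (fun z => s ^+ j * c j z).
  by apply: tdiff_scale; apply: tdiffW (dS j).
have dsum w := @dseq_sum R n [:: w] 'I_i.+1 (enum 'I_i.+1) 1 _ y dj.
rewrite -[LHS]/(dseq [:: h + s *: u]
  (fun z => 1 * \sum_(j <- enum 'I_i.+1) s ^+ j * c j z) y) dsum mul1r big_enum /=.
have -> : \sum_(j < i.+1) 'D_(h + s *: u) (fun z => s ^+ j * c j z) y =
  \sum_(j < i.+1) s ^+ j * ('D_h (c j) y + s * 'D_u (c j) y).
  apply: eq_bigr => j _.
  rewrite (derive_scale_at _ _ (dcd j y)); congr (_ * _).
  by rewrite addrC derive_dirD // addrC.

under [LHS]eq_bigr do rewrite mulrDr mulrA -exprSr.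
rewrite big_split /= big_ord_recl expr0 mul1r [RHS]big_ord_recl expr0 mul1r -addrA.
congr (_ + _); transitivity (\sum_(j < i.+1) (s ^+ j.+1 * 'D_h (c j.+1) y +
    s ^+ j.+1 * 'D_u (c j) y)); last first.
  by apply: eq_bigr => j _; rewrite /= mul1r mulrDr.
rewrite big_split /=; congr (_ + _).
by rewrite [RHS]big_ord_recr /= cz // derive_cst mulr0 addr0.
Qed.

Lemma convex_gradient f x y : convex_function setT f -> differentiable f x ->
  f x + 'D_(y - x) f x <= f y.
Proof.
move=> cf dx; rewrite -lerBrDl; apply/ler_addgt0Pr => e e0.
set w := y - x.
have w1 : 0 < `|w| + 1 by rewrite ltr_pwDr.
have [d d0 H] := differentiable_near dx (divr_gt0 e0 w1).
pose t := Num.min 1 (d / (`|w| + 1) / 2).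
have t0 : 0 < t by rewrite lt_min ltr01 !divr_gt0.
have t1 : t <= 1 by rewrite ge_min lexx.
have td : t * (`|w| + 1) < d.
  rewrite -ltr_pdivlMr //; apply: le_lt_trans (_ : d / (`|w| + 1) / 2 < _).
    by rewrite ge_min lexx orbT.
  by rewrite ltr_pdivrMr // ltr_pMr ?divr_gt0 // ltr1n.
have tw : `|t *: w| <= t * (`|w| + 1).
  by rewrite normrZ gtr0_norm // ler_pM2l // lerDl.
have {}H := H _ (le_lt_trans tw td).
have cE : f (t *: y + (1 - t) *: x) <= t * f y + (1 - t) * f x.
  by apply: (cf (Itv01 (ltW t0) t1) y x); rewrite inE.
have wE : t *: y + (1 - t) *: x = x + t *: w.
  by rewrite scalerBl scale1r scalerBr addrCA.
rewrite {}wE in cE.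
rewrite derive_dirZ // in H.
have {}H := le_trans H (ler_wpM2l (ltW (divr_gt0 e0 w1)) tw).
move: H; rewrite ler_distlC => /andP[_ H].
have : t * 'D_w f x <= t * (f y - f x + e).
  rewrite [_ / _ * _]mulrC -mulrA [(_ + _) * _]mulrC divfK ?gt_eqF // in H.
  by rewrite mulrDr; lra.
by rewrite ler_pM2l.
Qed.

Lemma is_derive_sum_seq (I : eqType) (r : seq I) (phi : I -> R -> R) (d : I -> R) (x : R) :
  (forall i, i \in r -> is_derive x 1 (phi i) (d i)) ->
  is_derive x 1 (fun t => \sum_(i <- r) phi i t) (\sum_(i <- r) d i).
Proof.
elim: r => [|i r IH] H.
  rewrite big_nil; under eq_fun do rewrite big_nil; exact: is_derive_cst.
rewrite big_cons; under eq_fun do rewrite big_cons.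
apply: is_deriveD; first by apply: H; rewrite mem_head.
by apply: IH => j jr; apply: H; rewrite inE jr orbT.
Qed.

Lemma derive_at_argmin (phi : R -> R) (d : R) : is_derive (0 : R) 1 phi d ->
  (forall t, phi 0 <= phi t) -> d = 0.
Proof.
move=> [dphi <-] pmin; set D := 'D_1 phi 0.
have cv : (fun h : R => h^-1 * (phi (h *: (1 : R^o) + 0) - phi 0)) @ 0^' --> D by exact: dphi.
apply/eqP; rewrite -normr_le0; apply/ler_addgt0Pl => e e0; rewrite addr0.
move/cvgrPdist_le : cv => /(_ e e0) /=.
rewrite near_withinE => /nbhs_normP[r r0 H].
have H1 (s : R) : s != 0 -> `|s| < r -> `|D - s^-1 * (phi s - phi 0)| <= e.
  move=> s0 sr; have := H s; rewrite /= sub0r normrN => /(_ sr s0).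
  by rewrite [s *: 1]mulr1 addr0.
have r2 : 0 < r / 2 by rewrite divr_gt0.
have rr : r / 2 < r by rewrite ltr_pdivrMr // ltr_pMr // ltr1n.
have := H1 (r / 2); rewrite gt_eqF // gtr0_norm // => /(_ isT rr).
have := H1 (- (r / 2)); rewrite oppr_eq0 gt_eqF // normrN gtr0_norm // => /(_ isT rr).
rewrite !ler_distl invrN mulNr.
set q1 := _^-1 * _; set q2 := _^-1 * _.
have q10 : 0 <= q1 by rewrite mulr_ge0 ?invr_ge0 ?(ltW r2) ?subr_ge0.
have q20 : 0 <= q2 by rewrite mulr_ge0 ?invr_ge0 ?(ltW r2) ?subr_ge0.
clearbody q1 q2 D => /andP[a1 a2] /andP[b1 b2].
by rewrite ler_norml; apply/andP; split; lra.
Qed.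

End Tensors.

(** * Numerical inequalities behind the constants of the method *)

Section Numerics.
Context {R : realType}.

Lemma bernoulli (x : R) m : -1 <= x -> 1 + m%:R * x <= (1 + x) ^+ m.
Proof.
move=> x1; elim: m => [|m IH]; first by rewrite mul0r addr0 expr0.
rewrite exprS; apply: le_trans (_ : (1 + x) * (1 + m%:R * x) <= _).
  by rewrite -natr1; have := mulr_ge0 (ler0n R m) (sqr_ge0 x); lra.
by apply: ler_wpM2l => //; lra.
Qed.

(* (1 - 1/k)^k increases with k, and equals 8/27 at k = 3. *)
Lemma pow_ratio_mono m : (8 / 27 : R) <= (m.+2%:R / m.+3%:R) ^+ m.+3.
Proof.
elim: m => [|m IH].
  by rewrite !exprS expr0; lra.
apply: le_trans IH _.
set q := m.+2%:R / m.+3%:R : R; set q' := m.+3%:R / m.+4%:R : R.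
pose x : R := (m.+2%:R * m.+4%:R)^-1.
have x0 : 0 <= x by rewrite invr_ge0 mulr_ge0.
have qE : q' = q * (1 + x).
  by rewrite /q /q' /x -!natr1; field; rewrite !natr1 !pnatr_eq0.
have q'0 : 0 <= q' by rewrite divr_ge0.
have -> : q' ^+ m.+4 = q ^+ m.+3 * (q' * (1 + x) ^+ m.+3).
  by rewrite exprS [RHS]mulrCA -exprMn -qE.
apply: ler_peMr; first by rewrite exprn_ge0 // divr_ge0.
apply: le_trans (_ : q' * (1 + m.+3%:R * x) <= _); last first.
  by rewrite ler_wpM2l // bernoulli // (le_trans _ x0) // oppr_le0.
have -> : q' * (1 + m.+3%:R * x) = 1 + (m.+2%:R * m.+4%:R * m.+4%:R)^-1.
  by rewrite /q' /x -!natr1; field; rewrite !natr1 !pnatr_eq0.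
by rewrite lerDl invr_ge0 !mulr_ge0.
Qed.

(** The case i = 3 of [young_ge3], as 2/15 * 9/5 = 6/25. For fixed z the worst r is z / sqrt 2,
    close to 71/100 z, where the negative part is about 0.2357 z^3; the expression (r - 71/100 z)^2
    (r + 142/100 z) is a nonnegative cubic nearly touching zero there. *)
Lemma cubic (r z : R) : 0 <= r -> 0 <= z ->
  0 <= 6 / 25 * z ^+ 3 + r * (r ^+ 2 / 3 - z ^+ 2 / 2).
Proof.
move=> r0 z0.
have h1 : 0 <= (r - 71 / 100 * z) ^+ 2 * (r + 142 / 100 * z).
  by apply: mulr_ge0; [exact: sqr_ge0 | lra].
have h2 : 0 <= z ^+ 3 by exact: exprn_ge0.
have h3 : 0 <= r * z ^+ 2 by rewrite mulr_ge0 // sqr_ge0.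
rewrite !exprS expr0 in h1 h2 h3 *; lra.
Qed.

(** The base 6(i-1)/(i sqrt 5) in [kappa] is 2 [th] (i-1)/i. *)
Local Notation th := (3 / Num.sqrt 5 : R).

Let s5 : (0 : R) < Num.sqrt 5. Proof. by rewrite sqrtr_gt0. Qed.

Let th2 : th ^+ 2 = 9 / 5.
Proof. by rewrite expr_div_n sqr_sqrtr // -natrX. Qed.

Let th0 : 0 < th. Proof. by rewrite divr_gt0. Qed.

Let th1 : 4 / 3 <= th.
Proof.
rewrite -(@ler_pXn2r _ 2) ?nnegrE ?ltW // th2; by rewrite expr_div_n; lra.
Qed.

(** If r <= th z, taking r^j out of both terms reduces to [cubic]. If r > th z, then r^2/3 >= 3/5
    z^2 because th^2 = 9/5, and the second term alone is nonnegative. *)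
Lemma young_ge3 j (b r z : R) : 0 <= r -> 0 <= z ->
  2 / 15 * th ^+ j.+2 <= b ->
  0 <= b * z ^+ j.+3 + r ^+ j.+1 * (r ^+ 2 / 3 - z ^+ 2 / 2).
Proof.
move=> r0 z0 hb.
apply: le_trans (_ : 2 / 15 * th ^+ j.+2 * z ^+ j.+3 +
   r ^+ j.+1 * (r ^+ 2 / 3 - z ^+ 2 / 2) <= _); last first.
  by rewrite lerD2r ler_wpM2r // exprn_ge0.
have [le_r|lt_r] := leP r (th * z).
  apply: le_trans (_ : r ^+ j * (6 / 25 * z ^+ 3 + r * (r ^+ 2 / 3 - z ^+ 2 / 2)) <= _).
    by rewrite mulr_ge0 ?exprn_ge0 // cubic.
  rewrite mulrDr mulrA -exprSr lerD2r.
  rewrite (_ : 2 / 15 * th ^+ j.+2 * z ^+ j.+3 = (th * z) ^+ j * (6 / 25 * z ^+ 3)).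
    by rewrite ler_wpM2r ?mulr_ge0 ?exprn_ge0 // lerXn2r ?nnegrE ?mulr_ge0 ?(ltW th0).
  have -> : th ^+ j.+2 = th ^+ j * (9 / 5) by rewrite -th2 -exprD addn2.
  have -> : z ^+ j.+3 = z ^+ j * z ^+ 3 by rewrite -exprD addn3.
  rewrite [(th * z) ^+ j]exprMn; move: (th ^+ j) (z ^+ j) (z ^+ 3) => a c d; by field.
apply: addr_ge0.
  apply: mulr_ge0; last exact: exprn_ge0.
  by apply: mulr_ge0; [lra | exact: exprn_ge0 (ltW th0)].
rewrite mulr_ge0 ?exprn_ge0 //.
have : (th * z) ^+ 2 <= r ^+ 2.
  by rewrite lerXn2r ?nnegrE ?mulr_ge0 ?(ltW th0) // ltW.
by rewrite [(th * z) ^+ 2]exprMn th2; have := sqr_ge0 r; lra.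
Qed.

(** The growth constant at the minimizer that m bisections extract from Clarkson's inequality; the
    recursion is the induction step of [psi_growth]. *)
Fixpoint kk (m i : nat) : R :=
  if m is m'.+1 then 2 / 2 ^+ i * (1 + kk m' i) else 0.

Lemma kk_ge0 m i : 0 <= kk m i.
Proof. by elim: m => //= m IH; rewrite mulr_ge0 ?divr_ge0 ?exprn_ge0 ?addr_ge0. Qed.

(** The growth of [psi] pays for the tensor step at order i, with [z] standing for alpha_t times the
    displacement of y. The 9/10 is the lower bound for 1 - alpha_t at late times; r^2/3 is what
    remains of the 4/9 in [step_geometry] once 1/9 has absorbed first-order noise. *)
Lemma young_term (p i : nat) (r z : R) : (2 <= p)%N -> (2 <= i <= p.+1)%N ->
  0 <= r -> 0 <= z ->
  0 <= 9 / 10 * (p%:R / (2 * i%:R)) * (6 * i.-1%:R / (i%:R * Num.sqrt 5)) ^+ i.-1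
       * kk 3 i * z ^+ i + r ^+ (i - 2) * (r ^+ 2 / 3 - z ^+ 2 / 2).
Proof.
move=> p2 /andP[i2 ip] r0 z0.
case: i i2 ip => [|[|[|j]]] // _ ip.
  rewrite subnn !expr0 mul1r expr1.
  (* At order 2 the coefficient of z^2 must reach 1/2. For p = 2 it does so with 7/8, but not with
     the 3/4 of two bisections. *)
  have -> : kk 3 2 = 7 / 8 by rewrite /= !exprS expr0; lra.
  have -> : 6 * 1%:R / (2 * Num.sqrt 5) = th.
    by field; rewrite gt_eqF.
  have p2R : (2 : R) <= p%:R by rewrite ler_nat.
  have z2 := sqr_ge0 z; have r2 := sqr_ge0 r.
  have h : 1 / 2 <= 9 / 10 * (p%:R / (2 * 2)) * th * (7 / 8).
    apply: le_trans (_ : 9 / 10 * (2 / (2 * 2)) * (4 / 3) * (7 / 8) <= _).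
      lra.
    rewrite ler_wpM2r // ler_pM // ?ler_wpM2l //.
    by rewrite ler_wpM2r.
  have := ler_wpM2r z2 h; lra.
rewrite !subSS subn0; apply: young_ge3 => //.
have s50 : Num.sqrt 5 != 0 :> R by rewrite gt_eqF.
(* From order 3 on one midpoint is enough: with p >= i-1 the coefficient becomes 9/20 th^(i-1)
   ((i-1)/i)^i, and 9/20 * 8/27 = 2/15. *)
have h1 : 2 / 2 ^+ j.+3 <= kk 3 j.+3.
  have := kk_ge0 2 j.+3; rewrite [kk 3 _]/= -/(kk 2 j.+3) => k0.
  by rewrite ler_peMr ?lerDl // divr_ge0 // exprn_ge0.
have ipR : (j.+2%:R : R) <= p%:R by rewrite ler_nat.
apply: le_trans (_ : 9 / 10 * (j.+2%:R / (2 * j.+3%:R)) *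
   (6 * j.+2%:R / (j.+3%:R * Num.sqrt 5)) ^+ j.+2 * (2 / 2 ^+ j.+3) <= _).
  have -> : 9 / 10 * (j.+2%:R / (2 * j.+3%:R)) *
   (6 * j.+2%:R / (j.+3%:R * Num.sqrt 5)) ^+ j.+2 * (2 / 2 ^+ j.+3)
   = 9 / 20 * th ^+ j.+2 * (j.+2%:R / j.+3%:R) ^+ j.+3.
    have -> : 6 * j.+2%:R / (j.+3%:R * Num.sqrt 5) = 2 * th * (j.+2%:R / j.+3%:R).
      have : (j.+3%:R : R) != 0 by rewrite pnatr_eq0.
      by move: (j.+2%:R : R) (j.+3%:R : R) => a b b0; field; rewrite s50 b0.
    have -> : j.+2%:R / (2 * j.+3%:R) = (j.+2%:R / j.+3%:R) / 2 :> R.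
      by rewrite invfM mulrA mulrAC.
    move: (j.+2%:R / j.+3%:R) => q.
    rewrite (exprMn _ (2 * th) q) (exprMn _ 2 th) [2 ^+ j.+3]exprS [q ^+ j.+3]exprS.
    have : (2 : R) ^+ j.+2 != 0 by rewrite expf_neq0.
    by move: (th ^+ j.+2) (2 ^+ j.+2) (q ^+ j.+2) => a b c b0; field.
  rewrite (_ : 2 / 15 * th ^+ j.+2 = 9 / 20 * th ^+ j.+2 * (8 / 27)); last by field.
  by rewrite ler_wpM2l ?pow_ratio_mono // mulr_ge0 // exprn_ge0 // ltW.
have nn (k : nat) : 0 <= (6 * j.+2%:R / (j.+3%:R * Num.sqrt 5)) ^+ k :> R.
  by rewrite exprn_ge0 // divr_ge0 ?mulr_ge0 // ltW.
apply: ler_pM => //.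

apply: ler_wpM2r => //; apply: ler_wpM2l => //.
by rewrite ler_wpM2r // invr_ge0 mulr_ge0.
Qed.

(** * The weights alpha, A and kappa *)

Section Coefficients.
Context (p : nat) (Lp sigma : R) (eta delta : nat -> R).
Hypothesis p_ge2 : (2 <= p)%N.

Lemma alpha_gt0 t : 0 < alpha p t :> R.
Proof. by rewrite divr_gt0 // ltr0n addnS. Qed.

Lemma one_alpha t : 1 - alpha p t = t%:R / (t + p.+1)%N%:R :> R.
Proof.
rewrite /alpha natrD.
by have h : (t%:R + p.+1%:R : R) != 0; [rewrite -natrD pnatr_eq0 addnS | field].
Qed.

Lemma alpha_anti s t : (s <= t)%N -> alpha p t <= alpha p s :> R.
Proof.
move=> st; rewrite /alpha ler_pM2l // lef_pV2 ?posrE ?ltr0n ?addnS //.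
by rewrite ler_nat ltnS leq_add2r.
Qed.

Lemma Aprod0 : Aprod p 0 = 1 :> R.
Proof. by rewrite /Aprod big_geq. Qed.

Lemma AprodS t : Aprod p t.+1 = Aprod p t * (1 - alpha p t.+1) :> R.
Proof. by rewrite /Aprod big_nat_recr. Qed.

Lemma Aprod_gt0 t : 0 < Aprod p t :> R.
Proof.
elim: t => [|t IH]; first by rewrite Aprod0.
by rewrite AprodS mulr_gt0 // one_alpha divr_gt0 // ltr0n addnS.
Qed.

Lemma one_alpha_le1 t : 1 - alpha p t <= 1 :> R.
Proof. by rewrite gerBl ltW // alpha_gt0. Qed.

Lemma Aprod_anti s t : (s <= t)%N -> Aprod p t <= Aprod p s :> R.
Proof.
move=> /subnKC <-; elim: (t - s)%N => [|k IH]; first by rewrite addn0.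
rewrite addnS AprodS; apply: le_trans IH.
by rewrite ler_piMr ?one_alpha_le1 // ltW // Aprod_gt0.
Qed.

(** The product telescopes to t! (p+1)! / (t+p+1)!, and the last p+1 factors of (t+p+1)! are at
    least t+1. This is the source of the rate T^-(p+1). *)
Lemma Aprod_le t : Aprod p t * t.+1%:R ^+ p.+1 <= (p.+1)`!%:R :> R.
Proof.
have E : Aprod p t * (t + p.+1)`!%:R = t`!%:R * (p.+1)`!%:R :> R.
  elim: t => [|t IH]; first by rewrite Aprod0 add0n fact0.
  rewrite AprodS one_alpha addSn factS natrM [t.+1`!]factS natrM.
  have : (t.+1 + p.+1)%N%:R != 0 :> R by rewrite pnatr_eq0.
  rewrite addSn => h0.
  transitivity (t.+1%:R * (Aprod p t * (t + p.+1)`!%:R) : R); last by rewrite IH; ring.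
  by field.
have F : (t`! * t.+1 ^ p.+1 <= (t + p.+1)`!)%N.
  elim: p.+1 => [|k IH]; first by rewrite addn0 muln1.
  rewrite addnS factS expnS mulnCA leq_mul // ltnS leq_addr //.
rewrite -(@ler_pM2l _ t`!%:R) ?ltr0n ?fact_gt0 // -E mulrCA.
by rewrite ler_wpM2l ?(ltW (Aprod_gt0 t)) // -natrX -natrM ler_nat.
Qed.

(** Makes the sums of alpha_t / A_t telescope, both in the accumulated noise and in the upper bound
    on [psi]. *)
Lemma inv_AprodS t : (Aprod p t.+1)^-1 - (Aprod p t)^-1
  = alpha p t.+1 / Aprod p t.+1 :> R.
Proof.
have A0 : Aprod p t != 0 :> R by rewrite gt_eqF // Aprod_gt0.
have A1 := gt_eqF (Aprod_gt0 t.+1); move: (A1); rewrite AprodS => A2.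
have : 1 - alpha p t.+1 != 0 :> R.
  by apply: contraFneq A2 => ->; rewrite mulr0.
by move: (alpha p t.+1) => a a0; field; rewrite A0 a0.
Qed.

(* The weight of order i in the regularization of the tensor steps. *)
Definition wreg (i : nat) : R := if i == p.+1 then p%:R * sigma else eta i * delta i.

Hypotheses (Lp_ge0 : 0 <= Lp) (sigma_ge : 3 * Lp <= p%:R * sigma)
  (eta_ge3 : forall i, (2 <= i <= p)%N -> 3 <= eta i)
  (delta_gt0 : forall i, (2 <= i <= p)%N -> 0 < delta i).

Lemma range_split i : (2 <= i < p.+2)%N -> i = p.+1 \/ (i == p.+1) = false /\ (2 <= i <= p)%N.
Proof. by move=> h; case: eqP => [->|]; [left|right; lia]. Qed.

Lemma wreg_ge0 i : (2 <= i < p.+2)%N -> 0 <= wreg i.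
Proof.
rewrite /wreg => /range_split[->|[-> h]]; first by rewrite eqxx (le_trans _ sigma_ge) // mulr_ge0.
by rewrite mulr_ge0 ?(ltW (delta_gt0 h)) // (le_trans _ (eta_ge3 h)).
Qed.

Definition kcoef (i : nat) : R :=
  p%:R / 2 * (6 * i.-1%:R / (i%:R * Num.sqrt 5)) ^+ i.-1.

Lemma kcoef_ge0 i : 0 <= kcoef i.
Proof. by rewrite mulr_ge0 ?divr_ge0 // exprn_ge0 // divr_ge0 ?mulr_ge0 ?(ltW s5). Qed.

Definition kwgt (i : nat) : R :=
  if i == p.+1 then 2 * Lp + p%:R * sigma else (eta i + 2) * delta i.

Lemma kappaE t i : kappa p Lp sigma eta delta t i
  = kcoef i * (alpha p t ^+ i / Aprod p t) * kwgt i.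
Proof. by []. Qed.

Lemma wreg_le_kwgt i : (2 <= i < p.+2)%N -> wreg i <= kwgt i.
Proof.
rewrite /wreg /kwgt => /range_split[->|[-> h]].
  by rewrite eqxx lerDr mulr_ge0.
by rewrite ler_wpM2r ?lerDl ?(ltW (delta_gt0 h)).
Qed.

Lemma kappa_ge0 t i : (2 <= i < p.+2)%N -> 0 <= kappa p Lp sigma eta delta t i.
Proof.
move=> h; rewrite kappaE mulr_ge0 //; last exact: le_trans (wreg_ge0 h) (wreg_le_kwgt h).
by rewrite mulr_ge0 ?kcoef_ge0 // divr_ge0 ?exprn_ge0 ?ltW ?alpha_gt0 ?Aprod_gt0.
Qed.

(** Ensures that the regularizer added to [psi] at each step is nonnegative. As i <= p+1, the
    exponent p+1 is the worst; there Bernoulli's inequality for b = alpha_(t+1)/alpha_t gives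
    b^(p+1) >= 1 - alpha_(t+1), which is exactly what the division by A requires. *)
Lemma kappa_mono t i : (2 <= i < p.+2)%N ->
  kappa p Lp sigma eta delta t i <= kappa p Lp sigma eta delta t.+1 i.
Proof.
move=> h; have w0 := le_trans (wreg_ge0 h) (wreg_le_kwgt h).
rewrite !kappaE ler_wpM2r // ler_wpM2l ?kcoef_ge0 //.
rewrite ler_pdivrMr ?Aprod_gt0 // AprodS [Aprod p t * _]mulrC invfM mulrA divfK; last first.
  by rewrite gt_eqF // Aprod_gt0.
have a1 : 0 < 1 - alpha p t.+1 :> R by rewrite one_alpha divr_gt0 // ltr0n addnS.
rewrite ler_pdivlMr //.
pose b : R := 1 - (t + p.+2)%N%:R^-1.
have h0 : (t + p.+2)%N%:R != 0 :> R by rewrite pnatr_eq0 addnS.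
have b0 : 0 <= b by rewrite subr_ge0 invf_le1 ?ltr0n ?addnS // ler1n.
have b1 : b <= 1 by rewrite gerBl invr_ge0.
have aE : alpha p t.+1 = alpha p t * b :> R.
  rewrite /b /alpha addSnnS; move: h0; rewrite addnS -natr1.
  have : (t + p.+1)%N%:R != 0 :> R by rewrite pnatr_eq0 addnS.
  move: (t + p.+1)%N%:R (p.+1%:R : R) => N q N0 N1.
  by field; rewrite N1 N0.
have -> : alpha p t.+1 ^+ i = alpha p t ^+ i * b ^+ i :> R by rewrite aE exprMn.
apply: ler_wpM2l; first exact/exprn_ge0/ltW/alpha_gt0.
apply: le_trans (_ : b ^+ p.+1 <= _); last first.
  by apply: ler_wiXn2l => //; move: h => /andP[].
apply: le_trans (@bernoulli (- (t + p.+2)%N%:R^-1) p.+1 _).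
  rewrite one_alpha addSnnS -(@ler_pM2r _ (t + p.+2)%N%:R) ?ltr0n ?addnS // -addnS.
  rewrite divfK // mulrDl mul1r mulrN mulNr divfK //.
  by rewrite lerBrDr -natrD ler_nat; lia.
by rewrite lerN2 invf_le1 ?ltr0n ?addnS // ler1n.
Qed.

End Coefficients.
End Numerics.

(** * One inexact tensor step *)

Section TensorStep.
Context {R : realType} {n : nat}.
Local Notation V := 'rV[R]_n.
Context (p : nat) (Lp sigma : R) (f : V -> R).
Hypotheses (p_ge2 : (2 <= p)%N) (f_diff : times_differentiable p f).
Hypothesis f_lip : forall (s : seq V) a b, size s = p ->
  `|dseq s f a - dseq s f b| <= Lp * enorm (a - b) * \prod_(v <- s) enorm v.

Lemma enorm_line (a h : V) (t : R) : 0 <= t -> enorm (a + t *: h - a) = t * enorm h.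
Proof. by move=> t0; rewrite addrC addKr enormZ ger0_norm. Qed.

Lemma taylor_value (a b : V) :
  `|f b - \sum_(0 <= j < p.+1) dseq (nseq j (b - a)) f a / j`!%:R|
  <= Lp * enorm (b - a) ^+ p.+1 / (p.+1)`!%:R.
Proof.
have := @taylor_line _ _ p f a (b - a) (Lp * enorm (b - a) ^+ p.+1) f_diff.
rewrite subrKC big_mkord; apply=> t t0.
apply: le_trans (f_lip _ _ (size_nseq _ _)) _; rewrite enorm_line //.
rewrite big_nseq -[iter _ _ _]/(iter p ( *%R (enorm (b - a))) 1) iter_mulr_1.
by rewrite exprS le_eqVlt; apply/orP; left; apply/eqP; ring.
Qed.

Lemma taylor_gradient (a b u : V) :
  `|'D_u f b - \sum_(0 <= j < p) dseq (u :: nseq j (b - a)) f a / j`!%:R|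
  <= Lp * enorm (b - a) ^+ p * enorm u / p`!%:R.
Proof.
have pE : p = p.-1.+1 by rewrite prednK // ltnW.
have df : times_differentiable p.-1 ('D_u f).
  by move: f_diff; rewrite pE => -[_]; exact.
have dE j : (j < p)%N -> dseq (nseq j (b - a)) ('D_u f) = dseq (u :: nseq j (b - a)) f.
  move=> jp; rewrite -dseq_nseq_rcons; first by rewrite -cats1 dseq_cat.
  exact: tdiffW jp f_diff.
have := @taylor_line _ _ p.-1 ('D_u f) a (b - a) (Lp * enorm (b - a) ^+ p * enorm u) df.
rewrite subrKC -pE -(big_mkord predT (fun j => dseq (nseq j (b - a)) ('D_u f) a / j`!%:R)).
rewrite (eq_big_nat _ _ (F2 := fun j => dseq (u :: nseq j (b - a)) f a / j`!%:R)); last first.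
  by move=> j /andP[_ jp]; rewrite dE.
have p1 : (p.-1 < p)%N by rewrite prednK // ltnW.
apply=> t t0; rewrite (dE _ p1).
have sz : size (u :: nseq p.-1 (b - a)) = p by rewrite /= size_nseq -pE.
apply: le_trans (f_lip _ _ sz) _; rewrite enorm_line // big_cons big_nseq.
rewrite -[iter _ _ _]/(iter p.-1 ( *%R (enorm (b - a))) 1) iter_mulr_1.
have -> : enorm (b - a) ^+ p = enorm (b - a) * enorm (b - a) ^+ p.-1 by rewrite -exprS -pE.
by rewrite le_eqVlt; apply/orP; left; apply/eqP; ring.
Qed.

(* fb i estimates the derivative of order i at v. *)
Context (v xp : V) (fb : nat -> V -> R) (G : @estimate R n) (tau : nat -> R) (c : nat -> R).
Hypotheses
  (fb_diff : forall i, (1 <= i <= p)%N -> times_differentiable p (fb i))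
  (GE : forall i (s : i.-tuple V), (1 <= i <= p)%N -> G s = dseq s (fb i) v)
  (noise : forall i (s : seq V), (1 <= i <= p)%N -> size s = i ->
     `|dseq s (fb i) v - dseq s f v| <= tau i * \prod_(w <- s) enorm w)
  (xp_min : is_argmin (reg_model p sigma f v G c) xp).

Local Notation u := (xp - v).
Local Notation r := (enorm u).

(** The gradient of the regularizer at [xp] is this scalar times [xp - v]. *)
Definition stepS : R := \sum_(2 <= i < p.+1) c i / (i.-1)`!%:R * r ^+ (i - 2)
  + sigma / (p.-1)`!%:R * r ^+ p.-1.

Lemma tpowE i h : (1 <= i <= p)%N -> tpow (@G i) h = dseq (nseq i h) (fb i) v.
Proof. by move=> ip; rewrite /tpow GE. Qed.

(** Stationarity of the model along the line through [xp] in direction [q]. That the estimated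
    tensors are derivatives of functions [fb i] enters here: [is_derive_tpow] relies on their
    symmetry. *)
Lemma step_optimality (q : V) :
  \sum_(1 <= i < p.+1) dseq (q :: nseq i.-1 u) (fb i) v / (i.-1)`!%:R
  + stepS * dot u q = 0.
Proof.
pose phi (t : R) := reg_model p sigma f v G c (xp + t *: q).
apply: (@derive_at_argmin _ phi); last first.
  by move=> t; rewrite /phi scale0r addr0; exact: xp_min.
rewrite /phi /reg_model /taylor /dreg.
have uE (t : R) : xp + t *: q - v = u + t *: q by rewrite addrAC.
under eq_fun do rewrite uE.
rewrite /stepS mulrDl mulr_suml addrA.
apply: is_deriveD; last first.
  have := is_deriveZ (sigma / (p.-1)`!%:R * p.+1%:R^-1)
     (@is_derive_enorm_pow _ _ p.+1 u q (leqW p_ge2)).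
  rewrite (_ : _ \*: _ = fun t : R => sigma / (p.-1)`!%:R * (p.+1%:R^-1 * enorm (u + t *: q) ^+ p.+1));
    last by apply/funext => t; rewrite /GRing.scale /= mulrA.
  move=> h; apply: is_derive_eq h _; rewrite [LHS]/GRing.scale /=.
  have -> : (p.+1 - 2 = p.-1)%N by rewrite -subn1 subSS.
  have : p.+1%:R != 0 :> R by rewrite pnatr_eq0.
  by move: (sigma / _) => A h0; field; rewrite -natr1 in h0; rewrite natr1 in h0 *.
apply: is_deriveD.
  rewrite -[X in is_derive _ _ _ X]add0r.
  apply: is_deriveD.
  apply: is_derive_sum_seq => i; rewrite mem_index_iota ltnS => ip.
  under eq_fun do rewrite tpowE //.
  have := is_deriveZ (i`!%:R^-1) (is_derive_tpow v u q (fb_diff ip) ip).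
  rewrite (_ : _ \*: _ = fun t : R => i`!%:R^-1 * dseq (nseq i (u + t *: q)) (fb i) v) //.
  move=> h; apply: is_derive_eq h _; rewrite [LHS]/GRing.scale /=.
  case: i ip => // i ip; rewrite factS natrM invfM /=.
  by rewrite mulrACA mulVf ?pnatr_eq0 // mul1r mulrC.
apply: is_derive_sum_seq => i; rewrite mem_index_iota ltnS => ip.
have i2 : (2 <= i)%N by move: ip => /andP[].
have := is_deriveZ (c i / (i.-1)`!%:R * i%:R^-1) (@is_derive_enorm_pow _ _ i u q i2).
rewrite (_ : _ \*: _ = fun t : R => c i / (i.-1)`!%:R * (i%:R^-1 * enorm (u + t *: q) ^+ i));
  last by apply/funext => t; rewrite /GRing.scale /= mulrA.
move=> h; apply: is_derive_eq h _; rewrite [LHS]/GRing.scale /=.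
have : i%:R != 0 :> R by rewrite pnatr_eq0 -lt0n ltnW.
by move: (c i / _) (i%:R : R) => A b b0; field.
Qed.

(* The gradient at the new point, without the first-order noise at v. *)
Definition clean_grad (q : V) : R := 'D_q f xp + ('D_q (fb 1) v - 'D_q f v).

Lemma step_residual (q : V) :
  `|clean_grad q + stepS * dot u q| <=
  (\sum_(2 <= i < p.+1) tau i * r ^+ i.-1 / (i.-1)`!%:R + Lp * r ^+ p / p`!%:R) * enorm q.
Proof.
(* Optimality trades the regularizer for the model. What is left is the Taylor error of the gradient
   and the noise of orders 2 to p; the noise of order 1 sits inside [clean_grad]. *)
have -> : clean_grad q + stepS * dot u q =
  ('D_q f xp - \sum_(0 <= j < p) dseq (q :: nseq j u) f v / j`!%:R) -
  \sum_(2 <= i < p.+1) (dseq (q :: nseq i.-1 u) (fb i) v - dseq (q :: nseq i.-1 u) f v) / (i.-1)`!%:R.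
  have /eqP := step_optimality q; rewrite addrC addr_eq0 => /eqP ->.
  pose a i := dseq (q :: nseq i.-1 u) (fb i) v / (i.-1)`!%:R.
  pose b i := dseq (q :: nseq i.-1 u) f v / (i.-1)`!%:R.
  rewrite -[X in _ - X = _]/(\sum_(1 <= i < p.+1) a i).
  have -> : \sum_(0 <= j < p) dseq (q :: nseq j u) f v / j`!%:R = \sum_(1 <= i < p.+1) b i.
    by rewrite big_add1.
  have -> : \sum_(2 <= i < p.+1) (dseq (q :: nseq i.-1 u) (fb i) v -
      dseq (q :: nseq i.-1 u) f v) / (i.-1)`!%:R
      = \sum_(2 <= i < p.+1) a i - \sum_(2 <= i < p.+1) b i.
    by rewrite -sumrB; apply: eq_bigr => i _; rewrite mulrBl.
  have p1 : (1 < p.+1)%N by rewrite ltnS ltnW.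
  rewrite !(big_ltn p1).
  have -> : a 1%N = 'D_q (fb 1) v by rewrite /a fact0 divr1.
  have -> : b 1%N = 'D_q f v by rewrite /b fact0 divr1.
  rewrite /clean_grad; move: ('D_q f xp) ('D_q (fb 1) v) ('D_q f v).
  by move: (\sum_(2 <= i < p.+1) a i) (\sum_(2 <= i < p.+1) b i) => A B c1 c2 c3; ring.
rewrite mulrDl [leRHS]addrC; apply: le_trans (ler_normB _ _) _.
apply: lerD.
  apply: le_trans (taylor_gradient _ _ _) _.
  by rewrite mulrAC.
rewrite mulr_suml; apply: le_trans (ler_norm_sum _ _ _) _.
rewrite big_seq [leRHS]big_seq; apply: ler_sum => i; rewrite mem_index_iota ltnS => ip.
rewrite normrM normfV normr_nat mulrAC ler_wpM2r ?invr_ge0 //.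
have i1 : (1 <= i <= p)%N by case/andP: ip => /ltnW -> ->.
have sz : size (q :: nseq i.-1 u) = i by rewrite /= size_nseq prednK //; case/andP: i1.
apply: le_trans (noise i1 sz) _; rewrite big_cons big_nseq.
by rewrite -[iter _ _ _]/(iter i.-1 ( *%R r) 1) iter_mulr_1 [enorm q * _]mulrC mulrA.
Qed.

End TensorStep.

Section StepGeometry.
Context {R : realType} {n : nat}.
Local Notation V := 'rV[R]_n.

(** Expanding ‖g + S u‖^2 <= (S‖u‖/3)^2 gives -g.u >= ‖g‖^2/(2S) + 4/9 S‖u‖^2, where 4/9 is half of
    1 - 1/9; expanding ‖g + S a w‖^2 >= 0 gives a g.w >= -‖g‖^2/(2S) - S a^2‖w‖^2/2. The terms in
    ‖g‖^2 cancel. *)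
Lemma step_geometry (g u w : V) (S a : R) : 0 <= S ->
  (forall q, `|dot g q + S * dot u q| <= S * enorm u / 3 * enorm q) ->
  S * (4 / 9 * enorm u ^+ 2 - a ^+ 2 * enorm w ^+ 2 / 2) <= - dot g u + a * dot g w.
Proof.
move=> S0 H.
(* The hypothesis is tested on the residual vector itself. *)
have gS : enorm (g + S *: u) <= S * enorm u / 3.
  have := H (g + S *: u); rewrite -dotZl -dotDl -enorm_sqr ger0_norm ?sqr_ge0 // expr2.
  have := enorm_ge0 (g + S *: u); rewrite le_eqVlt => /predU1P[<- _|gt0].
    by rewrite !mulr_ge0 ?enorm_ge0.
  by rewrite ler_pM2r.
have {}gS : enorm (g + S *: u) ^+ 2 <= (S * enorm u / 3) ^+ 2.
  by rewrite lerXn2r ?nnegrE ?enorm_ge0 // !mulr_ge0 ?enorm_ge0.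
have := sqr_ge0 (enorm (g + (S * a) *: w)).
move: gS; rewrite !enorm_sqrD !dotZr !enormZ !exprMn !real_normK ?num_real //.
rewrite exprMn.
(* If S = 0 the bound forces g = 0; otherwise the claim may be multiplied by S. *)
move: S0; rewrite le_eqVlt => /predU1P[<-|S0].
  rewrite expr0n /= !mul0r !mulr0 !addr0 => h _.
  have /eqP : enorm g ^+ 2 = 0 by apply/le_anti; rewrite h sqr_ge0.
  rewrite sqrf_eq0 => /eqP/enorm_eq0 ->.
  by rewrite -(scale0r (0 : V)) !dotZl !mul0r mulr0 addr0 oppr0.
move: (enorm u ^+ 2) (enorm w ^+ 2) (enorm g ^+ 2) (dot g u) (dot g w) => U W g2 gu gw h1 h2.
rewrite -(ler_pM2l S0); move: h1 h2; rewrite !expr2; lra.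
Qed.

End StepGeometry.

(** * The estimating sequence along a run with accurate estimates *)

Section Run.
Context {R : realType} {n : nat}.
Local Notation V := 'rV[R]_n.
Context (p : nat) (Lp sigma : R) (eta delta : nat -> R) (f : V -> R) (x0 xs : V).
Context (Rb tau : R) (T : nat) (G : nat -> V -> @estimate R n) (x y : nat -> V).
Context (fb : nat -> nat -> V -> R).

Definition query_point (q : nat) : V :=
  if q == 0%N then x0 else if odd q then x q./2.+1 else vpt p x y q./2.

Hypotheses (p_ge2 : (2 <= p)%N) (Lp_ge0 : 0 <= Lp) (sigma_ge : 3 * Lp <= p%:R * sigma)
  (eta_ge3 : forall i, (2 <= i <= p)%N -> 3 <= eta i)
  (delta_gt0 : forall i, (2 <= i <= p)%N -> 0 < delta i)
  (Rb_gt0 : 0 < Rb) (tau_ge0 : 0 <= tau).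
Hypotheses (f_convex : convex_function setT f) (f_diff : times_differentiable p f)
  (f_lip : forall (s : seq V) a b, size s = p ->
    `|dseq s f a - dseq s f b| <= Lp * enorm (a - b) * \prod_(v <- s) enorm v).
Hypotheses
  (fb_diff : forall q i, (1 <= i <= p)%N -> times_differentiable p (fb q i))
  (GE : forall q v i (s : i.-tuple V), (1 <= i <= p)%N -> G q v s = dseq s (fb q i) v)
  (noise : forall q i (s : seq V), (q < T.*2)%N -> (1 <= i <= p)%N -> size s = i ->
     `|dseq s (fb q i) (query_point q) - dseq s f (query_point q)|
       <= (if i == 1%N then tau else delta i) * \prod_(w <- s) enorm w)
  (run : astm_run p Lp sigma eta delta f x0 G x y)
  (bounded : iterates_bounded x0 x y xs Rb).

Local Notation kap := (kappa p Lp sigma eta delta).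
Local Notation psi := (psi p Lp sigma eta delta f x0 G x).
Local Notation w_ := (wreg p sigma eta delta).
Local Notation al := (@alpha R p).
Local Notation A_ := (@Aprod R p).

Arguments kk : simpl never.

Let df a : differentiable f a.
Proof. by apply: (tdiff_differentiable _ f_diff); rewrite ltnW. Qed.

Let p1 : (1 <= 1 <= p)%N. Proof. by apply/andP; split=> //; exact: ltnW. Qed.

Lemma scale_half (v : V) : 2^-1 *: (v + v) = v.
Proof. by rewrite scalerDr -scalerDl (_ : _ + _ = 1) ?scale1r //; lra. Qed.

Lemma dreg_coef (c : R) (i : nat) (h : V) : (0 < i)%N ->
  c / (i.-1)`!%:R * dreg i h = c / i`!%:R * enorm h ^+ i.
Proof.
case: i => // i _; rewrite /dreg factS natrM invfM /=.
by move: (enorm h ^+ i.+1) => e; rewrite !mulrA (mulrAC c).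
Qed.

Lemma dreg_sum (c : nat -> R) (h : V) :
  \sum_(2 <= i < p.+2) c i / (i.-1)`!%:R * dreg i h
  = \sum_(2 <= i < p.+2) c i / i`!%:R * enorm h ^+ i.
Proof.
rewrite big_seq [RHS]big_seq; apply: eq_bigr => i; rewrite mem_index_iota => /andP[i2 _].
by rewrite dreg_coef // ltnW.
Qed.

Lemma taylor1 q a z : taylor f a (G q a) 1 z = f a + 'D_(z - a) (fb q 1) a.
Proof.
rewrite /taylor big_nat1 (_ : 1`!%:R = 1) // invr1 mul1r; congr (_ + _).
by rewrite /tpow (GE _ _ _ p1).
Qed.

(** The increments of [kappa] telescope, so only the latest weights remain, and the linear models
    collect in an affine part. Of affinity only the midpoint identity is recorded, which is all that
    [psi_midpoint] uses. *)
Lemma psi_affine t : exists2 a : V -> R,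
  (forall b c, a (2^-1 *: (b + c)) = (a b + a c) / 2) &
  forall z, psi t.+1 z = a z + \sum_(2 <= i < p.+2) kap t i / i`!%:R * enorm (z - x0) ^+ i.
Proof.
elim: t => [|t [a aM aE]].
  exists (fun=> f (x 1%N)) => [b c|z]; first by field.
  by rewrite [LHS]/= dreg_sum.
exists (fun z => a z + al t.+1 / A_ t.+1 * taylor f (x t.+2) (G t.+1.*2.+1 (x t.+2)) 1 z).
  move=> b c; rewrite aM !taylor1.
  have dfb : differentiable (fb t.+1.*2.+1 1) (x t.+2).
    by apply: (tdiff_differentiable _ (fb_diff _ p1)); rewrite ltnW.
  have -> : 2^-1 *: (b + c) - x t.+2 = 2^-1 *: (b - x t.+2) + 2^-1 *: (c - x t.+2).
    rewrite -scalerDr addrACA -opprD scalerBr; congr (_ - _).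
    by rewrite scale_half.
  rewrite derive_dirD // derive_dirZ //.
  move: (al _ / _) ('D_(b - _) _ _) ('D_(c - _) _ _) => k B C; by field.
move=> z; rewrite [LHS]/= -[X in X + _ + _]/(psi t.+1 z) aE dreg_sum.
rewrite [RHS]addrAC; congr (_ + _); rewrite -addrA; congr (_ + _).
by rewrite -big_split; apply: eq_bigr => i _ /=; rewrite -mulrDl -mulrDl addrC subrK.
Qed.

Lemma psi_midpoint t a b : psi t.+1 (2^-1 *: (a + b)) <=
  (psi t.+1 a + psi t.+1 b) / 2
  - \sum_(2 <= i < p.+2) kap t i / i`!%:R * (enorm (a - b) ^+ i / 2 ^+ i).
Proof.
have [c cM cE] := psi_affine t; rewrite !cE cM.
set K := fun i => kap t i / i`!%:R.
have K0 i : (2 <= i < p.+2)%N -> 0 <= K i.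
  by move=> h; rewrite divr_ge0 // kappa_ge0.
have hK : \sum_(2 <= i < p.+2) K i * enorm (2^-1 *: (a + b) - x0) ^+ i
    + \sum_(2 <= i < p.+2) K i * (enorm (a - b) ^+ i / 2 ^+ i)
    <= (\sum_(2 <= i < p.+2) K i * enorm (a - x0) ^+ i
       + \sum_(2 <= i < p.+2) K i * enorm (b - x0) ^+ i) / 2.
  rewrite -!big_split mulr_suml big_seq [leRHS]big_seq; apply: ler_sum => i.
  rewrite mem_index_iota => h; rewrite /= -!mulrDr -mulrA ler_wpM2l ?K0 //.
  have i2 : (2 <= i)%N by case/andP: h.
  have := clarkson (a - x0) (b - x0) i2.
  rewrite opprB [_ - x0 + (x0 - b)]addrA subrK addrACA -opprD.
  have -> : 2^-1 *: (a + b - (x0 + x0)) = 2^-1 *: (a + b) - x0.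
    by rewrite scalerBr scale_half.
  by rewrite [enorm (2^-1 *: (a - b))]enormZ ger0_norm // exprMn exprVn [_^-1 * _]mulrC.
move: hK; rewrite -!/(K _); lra.
Qed.

(** Bisection: the midpoint of [z] and the minimizer obeys the previous bound at half the distance,
    and [psi_midpoint] carries it over to [z]. *)
Lemma psi_growth t m z :
  psi t.+1 (y t.+1) + \sum_(2 <= i < p.+2) kap t i / i`!%:R * (kk m i * enorm (z - y t.+1) ^+ i)
  <= psi t.+1 z.
Proof.
have ymin b : psi t.+1 (y t.+1) <= psi t.+1 b.
  by case: run => _ h1 h2; case: t => [|t]; [exact: h1 | have [_] := h2 t.+1 isT; exact].
elim: m z => [|m IH] z.
  by rewrite big1 ?addr0 // => i _; rewrite mul0r mulr0.
have := psi_midpoint t z (y t.+1); set mid := 2^-1 *: _; have := IH mid.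
have -> : mid - y t.+1 = 2^-1 *: (z - y t.+1).
  rewrite -[X in mid - X]scale_half /mid -scalerBr; congr (_ *: _).
  by rewrite opprD addrA addrK.
set Y := psi t.+1 (y t.+1); set W := enorm (z - y t.+1).
set S1 := \sum_(_ <= _ < _) _ => l1; set S2 := \sum_(_ <= _ < _) _ => l2.
set S3 := \sum_(_ <= _ < _) _.
suff -> : S3 = 2 * S1 + 2 * S2 by lra.
rewrite /S1 /S2 /S3 !mulr_sumr -big_split; apply: eq_bigr => i _.
rewrite enormZ ger0_norm // exprMn exprVn [RHS]/= -[kk m.+1 i]/(2 / 2 ^+ i * (1 + kk m i)).
by move: (kap t i / _) (kk m i) (W ^+ i) (2 ^+ i)^-1 => a b c d; ring.
Qed.

Lemma wS_split (F : nat -> R) : \sum_(2 <= i < p.+2) w_ i * F i =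
  \sum_(2 <= i < p.+1) eta i * delta i * F i + p%:R * sigma * F p.+1.
Proof.
rewrite big_nat_recr; last by rewrite ltnS ltnW.
congr (_ + _); last by rewrite /wreg eqxx.
rewrite big_seq [RHS]big_seq; apply: eq_bigr => i; rewrite mem_index_iota => /andP[_ ip].
by rewrite /wreg ltn_eqF.
Qed.

Let xb t : (1 <= t)%N -> enorm (x t - xs) <= Rb.
Proof. by move=> t1; case: bounded => _ /(_ t t1)[]. Qed.

Let yb t : (1 <= t)%N -> enorm (y t - xs) <= Rb.
Proof. by move=> t1; case: bounded => _ /(_ t t1)[]. Qed.

Let al01 t : 0 <= 1 - al t.
Proof. by rewrite one_alpha divr_ge0. Qed.

Let al0 t : 0 <= al t.
Proof. exact/ltW/alpha_gt0. Qed.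

Lemma vpt_bounded t : (1 <= t)%N -> enorm (vpt p x y t - xs) <= Rb.
Proof.
move=> t1; have -> : vpt p x y t - xs = (1 - al t) *: (x t - xs) + al t *: (y t - xs).
  rewrite /vpt !scalerBr addrACA; congr (_ + _).
  by rewrite -opprD -scalerDl subrK scale1r.
apply: le_trans (enormD _ _) _; rewrite !enormZ !ger0_norm //.
have h1 := ler_wpM2l (al01 t) (xb t1); have h2 := ler_wpM2l (al0 t) (yb t1).
by apply: le_trans (lerD h1 h2) _; rewrite -mulrDl subrK mul1r.
Qed.

Let close a b : enorm (a - xs) <= Rb -> enorm (b - xs) <= Rb -> enorm (a - b) <= 2 * Rb.
Proof.
move=> h1 h2; apply: le_trans (enorm_triangle xs a b) _.
by rewrite (enormB xs) mulr2n mulrDl mul1r lerD.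
Qed.

(* For t < 9(p+1) the factor 1 - alpha t in A_t / A_(t-1) is too small for the growth
   of psi to absorb the terms in y_(t+1) - y_t; slack0 bounds what is then lost. *)
Definition slack0 : R := \sum_(2 <= i < p.+2) w_ i / (i.-1)`!%:R * ((2 * Rb) ^+ i / 2).

Lemma step_terms t r z : (1 <= t)%N -> 0 <= r <= 2 * Rb -> 0 <= z <= 2 * Rb ->
  - (if (t < 9 * p.+1)%N then slack0 else 0) <=
  A_ t * \sum_(2 <= i < p.+2) kap t.-1 i / i`!%:R * (kk 3 i * z ^+ i) +
  \sum_(2 <= i < p.+2) w_ i / (i.-1)`!%:R * (r ^+ (i - 2) * (r ^+ 2 / 3 - al t ^+ 2 * z ^+ 2 / 2)).
Proof.
move=> t1 /andP[r0 rR] /andP[z0 zR].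
rewrite mulr_sumr -big_split /=.
have w0 i (h : (2 <= i < p.+2)%N) := wreg_ge0 p_ge2 Lp_ge0 sigma_ge eta_ge3 delta_gt0 h.
have k0 i (h : (2 <= i < p.+2)%N) : 0 <= kap t.-1 i by exact: kappa_ge0.
have A0 := ltW (@Aprod_gt0 R p t).
have al1 : al t <= 1 by rewrite -subr_ge0.
case: ifPn => [_|]; last first.
  rewrite -leqNgt => tbig; rewrite oppr0 big_seq; apply: sumr_ge0 => i.
  rewrite mem_index_iota => h; have i0 : (0 < i)%N by case/andP: h => /ltnW.
  have h' : (2 <= i <= p.+1)%N by rewrite -ltnS.
  have := young_term p_ge2 h' r0 (mulr_ge0 (al0 t) z0).
  rewrite [(al t * z) ^+ i]exprMn [(al t * z) ^+ 2]exprMn => Y.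
  have fE : i`!%:R^-1 = (i%:R)^-1 * (i.-1)`!%:R^-1 :> R.
    by case: i i0 {h h' Y} => // i _; rewrite factS natrM invfM.
  (* A_t/A_(t-1) = 1 - alpha_t = t/(t+p+1) is at least 9/10 exactly when t >= 9(p+1); alpha_(t-1) >=
     alpha_t and [kwgt] >= [wreg] do the rest. *)
  have kl : 9 / 10 * (kcoef p i * al t ^+ i * w_ i) <= A_ t * kap t.-1 i.
    rewrite kappaE.
    have tE : A_ t = A_ t.-1 * (1 - al t) by rewrite -[in LHS](prednK t1) AprodS prednK.
    have An0 : A_ t.-1 != 0 by rewrite gt_eqF // Aprod_gt0.
    have -> : A_ t * (kcoef p i * (al t.-1 ^+ i / A_ t.-1) * kwgt p Lp sigma eta delta i)
      = (1 - al t) * (kcoef p i * al t.-1 ^+ i * kwgt p Lp sigma eta delta i).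
      rewrite tE; move: (al t.-1 ^+ i) (kcoef p i) (kwgt _ _ _ _ _ _) => a b c; field.
      by rewrite An0.
    have kc0 := @kcoef_ge0 R p i.
    have ai0 : 0 <= al t ^+ i by rewrite exprn_ge0.
    apply: ler_pM.
    - lra.
    - by rewrite !mulr_ge0 ?w0.
    - rewrite one_alpha ler_pdivlMr ?ltr0n ?addnS // mulrAC ler_pdivrMr //.
      rewrite -natrM mulrC -natrM ler_nat; clear -tbig; lia.
    apply: ler_pM.
    - exact: mulr_ge0.
    - exact: w0.
    - apply: ler_wpM2l => //; apply: lerXn2r; rewrite ?nnegrE; [exact: al0|exact: al0|].
      by apply: alpha_anti; exact: leq_pred.
    exact: (wreg_le_kwgt eta p_ge2 Lp_ge0 sigma_ge delta_gt0 h).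
  apply: le_trans (_ : w_ i / (i.-1)`!%:R * (9 / 10 * (p%:R / (2 * i%:R)) *
      (6 * i.-1%:R / (i%:R * Num.sqrt 5)) ^+ i.-1 * kk 3 i * (al t ^+ i * z ^+ i) +
      r ^+ (i - 2) * (r ^+ 2 / 3 - al t ^+ 2 * z ^+ 2 / 2)) <= _).
    by apply: mulr_ge0 Y; apply: divr_ge0 => //; exact: w0.
  rewrite mulrDr lerD2r.
  have kz : 0 <= kk 3 i * z ^+ i / i`!%:R by rewrite divr_ge0 // mulr_ge0 ?kk_ge0 ?exprn_ge0.
  have := ler_wpM2r kz kl; rewrite fE /kcoef.
  have -> : (2 * i%:R)^-1 = 2^-1 * (i%:R)^-1 :> R by rewrite invfM.
  move: (i%:R^-1) ((i.-1)`!%:R^-1) (kap t.-1 i) (w_ i) (kk 3 i) (z ^+ i) (al t ^+ i) (A_ t) => a b c d e g h1 k.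
  by move: (_ ^+ i.-1) => l; lra.
rewrite -sumrN big_seq [leRHS]big_seq; apply: ler_sum => i; rewrite mem_index_iota => h.
have i2 : (2 <= i)%N by case/andP: h.
(* Early steps: the growth of [psi] and the positive power of [r] are discarded, and the negative
   term is bounded through the diameter 2 Rb. *)
rewrite -mulrN; apply: le_trans (_ : 0 + w_ i / (i.-1)`!%:R * - ((2 * Rb) ^+ i / 2) <= _).
  by rewrite add0r.
apply: lerD.
  apply: mulr_ge0 => //; apply: mulr_ge0; first by apply: divr_ge0 => //; exact: k0.
  by apply: mulr_ge0; [exact: kk_ge0 | exact: exprn_ge0].
apply: ler_wpM2l; first by apply: divr_ge0 => //; exact: w0.
have R2 : 0 <= 2 * Rb by apply: le_trans rR.
have h1 : r ^+ (i - 2) <= (2 * Rb) ^+ (i - 2) by rewrite lerXn2r ?nnegrE.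
have h2 : al t ^+ 2 * z ^+ 2 <= (2 * Rb) ^+ 2.
  have az : al t * z <= 2 * Rb by apply: le_trans zR; rewrite ler_piMl.
  by rewrite -exprMn; apply: lerXn2r; rewrite ?nnegrE //; exact: mulr_ge0.
have h3 : r ^+ (i - 2) * (al t ^+ 2 * z ^+ 2) <= (2 * Rb) ^+ i.
  rewrite -[X in _ <= _ ^+ X](subnK i2) exprD; apply: ler_pM => //.
    exact: exprn_ge0.
  by apply: mulr_ge0; exact: exprn_ge0.
have h4 : 0 <= r ^+ (i - 2) * r ^+ 2 by apply: mulr_ge0; exact: exprn_ge0.
by move: h3 h4; lra.
Qed.

Lemma query_point_even t : (1 <= t)%N -> query_point t.*2 = vpt p x y t.
Proof.
by move=> t1; rewrite /query_point double_eq0 eqn0Ngt t1 odd_double doubleK.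
Qed.

Lemma query_point_odd t : query_point t.*2.+1 = x t.+1.
Proof. by rewrite /query_point /= odd_double /= uphalf_double. Qed.

Lemma convex_step (a b : V) : f a + 'D_(b - a) f a <= f b.
Proof. exact: convex_gradient. Qed.

(** As sigma/(p-1)! = p sigma/p!, the top order fits the common pattern with weight p sigma. *)
Lemma stepS_wreg (v xp : V) : stepS p sigma v xp (fun i => eta i * delta i) =
  \sum_(2 <= i < p.+2) w_ i * (enorm (xp - v) ^+ (i - 2) / (i.-1)`!%:R).
Proof.
rewrite wS_split /stepS; congr (_ + _).
  by apply: eq_bigr => i _; rewrite mulrAC mulrA.
have -> : (p.+1 - 2 = p.-1)%N by rewrite -subn1 subSS.
have fE : p`!%:R = p%:R * (p.-1)`!%:R :> R.
  by rewrite -natrM; case: (p) p_ge2 => // k _; rewrite factS.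
rewrite /= fE; have : p%:R != 0 :> R by rewrite pnatr_eq0 -lt0n ltnW.
have : (p.-1)`!%:R != 0 :> R by rewrite pnatr_eq0 -lt0n fact_gt0.
move: (p%:R : R) ((p.-1)`!%:R : R) (_ ^+ p.-1) => P q e q0 P0.
by field; rewrite P0 q0.
Qed.

(** The place where eta_i >= 3 and p sigma >= 3 Lp act: noise and Taylor error together stay below a
    third of the regularizer's gradient, as [step_geometry] demands. *)
Lemma residual_le (v xp : V) :
  \sum_(2 <= i < p.+1) (if i == 1%N then tau else delta i) * enorm (xp - v) ^+ i.-1 / (i.-1)`!%:R
  + Lp * enorm (xp - v) ^+ p / p`!%:R
  <= stepS p sigma v xp (fun i => eta i * delta i) * enorm (xp - v) / 3.
Proof.
set r := enorm _; have r0 : 0 <= r by exact: enorm_ge0.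
rewrite stepS_wreg wS_split -/r !mulrDl !mulr_suml; apply: lerD.
  rewrite big_seq [leRHS]big_seq; apply: ler_sum => i; rewrite mem_index_iota ltnS => ip.
  have i2 : (2 <= i)%N by case/andP: ip.
  rewrite gtn_eqF //.
  have -> : r ^+ i.-1 = r ^+ (i - 2) * r.
    by rewrite -exprSr -subSn // subSS subn1.
  have := eta_ge3 ip; have := delta_gt0 ip.
  have : 0 <= r ^+ (i - 2) * r / (i.-1)`!%:R by rewrite divr_ge0 // mulr_ge0 // exprn_ge0.
  move: (r ^+ _) ((_)`!%:R^-1) => a b h d0 e3.
  have := mulr_ge0 h (mulr_ge0 (ltW d0) (_ : 0 <= eta i - 3)); rewrite subr_ge0 => /(_ e3).
  lra.
have -> : (p.+1 - 2 = p.-1)%N by rewrite -subn1 subSS.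
have -> : r ^+ p = r ^+ p.-1 * r by rewrite -exprSr prednK // ltnW.
have h : 0 <= r ^+ p.-1 * r / p`!%:R by rewrite divr_ge0 // mulr_ge0 // exprn_ge0.
rewrite /=; have := ler_wpM2r h sigma_ge.
by move: (r ^+ _) (p`!%:R^-1) (p%:R * sigma) => a b c; lra.
Qed.

(** With ' marking index t+1, u = x' - v_t and w = y' - y_t, the pivot is the identity (1 -
    alpha)(x_t - x') + alpha (y' - x') = -u + alpha w. It merges convexity towards x_t with the new
    linear model at y' into one derivative at x', which the tensor step bounds from below. *)
Lemma run_step t e : (1 <= t < T)%N ->
  f (x t) / A_ t.-1 - e <= psi t (y t) ->
  f (x t.+1) / A_ t - (e + (A_ t)^-1 * (4 * Rb * al t * tau + 3 / 4 * (tau ^+ 2 / delta 2)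
     + (if (t < 9 * p.+1)%N then slack0 else 0))) <= psi t.+1 (y t.+1).
Proof.
move=> /andP[t1 tT] IH.
set v := vpt p x y t; set xp := x t.+1; set u := xp - v.
set w := y t.+1 - y t; set r := enorm u; set z := enorm w.
have r0 : 0 <= r by exact: enorm_ge0.
have z0 : 0 <= z by exact: enorm_ge0.
have rR : r <= 2 * Rb by apply: close; [exact: xb | exact: vpt_bounded].
have zR : z <= 2 * Rb by apply: close; exact: yb.
have q1 : (t.*2 < T.*2)%N by rewrite ltn_double.
have q2 : (t.*2.+1 < T.*2)%N by move: tT; rewrite -leq_double.
have An : 0 < A_ t by exact: Aprod_gt0.
have tauD (h : V) : 'D_h f xp - tau * enorm h <= 'D_h (fb t.*2.+1 1) xp.
  have := noise (s := [:: h]) q2 p1 erefl; rewrite query_point_odd eqxx big_seq1 /=.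
  by rewrite ler_distl => /andP[].
pose S := stepS p sigma v xp (fun i => eta i * delta i).
have xpmin : is_argmin (reg_model p sigma f v (G t.*2 v) (fun i => eta i * delta i)) xp.
  by case: run => _ _ /(_ t t1)[].
have qE := query_point_even t1.
have nz i (s : seq V) : (1 <= i <= p)%N -> size s = i ->
    `|dseq s (fb t.*2 i) v - dseq s f v| <= (if i == 1%N then tau else delta i) * \prod_(w <- s) enorm w.
  by have := @noise t.*2 i s q1; rewrite qE.
pose res q := le_trans (step_residual p_ge2 f_diff f_lip (@fb_diff t.*2) (GE t.*2 v) nz xpmin q)
  (ler_wpM2r (enorm_ge0 q) (residual_le v xp)).
have dfb : differentiable (fb t.*2 1) v.
  by apply: (tdiff_differentiable _ (fb_diff _ p1)); rewrite ltnW.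
have [g gE] : exists g : V, forall q, clean_grad f v xp (fb t.*2) q = dot g q.
  have [g1 h1] := gradient (df xp); have [g2 h2] := gradient dfb; have [g3 h3] := gradient (df v).
  exists (g1 + (g2 - g3)) => q; rewrite /clean_grad h1 h2 h3.
  by rewrite !dotDl [dot (- g3) q]dotC dotNr [dot q g3]dotC.
have S0 : 0 <= S.
  rewrite /S stepS_wreg big_seq; apply: sumr_ge0 => i; rewrite mem_index_iota => h.
  apply: mulr_ge0; first exact: (wreg_ge0 p_ge2 Lp_ge0 sigma_ge eta_ge3 delta_gt0 h).
  by rewrite divr_ge0 // exprn_ge0 // enorm_ge0.
have geo : S * (4 / 9 * r ^+ 2 - al t ^+ 2 * z ^+ 2 / 2) <= - dot g u + al t * dot g w.
  by apply: step_geometry => // q; rewrite -gE; exact: res.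
(* Passing from the clean gradient to that of [f] costs the first-order noise at [v]. *)
have gf : - dot g u + al t * dot g w - tau * (r + al t * z) <= 'D_(- u + al t *: w) f xp.
  have -> : - dot g u + al t * dot g w = dot g (- u + al t *: w).
    by rewrite (dotDr g (- u)) (dotNr g u) (dotZr _ g w).
  rewrite -gE /clean_grad.
  have := nz 1%N [:: - u + al t *: w] p1 erefl; rewrite eqxx big_seq1 /= => /ler_normlW h1.
  have h2 : enorm (- u + al t *: w) <= r + al t * z.
    by apply: le_trans (enormD _ _) _; rewrite enormN enormZ ger0_norm.
  have := ler_wpM2l tau_ge0 h2; move: h1.
  move: ('D_(- u + al t *: w) f xp) ('D_(- u + al t *: w) (fb t.*2 1) v) ('D_(- u + al t *: w) f v).
  by move=> a b c h1 h3; lra.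
have d2 : 0 < delta 2 by apply: delta_gt0; rewrite p_ge2.
have S2 : 3 * delta 2 <= S.
  rewrite /S stepS_wreg big_ltn //= subnn expr0 divr1 mulr1.
  have -> : w_ 2 = eta 2 * delta 2 by rewrite /wreg ltn_eqF.
  have : 3 * delta 2 <= eta 2 * delta 2 by rewrite ler_pM2r // eta_ge3 // p_ge2.
  move=> h; apply: le_trans h _; rewrite lerDl big_seq; apply: sumr_ge0 => i.
  rewrite mem_index_iota => /andP[i3 ip]; apply: mulr_ge0.
    by apply: (wreg_ge0 p_ge2 Lp_ge0 sigma_ge eta_ge3 delta_gt0); rewrite ip ltnW.
  by rewrite divr_ge0 // exprn_ge0 // enorm_ge0.
(* AM-GM: the first-order error is absorbed by the order 2 part of the step *)
have amgm : tau * r <= S * r ^+ 2 / 9 + 3 / 4 * (tau ^+ 2 / delta 2).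
  have h1 : 3 * delta 2 * r ^+ 2 <= S * r ^+ 2 by rewrite ler_wpM2r // sqr_ge0.
  have h2 : 0 <= (delta 2)^-1 * (delta 2 * r - 3 / 2 * tau) ^+ 2.
    by rewrite mulr_ge0 ?sqr_ge0 // invr_ge0 ltW.
  have h3 : (delta 2)^-1 * (delta 2 * r - 3 / 2 * tau) ^+ 2
      = delta 2 * r ^+ 2 - 3 * tau * r + 9 / 4 * (tau ^+ 2 / delta 2).
    by move: (delta 2) d2 => d d0; field; rewrite gt_eqF.
  by move: h1 h2; rewrite h3; lra.
have rr : 0 <= r <= 2 * Rb by rewrite r0.
have zz : 0 <= z <= 2 * Rb by rewrite z0.
have terms := step_terms t1 rr zz.
set K := \sum_(2 <= i < p.+2) kap t.-1 i / i`!%:R * (kk 3 i * z ^+ i) in terms.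
have {}terms : - (if (t < 9 * p.+1)%N then slack0 else 0) <= A_ t * K +
    S * (r ^+ 2 / 3 - al t ^+ 2 * z ^+ 2 / 2).
  apply: le_trans terms _; rewrite lerD2l le_eqVlt; apply/orP; left; apply/eqP.
  rewrite /S stepS_wreg mulr_suml; apply: eq_bigr => i _.
  by rewrite -/u -/r mulrA mulrA; congr (_ * _); rewrite -!mulrA; congr (_ * _); rewrite mulrC.
have growth : psi t (y t) + K <= psi t (y t.+1).
  by have := psi_growth t.-1 3 (y t.+1); rewrite prednK.
have psiE : psi t (y t.+1) + al t / A_ t * (f xp + 'D_(y t.+1 - xp) (fb t.*2.+1 1) xp)
    <= psi t.+1 (y t.+1).
  rewrite -(prednK t1) [leRHS]/= -[X in _ <= X + _ + _]/(psi t.-1.+1 _) prednK //.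
  rewrite -taylor1 -/xp lerD2r lerDl dreg_sum big_seq; apply: sumr_ge0 => i.
  rewrite mem_index_iota => h; apply: mulr_ge0; last by rewrite exprn_ge0 ?enorm_ge0.
  apply: divr_ge0 => //; rewrite subr_ge0 -[in leRHS](prednK t1).
  exact: (kappa_mono p_ge2 Lp_ge0 sigma_ge eta_ge3 delta_gt0 _ h).
have cvx := convex_step xp (x t).
have yx : enorm (y t.+1 - xp) <= 2 * Rb by apply: close; [exact: yb | exact: xb].
have tD := tauD (y t.+1 - xp).
have dirE : 'D_(- u + al t *: w) f xp =
   (1 - al t) * 'D_(x t - xp) f xp + al t * 'D_(y t.+1 - xp) f xp.
  transitivity ('D_((1 - al t) *: (x t - xp) + al t *: (y t.+1 - xp)) f xp); last first.
    by rewrite (derive_dirD _ _ _ (df xp)) (derive_dirZ _ _ (df xp)).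
  congr ('D_ _ f xp); rewrite /u /w /v /vpt opprB !scalerBr scalerBl scale1r !scalerBl !scale1r.
  by apply/rowP => j; rewrite !mxE; ring.
have AE : (A_ t.-1)^-1 = (1 - al t) / A_ t.
  rewrite -[in RHS](prednK t1) AprodS prednK //.
  have h1 : 1 - al t != 0 by rewrite one_alpha mulf_neq0 // ?invr_eq0 pnatr_eq0 -lt0n // addnS.
  by rewrite invfM mulrCA mulfV // mulr1.
have h1 := ler_wpM2l (al0 t) tD.
have h2 := ler_wpM2l (al01 t) cvx.
(* The two halves of 4 Rb alpha tau: the noise of the linear model at x_(t+1), and the part of the
   noise at [v] along [w]. *)
have h3 := ler_wpM2l (al0 t) (ler_wpM2l tau_ge0 yx).
have h4 := ler_wpM2l (mulr_ge0 (al0 t) tau_ge0) zR.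
apply: le_trans psiE.
apply: le_trans (lerD (le_trans (lerD IH (lexx K)) growth) (lexx _)).
rewrite AE -(ler_pM2l An).
have -> (a b : R) : A_ t * (a / A_ t - (e + (A_ t)^-1 * b)) = a - b - A_ t * e.
  by move: (A_ t) An => A An'; field; rewrite gt_eqF.
have -> (a b c : R) : A_ t * (a * (b / A_ t) - e + K + al t / A_ t * c)
   = a * b + al t * c + A_ t * K - A_ t * e.
  by move: (A_ t) An => A An'; field; rewrite gt_eqF.
rewrite lerD2r.
move: terms geo gf amgm h1 h2 h3 h4; rewrite dirE /S.
set sl := (if _ then _ else _); set ST := stepS _ _ _ _ _.
move: ('D_(y t.+1 - xp) f xp) ('D_(x t - xp) f xp) ('D_(y t.+1 - xp) (fb _ _) xp) => a1 a2 a3.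
move: (A_ t * K) (r ^+ 2) (z ^+ 2) (al t ^+ 2) (tau ^+ 2 / _) (- dot g u + _) => k r2 z2 al2 tt gg.
move: (enorm (y t.+1 - xp)) (f (x t)) (f xp) (al t) => ey fx fxp al.
move=> g1 g2 g3 g4 g5 g6 g7 g8; clear -g1 g2 g3 g4 g5 g6 g7 g8; lra.
Qed.

Local Notation t0 := (9 * p.+1)%N.

Lemma slack0_ge0 : 0 <= slack0.
Proof.
rewrite /slack0 big_seq; apply: sumr_ge0 => i; rewrite mem_index_iota => h.
apply: mulr_ge0.
  by apply: divr_ge0 => //; exact: (wreg_ge0 p_ge2 Lp_ge0 sigma_ge eta_ge3 delta_gt0 h).
by apply: divr_ge0 => //; apply: exprn_ge0; apply: mulr_ge0 => //; exact: ltW.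
Qed.

Let invA_mono s t : (s <= t)%N -> (A_ s)^-1 <= (A_ t)^-1.
Proof. by move=> st; rewrite lef_pV2 ?posrE ?Aprod_gt0 // Aprod_anti. Qed.

(** A bound for what [run_step] accumulates: the terms alpha tau/A telescope, the terms in tau^2 are
    counted against the largest 1/A, and at most 9(p+1) steps pay [slack0]. *)
Definition run_error (t : nat) : R :=
  4 * Rb * tau * ((A_ t)^-1 - 1) + t%:R * (3 / 4 * (tau ^+ 2 / delta 2)) / A_ t
  + (minn t t0)%:R * (slack0 / A_ t0).

Lemma run_potential t : (t < T)%N ->
  f (x t.+1) / A_ t - run_error t <= psi t.+1 (y t.+1).
Proof.
elim: t => [|t IH] tT.
  rewrite /run_error Aprod0 invr1 subrr mulr0 min0n !mul0r !addr0 mulr1 subr0 [leRHS]/= dreg_sum.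
  rewrite lerDl big_seq; apply: sumr_ge0 => i; rewrite mem_index_iota => h.
  apply: mulr_ge0; last by apply: exprn_ge0; exact: enorm_ge0.
  by apply: divr_ge0 => //; exact: (kappa_ge0 p_ge2 Lp_ge0 sigma_ge eta_ge3 delta_gt0 _ h).
have tT' : (1 <= t.+1 < T)%N by rewrite tT.
have := run_step tT' (IH (ltnW tT)); apply: le_trans; rewrite lerD2l lerN2.
rewrite /run_error.
have d2 : 0 < delta 2 by apply: delta_gt0; rewrite p_ge2.
have tt : 0 <= 3 / 4 * (tau ^+ 2 / delta 2).
  by apply: mulr_ge0 => //; apply: divr_ge0; [exact: sqr_ge0 | exact: ltW].
have h1 : 4 * Rb * tau * ((A_ t)^-1 - 1) + (A_ t.+1)^-1 * (4 * Rb * al t.+1 * tau)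
    = 4 * Rb * tau * ((A_ t.+1)^-1 - 1).
  have := @inv_AprodS R p t; rewrite mulrC => h.
  have -> : (A_ t.+1)^-1 * (4 * Rb * al t.+1 * tau) = 4 * Rb * tau * ((A_ t.+1)^-1 * al t.+1) by ring.
  by rewrite -h; ring.
have h2 : t%:R * (3 / 4 * (tau ^+ 2 / delta 2)) / A_ t + (A_ t.+1)^-1 * (3 / 4 * (tau ^+ 2 / delta 2))
    <= t.+1%:R * (3 / 4 * (tau ^+ 2 / delta 2)) / A_ t.+1.
  have := ler_wpM2l (mulr_ge0 (ler0n R t) tt) (invA_mono (leqnSn t)).
  rewrite -[t.+1%:R]natr1; move: (3 / 4 * _) (A_ t)^-1 (A_ t.+1)^-1 => a b c; lra.
have h3 : (minn t t0)%:R * (slack0 / A_ t0)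
    + (A_ t.+1)^-1 * (if (t.+1 < t0)%N then slack0 else 0)
    <= (minn t.+1 t0)%:R * (slack0 / A_ t0).
  have s0 := slack0_ge0.
  have sA : 0 <= slack0 / A_ t0 by apply: divr_ge0 => //; exact/ltW/Aprod_gt0.
  case: ifPn => [tl|_]; last first.
    rewrite mulr0 addr0; apply: ler_wpM2r => //.
    by rewrite ler_nat leq_min geq_min leqnSn geq_minr.
  have -> : minn t t0 = t by apply/minn_idPl; rewrite ltnW // ltnW.
  have -> : minn t.+1 t0 = t.+1 by apply/minn_idPl; rewrite ltnW.
  have := ler_wpM2l s0 (invA_mono (ltnW tl)).
  by rewrite -natr1; move: (A_ t0)^-1 (A_ t.+1)^-1 => a b; lra.
move: h1 h2 h3.
set a1 := 4 * Rb * tau * _; set a2 := (A_ t.+1)^-1 * (4 * _ * _ * _); set a3 := 4 * Rb * tau * _.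
set b1 := t%:R * _ / _; set b2 := (A_ t.+1)^-1 * (3 / 4 * _); set b3 := t.+1%:R * _ / _.
set c1 := (minn t _)%:R * _; set c2 := (A_ t.+1)^-1 * (if _ then _ else _).
set c3 := (minn t.+1 _)%:R * _ => h1 h2 h3.
have -> : (A_ t.+1)^-1 * (4 * Rb * al t.+1 * tau + 3 / 4 * (tau ^+ 2 / delta 2)
   + (if (t.+1 < t0)%N then slack0 else 0)) = a2 + b2 + c2.
  by rewrite /a2 /b2 /c2 !mulrDr.
by clearbody a1 a2 a3 b1 b2 b3 c1 c2 c3; lra.
Qed.

(** By convexity each linear model lies below [f] at [xs], up to first-order noise times the
    distance to [xs]; the weights of the models telescope. *)
Lemma psi_upper t : (t < T)%N ->
  psi t.+1 xs <= f (x 1%N) + \sum_(2 <= i < p.+2) kap t i / i`!%:R * enorm (xs - x0) ^+ i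
    + ((A_ t)^-1 - 1) * (f xs + tau * Rb).
Proof.
elim: t => [|t IH] tT.
  by rewrite Aprod0 invr1 subrr mul0r addr0 [leLHS]/= dreg_sum.
have q2 : (t.+1.*2.+1 < T.*2)%N by move: tT; rewrite -leq_double.
have := noise (s := [:: xs - x t.+2]) q2 p1 erefl.
rewrite query_point_odd eqxx big_seq1 /= => /ler_normlW h1.
have h2 := convex_step (x t.+2) xs.
have h3 : enorm (xs - x t.+2) <= Rb by rewrite enormB; exact: xb.
have h4 := ler_wpM2l tau_ge0 h3.
have a0 : 0 <= al t.+1 / A_ t.+1 by apply: divr_ge0 => //; exact/ltW/Aprod_gt0.
rewrite [leLHS]/= -[X in X + _ + _ <= _]/(psi t.+1 xs) taylor1 dreg_sum.
have h5 : f (x t.+2) + 'D_(xs - x t.+2) (fb t.+1.*2.+1 1) (x t.+2) <= f xs + tau * Rb.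
  move: h1 h2 h4; move: ('D_ _ f _) ('D_ _ _ _) => a b c d e; lra.
have h6 := ler_wpM2l a0 h5.
have h7 : \sum_(2 <= i < p.+2) kap t.+1 i / i`!%:R * enorm (xs - x0) ^+ i =
   \sum_(2 <= i < p.+2) kap t i / i`!%:R * enorm (xs - x0) ^+ i +
   \sum_(2 <= i < p.+2) (kap t.+1 i - kap t i) / i`!%:R * enorm (xs - x0) ^+ i.
  by rewrite -big_split; apply: eq_bigr => i _ /=; rewrite -mulrDl -mulrDl subrKC.
rewrite h7; have h8 := IH (ltnW tT).
move: h6 h8; rewrite -(@inv_AprodS R p t).
move: (f (x t.+2) + _) (f xs + _) (A_ t)^-1 (A_ t.+1)^-1 => a b c d.
set s1 := \sum_(_ <= _ < _) _; set s2 := \sum_(_ <= _ < _) _.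
by move: (psi t.+1 xs) s1 s2 => e s1 s2 l1 l2; lra.
Qed.

Definition model_error (h : V) : R := tau * enorm h
  + \sum_(2 <= i < p.+1) delta i / i`!%:R * enorm h ^+ i + Lp * enorm h ^+ p.+1 / (p.+1)`!%:R.

Lemma taylor_model_error z : (0 < T)%N ->
  `|f z - taylor f x0 (G 0%N x0) p z| <= model_error (z - x0).
Proof.
move=> T0; set h := z - x0.
have tE : taylor f x0 (G 0%N x0) p z =
    f x0 + \sum_(1 <= i < p.+1) dseq (nseq i h) (fb 0 i) x0 / i`!%:R.
  rewrite /taylor big_seq [in RHS]big_seq; congr (_ + _); apply: eq_bigr => i.
  by rewrite mem_index_iota ltnS => ip; rewrite /tpow (GE _ _ _ ip) mulrC.
have := taylor_value f_diff f_lip x0 z; rewrite -/h big_ltn // fact0 divr1.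
rewrite -[dseq (nseq 0 h) f x0]/(f x0) => TV.
have NZ : `|\sum_(1 <= i < p.+1) dseq (nseq i h) (fb 0 i) x0 / i`!%:R
    - \sum_(1 <= i < p.+1) dseq (nseq i h) f x0 / i`!%:R|
    <= tau * enorm h + \sum_(2 <= i < p.+1) delta i / i`!%:R * enorm h ^+ i.
  have q0 : (0 < T.*2)%N by rewrite double_gt0.
  have bnd i : (1 <= i <= p)%N -> `|dseq (nseq i h) (fb 0 i) x0 / i`!%:R - dseq (nseq i h) f x0 / i`!%:R|
       <= (if i == 1%N then tau else delta i) / i`!%:R * enorm h ^+ i.
    move=> ip; rewrite -mulrBl normrM normfV normr_nat.
    apply: le_trans (ler_wpM2r _ (noise q0 ip (size_nseq i h))) _; first by rewrite invr_ge0.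
    rewrite big_nseq -[iter _ _ _]/(iter i ( *%R (enorm h)) 1) iter_mulr_1.
    by rewrite mulrAC.
  rewrite -sumrB; apply: le_trans (ler_norm_sum _ _ _) _.
  have p2' : (1 < p.+1)%N by rewrite ltnS ltnW.
  rewrite (big_ltn p2'); apply: lerD.
    by apply: le_trans (bnd 1%N p1) _; rewrite eqxx expr1 (_ : 1`!%:R = 1) // divr1.
  rewrite big_seq [leRHS]big_seq; apply: ler_sum => i; rewrite mem_index_iota => ip.
  have i2 : (2 <= i)%N by case/andP: ip.
  have i1 : (1 <= i <= p)%N by case/andP: ip => i2' ip; rewrite ltnW.
  apply: le_trans (bnd i i1) _.
  by rewrite gtn_eqF.
rewrite tE /model_error.
move: TV NZ; move: (\sum_(1 <= i < p.+1) _) (\sum_(1 <= i < p.+1) _) => s1 s2 TV NZ.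
have -> : f z - (f x0 + s1) = (f z - (f x0 + s2)) - (s1 - s2) by ring.
by apply: le_trans (ler_normB _ _) _; rewrite [leRHS]addrC; exact: lerD.
Qed.

(** x_1 is compared with [xs] in the model at x_0. At x_1 the regularizer absorbs the model error of
    orders 2 and more; at [xs] the two add up, whence the factor 2 and the sum Lp + p sigma. *)
Lemma initial_gap : (0 < T)%N ->
  f (x 1%N) - f xs <= 2 * (\sum_(2 <= i < p.+1) delta i / i`!%:R * enorm (xs - x0) ^+ i)
    + (Lp + p%:R * sigma) * enorm (xs - x0) ^+ p.+1 / (p.+1)`!%:R
    + tau * (enorm (xs - x0) + Rb).
Proof.
move=> T0; case: run => /(_ xs) opt _ _.
have regE z : reg_model p sigma f x0 (G 0%N x0) delta z = taylor f x0 (G 0%N x0) p z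
   + \sum_(2 <= i < p.+1) delta i / i`!%:R * enorm (z - x0) ^+ i
   + p%:R * sigma * enorm (z - x0) ^+ p.+1 / (p.+1)`!%:R.
  rewrite /reg_model; congr (_ + _ + _).
    rewrite big_seq [RHS]big_seq; apply: eq_bigr => i; rewrite mem_index_iota => /andP[i2 _].
    by rewrite dreg_coef // ltnW.
  rewrite /dreg factS natrM.
  have -> : p`!%:R = p%:R * (p.-1)`!%:R :> R.
    by rewrite -natrM; case: (p) p_ge2 => // k _; rewrite factS.
  have : p%:R != 0 :> R by rewrite pnatr_eq0 -lt0n ltnW.
  have : p.+1%:R != 0 :> R by rewrite pnatr_eq0.
  have : (p.-1)`!%:R != 0 :> R by rewrite pnatr_eq0 -lt0n fact_gt0.
  move: (p%:R : R) (p.+1%:R : R) ((p.-1)`!%:R : R) (_ ^+ p.+1) => P P1 q e q0 P10 P0.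
  by field; rewrite P0 q0 P10.
rewrite !regE in opt.
have := taylor_model_error (x 1%N) T0; have := taylor_model_error xs T0.
rewrite /model_error !ler_norml => /andP[a1 _] /andP[_ b1].
have rb : enorm (x 1%N - x0) <= Rb by case: bounded.
have := ler_wpM2l tau_ge0 rb.
have h : 0 <= enorm (x 1%N - x0) ^+ p.+1 / (p.+1)`!%:R.
  by apply: divr_ge0 => //; apply: exprn_ge0; exact: enorm_ge0.
have h1 : Lp * enorm (x 1%N - x0) ^+ p.+1 / (p.+1)`!%:R
   <= p%:R * sigma * enorm (x 1%N - x0) ^+ p.+1 / (p.+1)`!%:R.
  rewrite -!mulrA [p%:R * (sigma * _)]mulrA; apply: ler_wpM2r => //.
  by move: Lp_ge0 sigma_ge; move: (p%:R * sigma) => ps l0 l1; lra.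
move: opt a1 b1 h1.
move: (\sum_(2 <= i < p.+1) _) (\sum_(2 <= i < p.+1) _) => s1 s2.
move: (taylor _ _ _ _ _) (taylor _ _ _ _ _) => T1 T2.
rewrite [(Lp + _) * _]mulrDl mulrDl.
move: (_ / (p.+1)`!%:R) (_ / (p.+1)`!%:R) (_ / (p.+1)`!%:R) (_ / (p.+1)`!%:R) => c1 c2 c3 c4.
move: (f xs) (f (x 1%N)) (enorm (xs - x0)) (enorm (x 1%N - x0)) => fs f1 e1 e2.
move=> l1 l2 l3 l4 l5; lra.
Qed.

(** [run_potential] and [psi_upper] meet at the minimizer of [psi], and everything is multiplied by
    A_(T-1). Of 5 Rb tau, four parts come from [run_error] and one from [psi_upper]. *)
Theorem convergence : (0 < T)%N ->
  f (x T) - f xs <= A_ T.-1 *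
    (2 * (\sum_(2 <= i < p.+1) delta i / i`!%:R * enorm (xs - x0) ^+ i)
    + (Lp + p%:R * sigma) * enorm (xs - x0) ^+ p.+1 / (p.+1)`!%:R
    + tau * (enorm (xs - x0) + Rb)
    + \sum_(2 <= i < p.+2) kap T.-1 i / i`!%:R * enorm (xs - x0) ^+ i
    + t0%:R * (slack0 / A_ t0))
  + 5 * Rb * tau + T%:R * (3 / 4 * (tau ^+ 2 / delta 2)).
Proof.
move=> T0; have T1 : (T.-1 < T)%N by rewrite prednK.
have ymin : psi T.-1.+1 (y T.-1.+1) <= psi T.-1.+1 xs.
  case: run => _ h1 h2; move: T.-1 => t.
  by case: t => [|t]; [exact: h1 | have [_] := h2 t.+1 isT; exact].
have := initial_gap T0.
have := le_trans (run_potential T1) (le_trans ymin (psi_upper T1)).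
rewrite prednK // /run_error.
have A0 := @Aprod_gt0 R p T.-1.
have A1 : A_ T.-1 <= 1 by rewrite -(@Aprod0 R p); exact: Aprod_anti.
have d2 : 0 < delta 2 by apply: delta_gt0; rewrite p_ge2.
have tt : 0 <= 3 / 4 * (tau ^+ 2 / delta 2).
  by apply: mulr_ge0 => //; apply: divr_ge0; [exact: sqr_ge0 | exact: ltW].
have h1 : (minn T.-1 t0)%:R * (slack0 / A_ t0) <= t0%:R * (slack0 / A_ t0).
  apply: ler_wpM2r; last by rewrite ler_nat geq_minr.
  by apply: divr_ge0; [exact: slack0_ge0 | exact/ltW/Aprod_gt0].
have h2 : T.-1%:R * (3 / 4 * (tau ^+ 2 / delta 2)) <= T%:R * (3 / 4 * (tau ^+ 2 / delta 2)).
  by apply: ler_wpM2r => //; rewrite ler_nat leq_pred.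
have h3 : 0 <= (1 - A_ T.-1) * (Rb * tau) - 0.
  by rewrite subr0; apply: mulr_ge0; [rewrite subr_ge0 | apply: mulr_ge0 => //; exact: ltW].
have h4 : 0 <= A_ T.-1 * (Rb * tau) by do 2 (apply: mulr_ge0; try exact: ltW).
move: h1 h2; move: (3 / 4 * _) (t0%:R * _) ((minn _ _)%:R * _) => a b c h1 h2.
move: (\sum_(2 <= i < p.+1) _) (\sum_(2 <= i < p.+2) _) (_ / (p.+1)`!%:R) => s1 s2 s3.
move: (enorm _) (f (x T)) (f (x 1%N)) (f xs) => r fT f1 fs.
move: (A_ T.-1) A0 A1 h3 h4 => A A0 A1 h3 h4 l1 l2.
have {}l1 := ler_wpM2l (ltW A0) l1.
have {}l2 := ler_wpM2l (ltW A0) l2.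
have {}h1 := ler_wpM2l (ltW A0) h1.
have E1 : A * (fT / A - (4 * Rb * tau * (A^-1 - 1) + T.-1%:R * a / A + c))
  = fT - 4 * (Rb * tau) * (1 - A) - T.-1%:R * a - A * c by field; rewrite gt_eqF.
have E2 : A * (f1 + s2 + (A^-1 - 1) * (fs + tau * Rb)) = A * f1 + A * s2 + (1 - A) * (fs + Rb * tau).
  by field; rewrite gt_eqF.
rewrite E1 E2 in l1.
move: (T.-1%:R * a) (T%:R * a) h2 l1 => d e h2 l1.
lra.
Qed.

End Run.

(** * Explicit rate for tolerances growing like T^i *)

Section Rate.
Context {R : realType} (p : nat) (Lp sigma : R) (eta : nat -> R) (R0 Rb : R).
Hypotheses (p_ge2 : (2 <= p)%N) (Lp_ge0 : 0 <= Lp) (sigma_ge : 3 * Lp <= p%:R * sigma)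
  (eta_ge3 : forall i, (2 <= i <= p)%N -> 3 <= eta i)
  (R0_ge0 : 0 <= R0) (Rb_gt0 : 0 < Rb).

Local Notation t0 := (9 * p.+1)%N.
Local Notation fct := ((p.+1)`!%:R : R).
Local Notation A_ := (@Aprod R p).
Local Notation al := (@alpha R p).

(** In [rate1] and [rate2] the three summands come, in this order, from the initial gap, the last
    regularizer and the early slack. *)
Definition rate1 : R :=
  2 * (\sum_(2 <= i < p.+1) fct / i`!%:R * R0 ^+ i)
  + \sum_(2 <= i < p.+1) kcoef p i * p.+1%:R ^+ i * (eta i + 2) / i`!%:R * R0 ^+ i
  + t0%:R / A_ t0 * \sum_(2 <= i < p.+1) eta i * fct * ((2 * Rb) ^+ i / 2 / (i.-1)`!%:R).

Definition rate2 : R :=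
  fct * ((Lp + p%:R * sigma) * R0 ^+ p.+1 / fct)
  + kcoef p p.+1 * p.+1%:R ^+ p.+1 * (2 * Lp + p%:R * sigma) / fct * R0 ^+ p.+1
  + t0%:R / A_ t0 * (fct * (p%:R * sigma * ((2 * Rb) ^+ p.+1 / 2 / p`!%:R))).

Definition rate3 : R := R0 + 6 * Rb.

Let ps0 : 0 <= p%:R * sigma.
Proof. by apply: le_trans sigma_ge; apply: mulr_ge0. Qed.

Let eta0 i : (2 <= i < p.+1)%N -> 0 <= eta i.
Proof. by move=> h; apply: le_trans (eta_ge3 _). Qed.

Let At0 : 0 <= t0%:R / A_ t0.
Proof. by apply: divr_ge0 => //; exact/ltW/Aprod_gt0. Qed.

Lemma rate_ge0 : [/\ 0 <= rate1, 0 <= rate2 & 0 <= rate3].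
Proof.
have Rb0 := ltW Rb_gt0.
have R2 : 0 <= 2 * Rb by apply: mulr_ge0.
have bi i : 0 <= (2 * Rb) ^+ i / 2 by apply: divr_ge0 => //; exact: exprn_ge0.
have ri i : 0 <= R0 ^+ i by exact: exprn_ge0.
have L2 : 0 <= 2 * Lp + p%:R * sigma by apply: addr_ge0 => //; exact: mulr_ge0.
split.
- apply: addr_ge0; first apply: addr_ge0.
  + by apply: mulr_ge0 => //; apply: sumr_ge0 => i _; apply: mulr_ge0 => //; apply: divr_ge0.
  + rewrite big_seq; apply: sumr_ge0 => i; rewrite mem_index_iota => h.
    apply: mulr_ge0 => //; apply: divr_ge0 => //; apply: mulr_ge0; last by apply: addr_ge0 => //; exact: eta0.
    by apply: mulr_ge0; [exact: kcoef_ge0 | exact: exprn_ge0].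
  + apply: mulr_ge0 => //; rewrite big_seq; apply: sumr_ge0 => i; rewrite mem_index_iota => h.
    by apply: mulr_ge0; [apply: mulr_ge0 => //; exact: eta0 | exact: divr_ge0].
- apply: addr_ge0; first apply: addr_ge0.
  + apply: mulr_ge0 => //; apply: divr_ge0 => //; apply: mulr_ge0 => //.
    exact: addr_ge0.
  + apply: mulr_ge0 => //; apply: divr_ge0 => //; apply: mulr_ge0 => //.
    by apply: mulr_ge0; [exact: kcoef_ge0 | exact: exprn_ge0].
  + by apply: mulr_ge0 => //; apply: mulr_ge0 => //; apply: mulr_ge0 => //; apply: divr_ge0.
- by apply: addr_ge0 => //; apply: mulr_ge0.
Qed.

Context (T : nat) (d tau : R) (delta : nat -> R).
Hypotheses (T_gt0 : (0 < T)%N) (d_gt0 : 0 < d) (tau_ge0 : 0 <= tau)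
  (deltaE : forall i, (2 <= i <= p)%N -> delta i = d * T%:R ^+ i).

Let TR : (0 : R) < T%:R. Proof. by rewrite ltr0n. Qed.

Let AT : A_ T.-1 <= fct / T%:R ^+ p.+1.
Proof. by rewrite ler_pdivlMr ?exprn_gt0 // -[in X in _ * X](prednK T_gt0) Aprod_le. Qed.

Let AT1 : A_ T.-1 <= 1.
Proof. by rewrite -(@Aprod0 R p); exact: Aprod_anti. Qed.

Let Adelta i : (2 <= i < p.+1)%N -> A_ T.-1 * delta i <= d * fct.
Proof.
move=> h; rewrite deltaE // mulrCA ler_pM2l //.
apply: le_trans (ler_wpM2r _ AT) _; first exact/exprn_ge0/ltW.
rewrite mulrAC ler_pdivrMr ?exprn_gt0 // ler_wpM2l //.
by apply: ler_weXn2l; [rewrite ler1n | case/andP: h => _ /ltnW].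
Qed.

(** Exact compensation of the T^i in [delta i]; in the other error terms A_(T-1) dominates every T^i
    with i <= p+1. *)
Let alT i : al T.-1 ^+ i <= p.+1%:R ^+ i / T%:R ^+ i.
Proof.
rewrite -expr_div_n; apply: lerXn2r; rewrite ?nnegrE ?divr_ge0 //.
rewrite /alpha ler_pM2l // lef_pV2 ?posrE ?ltr0n ?addnS // ler_nat.
by rewrite -[leqLHS](prednK T_gt0) ltnS leq_addr.
Qed.

Lemma rate_bound :
  A_ T.-1 *
    (2 * (\sum_(2 <= i < p.+1) delta i / i`!%:R * R0 ^+ i)
    + (Lp + p%:R * sigma) * R0 ^+ p.+1 / fct
    + tau * (R0 + Rb)
    + \sum_(2 <= i < p.+2) kappa p Lp sigma eta delta T.-1 i / i`!%:R * R0 ^+ i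
    + t0%:R * (slack0 p sigma eta delta Rb / A_ t0))
  + 5 * Rb * tau + T%:R * (3 / 4 * (tau ^+ 2 / delta 2))
  <= rate1 * d + rate2 / T%:R ^+ p.+1 + rate3 * tau + tau ^+ 2 / d.
Proof.
have A0 := @Aprod_gt0 R p T.-1.
have Rb0 := ltW Rb_gt0.
have R2 : 0 <= 2 * Rb by apply: mulr_ge0.
have bi i : 0 <= (2 * Rb) ^+ i / 2 by apply: divr_ge0 => //; exact: exprn_ge0.
have ri i : 0 <= R0 ^+ i by exact: exprn_ge0.
have L2 : 0 <= 2 * Lp + p%:R * sigma by apply: addr_ge0 => //; exact: mulr_ge0.
have ha : A_ T.-1 * (2 * (\sum_(2 <= i < p.+1) delta i / i`!%:R * R0 ^+ i))
    <= 2 * (\sum_(2 <= i < p.+1) fct / i`!%:R * R0 ^+ i) * d.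
  rewrite mulrCA -mulrA; apply: ler_wpM2l => //.
  rewrite mulr_sumr mulr_suml big_seq [leRHS]big_seq; apply: ler_sum => i.
  rewrite mem_index_iota => h; rewrite !mulrA -mulrA [leRHS]mulrC -!mulrA [leRHS]mulrA.
  by rewrite mulrA; apply: ler_wpM2r; [apply: mulr_ge0 | exact: Adelta].
have hb : A_ T.-1 * ((Lp + p%:R * sigma) * R0 ^+ p.+1 / fct)
    <= fct * ((Lp + p%:R * sigma) * R0 ^+ p.+1 / fct) / T%:R ^+ p.+1.
  rewrite [leRHS]mulrAC; apply: ler_wpM2r => //; apply: divr_ge0 => //.
  by apply: mulr_ge0 => //; exact: addr_ge0.
have hc : A_ T.-1 * (tau * (R0 + Rb)) <= tau * (R0 + Rb).
  by apply: ler_piMl => //; apply: mulr_ge0 => //; exact: addr_ge0.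
have hd : A_ T.-1 * (\sum_(2 <= i < p.+2) kappa p Lp sigma eta delta T.-1 i / i`!%:R * R0 ^+ i)
   <= (\sum_(2 <= i < p.+1) kcoef p i * p.+1%:R ^+ i * (eta i + 2) / i`!%:R * R0 ^+ i) * d
     + kcoef p p.+1 * p.+1%:R ^+ p.+1 * (2 * Lp + p%:R * sigma) / fct * R0 ^+ p.+1 / T%:R ^+ p.+1.
  rewrite big_nat_recr ?ltnS ?(ltnW p_ge2) //= mulrDr.
  have kE i : A_ T.-1 * (kappa p Lp sigma eta delta T.-1 i / i`!%:R * R0 ^+ i)
      = kcoef p i * al T.-1 ^+ i * kwgt p Lp sigma eta delta i / i`!%:R * R0 ^+ i.
    rewrite kappaE; move: (R0 ^+ i) (i`!%:R^-1) (kcoef p i) (al _ ^+ i) (kwgt _ _ _ _ _ _) => a b c e g.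
    by field; rewrite gt_eqF.
  have kc i := @kcoef_ge0 R p i.
  apply: lerD; last first.
    rewrite kE /kwgt eqxx.
    have m0 : 0 <= kcoef p p.+1 * (2 * Lp + p%:R * sigma) / fct * R0 ^+ p.+1.
      by apply: mulr_ge0 => //; apply: divr_ge0 => //; apply: mulr_ge0.
    have := ler_wpM2l m0 (alT p.+1).
    move: (al _ ^+ _) (p.+1%:R ^+ _) (R0 ^+ _) (_ ^+ p.+1)^-1 (fct^-1) (2 * Lp + _) => a b c e g h.
    lra.
  rewrite mulr_sumr mulr_suml big_seq [leRHS]big_seq; apply: ler_sum => i.
  rewrite mem_index_iota => h; rewrite kE /kwgt ltn_eqF; last by case/andP: h.
  rewrite deltaE //.
  have := ler_wpM2r _ (alT i); move=> /(_ (T%:R ^+ i)).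
  rewrite divfK ?gt_eqF ?exprn_gt0 // => /(_ (exprn_ge0 _ (ltW TR))) l.
  have m0 : 0 <= kcoef p i * (eta i + 2) / i`!%:R * R0 ^+ i * d.
    apply: mulr_ge0; last exact: ltW.
    apply: mulr_ge0 => //; apply: divr_ge0 => //; apply: mulr_ge0 => //.
    by apply: addr_ge0 => //; exact: eta0.
  have := ler_wpM2l m0 l.
  move: (al _ ^+ i) (T%:R ^+ i) (R0 ^+ i) (_%:R^-1) (p.+1%:R ^+ i) => a b c e g.
  lra.
have he : A_ T.-1 * (t0%:R * (slack0 p sigma eta delta Rb / A_ t0)) <=
   t0%:R / A_ t0 * (\sum_(2 <= i < p.+1) eta i * fct * ((2 * Rb) ^+ i / 2 / (i.-1)`!%:R)) * d
   + t0%:R / A_ t0 * (fct * (p%:R * sigma * ((2 * Rb) ^+ p.+1 / 2 / p`!%:R))) / T%:R ^+ p.+1.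
  have -> : A_ T.-1 * (t0%:R * (slack0 p sigma eta delta Rb / A_ t0))
     = t0%:R / A_ t0 * (A_ T.-1 * slack0 p sigma eta delta Rb) by ring.
  rewrite -[X in _ <= X + _]mulrA -[X in _ <= _ + X]mulrA -mulrDr; apply: ler_wpM2l => //.
  have -> : slack0 p sigma eta delta Rb =
     \sum_(2 <= i < p.+2) wreg p sigma eta delta i * ((2 * Rb) ^+ i / 2 / (i.-1)`!%:R).
    by apply: eq_bigr => i _; rewrite mulrAC mulrA.
  rewrite (wS_split sigma eta delta p_ge2) mulrDr; apply: lerD; last first.
    rewrite /= [leRHS]mulrAC; apply: ler_wpM2r AT.
    by apply: mulr_ge0 => //; apply: divr_ge0.
  rewrite mulr_sumr mulr_suml big_seq [leRHS]big_seq; apply: ler_sum => i.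
  rewrite mem_index_iota => h.
  have m0 : 0 <= eta i * ((2 * Rb) ^+ i / 2 / (i.-1)`!%:R).
    by apply: mulr_ge0; [exact: eta0 | apply: divr_ge0].
  have := ler_wpM2l m0 (Adelta h).
  by move: ((2 * Rb) ^+ i / 2 / _) => a; lra.
(* [delta 2] is d T^2, so even the sum of T such terms decays. *)
have hf : T%:R * (3 / 4 * (tau ^+ 2 / delta 2)) <= tau ^+ 2 / d.
  rewrite deltaE ?p_ge2 //.
  have T1 : (1 : R) <= T%:R by rewrite ler1n.
  have -> : T%:R * (3 / 4 * (tau ^+ 2 / (d * T%:R ^+ 2))) = tau ^+ 2 / d * (3 / 4 / T%:R).
    by move: (T%:R : R) TR => S S0; field; rewrite !gt_eqF.
  apply: ler_piMr; first by apply: divr_ge0; [exact: sqr_ge0 | exact: ltW].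
  by rewrite ler_pdivrMr //; lra.
rewrite 4!(mulrDr (A_ T.-1)).
apply: le_trans (lerD (lerD (lerD (lerD (lerD (lerD ha hb) hc) hd) he)
  (lexx (5 * Rb * tau))) hf) _.
rewrite /rate1 /rate2 /rate3 le_eqVlt; apply/orP; left; apply/eqP.
clear; set a1 := 2 * _; set a2 := \sum_(_ <= _ < _) _; set a3 := _ * \sum_(_ <= _ < _) _.
set b1 := fct * _; set b2 := _ / fct * _; set b3 := t0%:R / _ * (fct * _).
set c := _ / d; set e := T%:R ^+ _.
ring.
Qed.

End Rate.

(** * Joint measurability and centring of the noise derivatives *)

Section JointMeasurability.
Context {R : realType} {n : nat} {dX : measure_display} {Xi : measurableType dX}.
Local Notation V := 'rV[R]_n.
Context (p : nat) (E : V -> Xi -> R).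
Hypotheses (p_gt0 : (0 < p)%N) (E_meas : forall x, measurable_fun setT (E x))
  (E_diff : forall z, times_differentiable p (E^~ z)).

Definition coord_measurable {d} {W : measurableType d} (X : W -> V) :=
  forall j, measurable_fun setT (fun w => X w ord0 j).

Definition grid_point (m : nat) (a : {ffun 'I_n -> int}) : V :=
  \row_j ((a j)%:~R / m.+1%:R).

Definition grid_code (m : nat) (v : V) : {ffun 'I_n -> int} :=
  [ffun j => Num.floor (m.+1%:R * v ord0 j)].

Lemma grid_cvg (v : V) : (fun m => grid_point m (grid_code m v)) @ \oo --> v.
Proof.
apply/cvgrPdist_le => /= e e0.
pose C := \sum_j `|bvec j : V|.
have C0 : 0 <= C by exact: sumr_ge0.
near=> m.
have mC : C / e <= m.+1%:R.
  apply: le_trans (_ : m%:R <= _); last by rewrite ler_nat.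
  by near: m; exact: nbhs_infty_ger.
set w := v - _; rewrite (row_sum_delta w).
apply: le_trans (ler_norm_sum _ _ _) _.
apply: le_trans (_ : \sum_j m.+1%:R^-1 * `|bvec j : V| <= _); last first.
  rewrite -mulr_sumr -/C ler_pdivrMl ?ltr0n //.
  by move: mC; rewrite ler_pdivrMr.
apply: ler_sum => j _; rewrite normrZ; apply: ler_wpM2r => //.
rewrite /w !mxE ffunE; set t := v ord0 j.
have /andP[l1 l2] := floor_itv (m.+1%:R * t).
have m0 : 0 < m.+1%:R :> R by rewrite ltr0n.
have -> : t - (Num.floor (m.+1%:R * t))%:~R / m.+1%:R =
    m.+1%:R^-1 * (m.+1%:R * t - (Num.floor (m.+1%:R * t))%:~R).
  by rewrite mulrBr mulKf ?gt_eqF // [_^-1 * _]mulrC.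
rewrite normrM ger0_norm ?invr_ge0 ?(ltW m0) // -[leRHS]mulr1 ler_wpM2l ?invr_ge0 ?(ltW m0) //.
rewrite ger0_norm ?subr_ge0 // lerBlDl; apply: ltW.
by rewrite intrD in l2.
Unshelve. all: by end_near. Qed.

(** A function measurable in the sample and continuous in the point is jointly measurable: with the
    point rounded to a grid, preimages are countable unions of measurable rectangles, and continuity
    lets the mesh tend to 0. *)
Lemma measurable_eval {d} {W : measurableType d} (X : W -> V) :
  coord_measurable X -> measurable_fun setT (fun q : W * Xi => E (X q.1) q.2).
Proof.
move=> mX.
apply: (@measurable_fun_cvg _ _ R setT
  (fun m (q : W * Xi) => E (grid_point m (grid_code m (X q.1))) q.2)); last first.
  move=> [w z] _ /=.
  have cE : {for X w, continuous (E^~ z)}.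
    exact/differentiable_continuous/(tdiff_differentiable p_gt0 (E_diff z)).
  by apply: (cvg_comp (fun m => grid_point m (grid_code m (X w))) (E^~ z));
    [exact: grid_cvg | exact: cE].
move=> m _ B mB; rewrite setTI.
rewrite (_ : _ @^-1` B = \bigcup_(a : {ffun 'I_n -> int})
   ((\bigcap_(j : 'I_n) [set w | Num.floor (m.+1%:R * X w ord0 j) == a j]) `*`
    (E (grid_point m a) @^-1` B))); last first.
  apply/seteqP; split=> [[w z] /= h|[w z] [a _ [/= h1 h2]]].
    exists (grid_code m (X w)) => //; split => //= j _ /=.
    by rewrite ffunE.
  have -> : grid_code m (X w) = a by apply/ffunP => j; rewrite ffunE; exact/eqP/h1.
  exact: h2.
apply: countable_bigcupT_measurable => // a; apply: measurableX; last first.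
  by rewrite -[X in measurable X]setTI; exact: E_meas.
apply: fin_bigcap_measurable => // j _.
under eq_set do rewrite floor_eq.
have mg : measurable_fun setT (fun w => m.+1%:R * X w ord0 j).
  by apply: measurable_funM => //; exact: mX.
have := mg measurableT _ (measurable_itv `[(a j)%:~R : R, (a j + 1)%:~R[).
by rewrite setTI; congr measurable; apply/seteqP; split=> w /=; rewrite in_itv.
Qed.

Lemma derive_cvg_seq (g : V -> R) x v : derivable g x v ->
  (fun k => k.+1%:R * (g (x + k.+1%:R^-1 *: v) - g x)) @ \oo --> 'D_v g x.
Proof.
move=> dg.
have cv : (fun h : R => h^-1 * (g (h *: v + x) - g x)) @ 0^' --> 'D_v g x by exact: dg.
apply/cvgrPdist_le => /= e e0; move/cvgrPdist_le : cv => /(_ e e0) /=.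
rewrite near_withinE => /nbhs_normP[r r0 H]; near=> k.
have kr : k.+1%:R^-1 < r.
  rewrite invf_plt ?posrE ?ltr0n //; apply: lt_le_trans (_ : k.+1%:R <= _); last by [].
  apply: le_lt_trans (_ : k%:R < _); last by rewrite ltr_nat.
  by near: k; exact: nbhs_infty_ger.
have := H k.+1%:R^-1; rewrite /= sub0r normrN ger0_norm ?invr_ge0 //.
by move=> /(_ kr); rewrite invr_eq0 pnatr_eq0 invrK [_ *: v + x]addrC; apply.
Unshelve. all: by end_near. Qed.

(** A derivative is the limit of difference quotients with steps 1/(k+1). These involve the shifted
    point, so the induction quantifies over [X]. *)
Lemma measurable_dseq {d} {W : measurableType d} (X : W -> V) (s : seq V) :
  (size s <= p)%N -> coord_measurable X ->
  measurable_fun setT (fun q : W * Xi => dseq s (E^~ q.2) (X q.1)).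
Proof.
elim: s X => [|v s IH] X sp mX; first exact: measurable_eval.
have mXk (k : nat) : coord_measurable (fun w => X w + k.+1%:R^-1 *: v).
  move=> j; apply: (eq_measurable_fun (fun w => X w ord0 j + k.+1%:R^-1 * v ord0 j)).
    by move=> w _; rewrite !mxE.
  by apply: measurable_funD => //; exact: mX.
apply: (@measurable_fun_cvg _ _ R setT (fun k (q : W * Xi) =>
   k.+1%:R * (dseq s (E^~ q.2) (X q.1 + k.+1%:R^-1 *: v) - dseq s (E^~ q.2) (X q.1)))).
  move=> k; apply: measurable_funM => //; apply: measurable_funB.
    exact: (IH _ (ltnW sp) (mXk k)).
  exact: (IH _ (ltnW sp) mX).
move=> [w z] _ /=; apply: derive_cvg_seq; apply: diff_derivable.
exact: dseq_differentiable (E_diff z) sp.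
Qed.

Lemma measurable_dseq_at (s : seq V) x : (size s <= p)%N ->
  measurable_fun setT (fun z => dseq s (E^~ z) x).
Proof.
move=> sp.
have mX : coord_measurable (fun _ : Xi => x) by move=> j; exact: measurable_cst.
exact: (measurableT_comp (measurable_dseq sp mX)
  (measurable_fun_pair (@measurable_id _ Xi setT) (@measurable_id _ Xi setT))).
Qed.

Context (D : probability Xi R) (M : nat -> R).
Hypotheses (E_int : forall x, D.-integrable setT (EFin \o E x))
  (E_mean : forall x, (\int[D]_z (E x z)%:E = 0)%E)
  (E_bound : forall (s : seq V) x z, (1 <= size s <= p)%N ->
     `|dseq s (E^~ z) x| <= M (size s) * \prod_(v <- s) enorm v).

Lemma MVT_line (g : V -> R) x v (B : R) : (forall y, differentiable g y) ->
  (forall y, `|'D_v g y| <= B) -> forall t : R, 0 < t ->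
  `|g (x + t *: v) - g x| <= B * t.
Proof.
move=> dg gB t t0.
have [c _ E1] := MVT0 t0 (fun c => is_derive_line (dg (x + c *: v))).
move: E1; rewrite scale0r addr0 => ->; rewrite normrM (gtr0_norm t0).
by rewrite ler_pM2r // gB.
Qed.

(* Differentiation under the expectation: the difference quotients are dominated
   by the bound on the next derivative. *)
Lemma dseq_mean_zero (s : seq V) x : (size s <= p)%N ->
  D.-integrable setT (fun z => (dseq s (E^~ z) x)%:E) /\
  (\int[D]_z (dseq s (E^~ z) x)%:E = 0)%E.
Proof.
elim: s x => [|v s IH] x sp; first by split; [exact: E_int | exact: E_mean].
pose B := M (size s).+1 * \prod_(w <- v :: s) enorm w.
pose q (k : nat) (z : Xi) : R := k.+1%:R * (dseq s (E^~ z) (x + k.+1%:R^-1 *: v) - dseq s (E^~ z) x).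
have dd z y : differentiable (dseq s (E^~ z)) y.
  exact: dseq_differentiable (E_diff z) sp.
have dB z y : `|'D_v (dseq s (E^~ z)) y| <= B by exact: (@E_bound (v :: s) y z sp).
have iq y : D.-integrable setT (fun z => (dseq s (E^~ z) y)%:E) by exact: (IH y (ltnW sp)).1.
have mq y : (\int[D]_z (dseq s (E^~ z) y)%:E = 0)%E by exact: (IH y (ltnW sp)).2.
have [|||||i1 _ cv] := @dominated_convergence _ Xi R D setT measurableT
  (fun k z => (q k z)%:E) (fun z => (dseq (v :: s) (E^~ z) x)%:E) (fun=> B%:E).
- move=> k; apply/measurable_EFinP; apply: measurable_funM => //.
  by apply: measurable_funB; apply: measurable_dseq_at; exact: ltnW.
- by apply/measurable_EFinP; exact: measurable_dseq_at.
- apply: aeW => z _; apply: cvg_EFin; first by apply: nearW.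
  exact/derive_cvg_seq/diff_derivable.
- exact: finite_measure_integrable_cst.
- apply: aeW => z k _; rewrite abse_EFin lee_fin normrM ger0_norm //.
  rewrite mulrC -ler_pdivlMr ?ltr0n //.
  exact: (MVT_line x (dd z) (dB z)).
split => //; apply: (cvg_unique _ cv) => //=.
rewrite (_ : (fun k => _) = fun=> 0%E); first exact: cvg_cst.
apply/funext => k; rewrite /q.
under eq_integral do rewrite EFinM EFinB.
rewrite integralZl //; last exact: integrableB.
by rewrite integralB // !mq sube0 mule0.
Qed.

End JointMeasurability.

Definition mfun_pack {d d'} {T : measurableType d} {T' : measurableType d'}
  (f : T -> T') (mf : measurable_fun setT f) : {mfun T >-> T'} :=
  HB.pack f (isMeasurableFun.Build _ _ _ _ _ mf).

(** * Independence of fresh samples from the past *)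

Section SampleSigmaAlgebra.
Context {R : realType} {dX dO : measure_display} {Xi : measurableType dX}
  {Omega : measurableType dO} {P : probability Omega R}.
Variable xi : nat -> nat -> {RV P >-> Xi}.

Definition sample_gen (I : set (nat * nat)) : set (set Omega) :=
  \bigcup_(k in I) preimage_set_system setT (xi k.1 k.2) measurable.

(** [Omega] with the coarser sigma-algebra of the samples in [I], as a type of its own: dependence
    on the past becomes ordinary measurability, and products with [Xi] come for free. *)
Definition sample_space (I : set (nat * nat)) := g_sigma_algebraType (sample_gen I).

Lemma sample_gen_measurable I : sample_gen I `<=` measurable.
Proof. by move=> _ [k _ [B mB <-]]; exact: measurable_funP. Qed.

Lemma sample_sigma_measurable I A : <<s sample_gen I >> A -> measurable A.
Proof. exact: (smallest_sub (@sigma_algebra_measurable _ Omega) (@sample_gen_measurable I)). Qed.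

Lemma sample_space_id I :
  measurable_fun setT (fun w : Omega => w : sample_space I).
Proof. by move=> _ A mA; rewrite setTI; exact: sample_sigma_measurable mA. Qed.

Lemma sample_space_sub I J : I `<=` J ->
  measurable_fun setT (fun w : sample_space J => w : sample_space I).
Proof.
move=> IJ _ A mA; rewrite setTI.
suff h : <<s sample_gen I >> `<=` <<s sample_gen J >> by exact: h.
by apply: sub_sigma_algebra2 => B [k Ik Bk]; exists k => //; exact: IJ.
Qed.

Lemma sample_space_xi I (k : nat * nat) : I k ->
  measurable_fun setT (fun w : sample_space I => xi k.1 k.2 w).
Proof.
move=> Ik _ B mB; apply: sub_sigma_algebra; exists k => //.
by exists B.
Qed.

Lemma past_sub q A : past xi q A -> <<s sample_gen [set k | (k.1 < q)%N] >> A.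
Proof.
apply: (sub_sigma_algebra2 (D := setT)) => B [i /= iq [j _ Bij]].
by exists (i, j).
Qed.

Context (D : probability Xi R).
Hypothesis iid : iid_samples D xi.

(** Both sides are finite measures in [A]. They agree on finite intersections of sample events
    indexed by [I], by mutual independence and because [k] is outside [I]; these sets form a
    pi-system generating the sigma-algebra. *)
Lemma sample_independent I (k : nat * nat) A B : ~ I k ->
  <<s sample_gen I >> A -> measurable B ->
  P (A `&` (xi k.1 k.2 @^-1` B)) = (P A * D B)%E.
Proof.
move=> Ik IA mB; have [dist indep] := iid.
have mxi (l : nat * nat) C : measurable C -> measurable (xi l.1 l.2 @^-1` C).
  by move=> mC; rewrite -[X in measurable X]setTI; exact: measurable_funP.
pose Pi : set (set Omega) := [set A | exists (J : {fset nat * nat}) (C : nat * nat -> set Xi),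
  [/\ [set` J] `<=` I, forall l, measurable (C l) &
      A = \bigcap_(l in [set` J]) (xi l.1 l.2 @^-1` C l)] ].
have Pim : Pi `<=` measurable.
  move=> _ [J [C [_ mC ->]]]; apply: fin_bigcap_measurable; first exact: finite_fset.
  by move=> l _; exact: mxi.
have PiI : setI_closed Pi.
  move=> _ _ [J1 [C1 [J1I mC1 ->]]] [J2 [C2 [J2I mC2 ->]]].
  exists (J1 `|` J2)%fset, (fun l => (if l \in J1 then C1 l else setT) `&`
     (if l \in J2 then C2 l else setT)); split.
  - by move=> l /=; rewrite inE => /orP[/J1I|/J2I].
  - by move=> l; apply: measurableI; case: ifP.
  - apply/seteqP; split=> w /=.
      move=> [h1 h2] l /=; rewrite inE => _; split.
        by case: ifPn => // l1; exact: h1.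
      by case: ifPn => // l2; exact: h2.
    move=> h; split=> l /= lJ.
      by have := h l; rewrite /= inE lJ => /(_ isT)[].
    by have := h l; rewrite /= inE lJ orbT => /(_ isT)[].
have PiT : Pi setT.
  exists fset0, (fun=> setT); split => //.
  by apply/seteqP; split.
have genPi : sample_gen I `<=` Pi.
  move=> _ [l Il [C mC <-]]; exists [fset l]%fset, (fun=> C); split => //.
    by move=> m /=; rewrite inE => /eqP ->.
  rewrite setTI; apply/seteqP; split => w /=.
    by move=> h m /=; rewrite inE => /eqP ->.
  by move=> h; apply: (h l); rewrite /= inE.
have DB0 : (0 <= fine (D B))%R by exact: fine_ge0.
pose m1 : {measure set Omega -> \bar R} := mrestr P (mxi k B mB).
pose m2 : {measure set Omega -> \bar R} := mscale (NngNum DB0) P.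
have DBE : (fine (D B))%:E = D B by rewrite fineK // fin_num_measure.
have E : m1 A = m2 A.
  apply: (g_sigma_algebra_measure_unique Pi Pim (fun=> setT)) => //.
  - by apply/seteqP; split=> // w _; exists 0%N.
  - move=> _ [J [C [JI mC ->]]]; rewrite /m1 /m2 /= /mrestr /mscale /= DBE.
    pose C' l := if l == k then B else C l.
    have mC' l : measurable (C' l) by rewrite /C'; case: ifP.
    have kJ : k \notin J by apply/negP => /JI.
    have -> : \bigcap_(l in [set` J]) (xi l.1 l.2 @^-1` C l) `&` (xi k.1 k.2 @^-1` B)
       = \bigcap_(l in [set` (k |` J)%fset]) (xi l.1 l.2 @^-1` C' l).
      apply/seteqP; split => w /=.
        move=> [h1 h2] l /=; rewrite /C' !inE; case: eqP => [-> _|_ /= lJ] //.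
        exact: h1.
      move=> h; split.
        move=> l /= lJ; have := h l; rewrite /C' /= !inE lJ orbT => /(_ isT).
        by case: eqP => // lk; move: kJ; rewrite -lk lJ.
      by have := h k; rewrite /C' /= !inE eqxx => /(_ isT).
    rewrite indep // big_fsetU1 //= {1}/C' eqxx.
    rewrite [X in (X * _)%E](_ : _ = D B); last exact: dist.
    rewrite indep //; congr (_ * _)%E; rewrite big_seq [RHS]big_seq.
    apply: eq_bigr => l lJ; rewrite /C'; case: eqP => // lk.
    by move: kJ; rewrite -lk lJ.
  - by move=> _; rewrite /m1 /= /mrestr setTI; apply: le_lt_trans (probability_le1 _ (mxi k B mB)) (ltry _).
  - exact: (sub_sigma_algebra2 (D := setT) genPi) IA.
by move: E; rewrite /m1 /m2 /= /mrestr /mscale /= DBE muleC.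
Qed.

(** Freezing of the past: by [sample_independent] the joint law of the past and the fresh sample is
    a product measure, and Tonelli integrates the sample first. *)
Lemma conditional_integral I (k : nat * nat) (f : sample_space I * Xi -> \bar R) : ~ I k ->
  measurable_fun setT f -> (forall r, (0 <= f r)%E) ->
  (\int[P]_w f (w : sample_space I, xi k.1 k.2 w) =
   \int[P]_w \int[D]_z f (w : sample_space I, z))%E.
Proof.
move=> Ik mf f0.
pose W := sample_space I.
pose iW : {mfun Omega >-> W} := mfun_pack (@sample_space_id I).
have mpair : measurable_fun setT (fun w : Omega => (w : W, xi k.1 k.2 w)).
  by apply: measurable_fun_pair; [exact: sample_space_id | exact: measurable_funP].
pose pW : {mfun Omega >-> (W * Xi)%type} := mfun_pack mpair.
have joint X : measurable X -> (distribution P iW \x D)%E X = distribution P pW X.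
  apply: product_measure_unique => A B mA mB.
  rewrite /distribution /pushforward /= -(sample_independent Ik mA mB).
  by congr (P _); apply/seteqP; split.
transitivity (\int[distribution P pW]_r f r)%E.
  by rewrite ge0_integral_distribution.
transitivity (\int[distribution P iW \x D]_r f r)%E.
  apply: eq_measure_integral => A mA _. exact: esym (joint _ mA).
rewrite fubini_tonelli1 //.
rewrite ge0_integral_distribution //.
  exact: measurable_fun_fubini_tonelli_F.
by move=> w; apply: integral_ge0.
Qed.

End SampleSigmaAlgebra.

(** * Exponential moments of sums of fresh samples *)

Section Concentration.
Context {R : realType}.

(** exp(-y) >= 1 - y gives exp y <= 1/(1-y), and (1 + y + 2y^2)(1 - y) = 1 + y^2 (1 - 2y) >= 1. *)
Lemma expR_quadratic (y : R) : y <= 2^-1 -> expR y <= 1 + y + 2 * y ^+ 2.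
Proof.
move=> y2; have h := expR_ge1Dx (- y); have y1 : 0 < 1 - y by lra.
have e0 := expR_gt0 y.
have : expR y * (1 - y) <= 1.
  by move: h; rewrite expRN -(ler_pM2l e0) divff ?gt_eqF.
rewrite -ler_pdivlMr // => /le_trans; apply.
rewrite ler_pdivrMr //.
have := sqr_ge0 y; have : 0 <= y ^+ 2 * (1 - 2 * y) by rewrite mulr_ge0 ?sqr_ge0 //; lra.
by rewrite !exprS expr0; lra.
Qed.

Lemma mgf_bounded {d} {Xi : measurableType d} (D : probability Xi R) (h : Xi -> R) (B l : R) :
  measurable_fun setT h -> (forall z, `|h z| <= B) ->
  (\int[D]_z (h z)%:E = 0)%E -> `|l| * B <= 2^-1 ->
  (\int[D]_z (expR (l * h z))%:E <= (expR (2 * (l * B) ^+ 2))%:E)%E.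
Proof.
move=> mh hB h0 lB.
have ih : D.-integrable setT (EFin \o h).
  apply: (@le_integrable _ _ _ D setT measurableT _ (EFin \o cst B)).
  - exact/measurable_EFinP.
  - move=> z _; rewrite /= lee_fin (le_trans (hB z)) // ler_norm //.
  - exact: finite_measure_integrable_cst.
have ilh : D.-integrable setT (fun z => (l * h z)%:E).
  by under eq_fun do rewrite EFinM; exact: integrableZl.
pose c := 1 + 2 * (l * B) ^+ 2.
have le1 z : expR (l * h z) <= c + l * h z.
  have lh : `|l * h z| <= `|l| * B by rewrite normrM ler_wpM2l.
  apply: le_trans (expR_quadratic _) _; first exact: le_trans (ler_norm _) (le_trans lh lB).
  have : (l * h z) ^+ 2 <= (l * B) ^+ 2.
    rewrite -[leLHS]real_normK ?num_real // -[leRHS]real_normK ?num_real //.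
    rewrite lerXn2r ?nnegrE //; apply: le_trans lh _.
    by rewrite normrM ler_wpM2l // ler_norm.
  by rewrite /c; lra.
apply: (@le_trans _ _ (\int[D]_z (c + l * h z)%:E)%E).
  apply: ge0_le_integral => //.
  - by apply/measurable_EFinP; apply: measurableT_comp => //; exact: measurable_funM.
  - by apply/measurable_EFinP; apply: measurable_funD => //; exact: measurable_funM.
  - by move=> z _; rewrite lee_fin.
under eq_integral do rewrite EFinD.
rewrite integralD //; last exact: finite_measure_integrable_cst.
under [X in (_ + X)%E]eq_integral do rewrite EFinM.
rewrite integralZl // h0 mule0 adde0 integral_cst //= probability_setT mule1 lee_fin.
exact: expR_ge1Dx.
Qed.

Context {dX dO : measure_display} {Xi : measurableType dX}
  {Omega : measurableType dO} {P : probability Omega R} (D : probability Xi R).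
Variable xi : nat -> nat -> {RV P >-> Xi}.
Hypothesis iid : iid_samples D xi.
Context (q : nat) (H : Omega -> Xi -> R) (B : R).
Local Notation before := [set k : nat * nat | (k.1 < q)%N].
Hypotheses
  (H_meas : measurable_fun setT (fun r : sample_space xi before * Xi => H r.1 r.2))
  (H_bound : forall w z, `|H w z| <= B)
  (H_mean : forall w, (\int[D]_z (H w z)%:E = 0)%E).

(** The information carried by the partial sum over [l]: earlier queries, and the samples of query
    [q] already used. A sample outside [l] is fresh for it. *)
Let upto (l : seq nat) : set (nat * nat) := before `|` [set k | k.1 = q /\ k.2 \in l].

Let upto_meas l : measurable_fun setT (fun r : sample_space xi (upto l) * Xi => H r.1 r.2).
Proof.
apply: (measurableT_comp H_meas (g := fun r : sample_space xi (upto l) * Xi =>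
  (r.1 : sample_space xi before, r.2))).
apply: measurable_fun_pair; last exact: measurable_snd.
have hs : measurable_fun setT (fun w : sample_space xi (upto l) => w : sample_space xi before).
  by apply: sample_space_sub; exact: subsetUl.
exact: (measurableT_comp hs measurable_fst).
Qed.

Let sum_meas l s : {subset s <= l} ->
  measurable_fun setT (fun w : sample_space xi (upto l) => \sum_(j <- s) H w (xi q j w)).
Proof.
elim: s => [|j s IH] sl.
  by under eq_fun do rewrite big_nil; exact: measurable_cst.
under eq_fun do rewrite big_cons.
apply: measurable_funD; last by apply: IH => i is_; apply: sl; rewrite inE is_ orbT.
pose g (w : sample_space xi (upto l)) : sample_space xi (upto l) * Xi := (w, xi q j w).
have mg : measurable_fun setT g.
  apply: measurable_fun_pair; first exact: measurable_id.
  apply: (@sample_space_xi _ _ _ _ _ _ xi _ (q, j)).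
  by right; split => //=; apply: sl; rewrite mem_head.
exact: (measurableT_comp (@upto_meas l) mg).
Qed.

Lemma sample_sum_measurable (s : seq nat) :
  measurable_fun setT (fun w : Omega => \sum_(j <- s) H w (xi q j w)).
Proof.
exact: (measurableT_comp (@sum_meas _ _ (fun _ h => h)) (@sample_space_id _ _ _ _ _ _ xi (upto s))).
Qed.

(** The head sample is independent of [upto s], which fixes both the rest of the sum and the query
    point; integrating it first gives the factor of [mgf_bounded]. *)
Lemma mgf_sample_sum (s : seq nat) (l : R) : uniq s -> `|l| * B <= 2^-1 ->
  (\int[P]_w (expR (l * \sum_(j <- s) H w (xi q j w)))%:E
    <= (expR (2 * (l * B) ^+ 2) ^+ size s)%:E)%E.
Proof.
move=> us lB; elim: s us => [_|j s IH /= /andP[js us]].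
  under eq_integral do rewrite big_nil mulr0 expR0.
  by rewrite integral_cst //= probability_setT mule1 expr0.
set c := expR (2 * (l * B) ^+ 2) in IH *.
pose U (w : sample_space xi (upto s)) := expR (l * \sum_(i <- s) H w (xi q i w)).
have mU : measurable_fun setT U.
  apply: measurableT_comp => //; apply: measurable_funM => //.
  exact: (@sum_meas _ _ (fun _ h => h)).
pose f (r : sample_space xi (upto s) * Xi) := (U r.1 * expR (l * H r.1 r.2))%:E.
have kU : ~ upto s (q, j).
  by move=> [/=|[_ /=]]; [rewrite ltnn | apply/negP].
have mf : measurable_fun setT f.
  apply/measurable_EFinP; apply: measurable_funM.
    exact: (measurableT_comp mU measurable_fst).
  apply: measurableT_comp => //; apply: measurable_funM => //; exact: (@upto_meas s).
have f0 r : (0 <= f r)%E by rewrite lee_fin mulr_ge0 ?expR_ge0.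
have := conditional_integral iid kU mf f0.
rewrite (eq_integral (fun w => (expR (l * \sum_(i <- j :: s) H w (xi q i w)))%:E)); last first.
  by move=> w _; rewrite /f /U /= -expRD -mulrDr big_cons addrC.
move=> ->.
have c0 : 0 <= c by exact: expR_ge0.
have mUO : measurable_fun setT (fun w : Omega => (U w)%:E).
  by apply/measurable_EFinP; exact: (measurableT_comp mU (@sample_space_id _ _ _ _ _ _ xi _)).
apply: (@le_trans _ _ (\int[P]_w (c%:E * (U w)%:E))%E).
  apply: ge0_le_integral => //.
  - by move=> w _; apply: integral_ge0.
  - exact: (measurableT_comp (measurable_fun_fubini_tonelli_F _ mf f0)
      (@sample_space_id _ _ _ _ _ _ xi _)).
  - exact: measurable_funeM.
  move=> w _; rewrite /f /=; under eq_integral do rewrite EFinM.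
  have mH : measurable_fun setT (H w).
    exact: (measurableT_comp H_meas (g := fun z => (w : sample_space xi before, z))
       (measurable_fun_pair (measurable_cst _) (@measurable_id _ _ _))).
  rewrite ge0_integralZl_EFin //; last 2 first.
  - by apply/measurable_EFinP; apply: measurableT_comp => //; exact: measurable_funM.
  - exact: expR_ge0.
  rewrite muleC; apply: lee_wpmul2r; first by rewrite lee_fin expR_ge0.
  exact: mgf_bounded.
rewrite ge0_integralZl_EFin //; last by move=> w _; rewrite lee_fin expR_ge0.
rewrite exprS EFinM; apply: lee_wpmul2l; first by rewrite lee_fin.
exact: IH.
Qed.

Lemma sample_sum_tail (s : seq nat) (tau : R) : uniq s -> 0 < tau -> 0 < B -> tau <= 2 * B ->
  (P [set w | ((size s)%:R * tau <= \sum_(j <- s) H w (xi q j w))%R]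
   <= (expR (- ((size s)%:R * (tau ^+ 2 / (8 * B ^+ 2))))%R)%:E)%E.
Proof.
move=> us tau0 B0 tauB.
pose X : {RV P >-> R} := mfun_pack (sample_sum_measurable s).
(* The minimizer of 2 l^2 B^2 - l tau, the exponent per sample, with minimum -tau^2/(8 B^2). The
   hypothesis tau <= 2 B is |l| B <= 1/2. *)
pose l : R := tau / (4 * B ^+ 2).
have B2 : 0 < B ^+ 2 by exact: exprn_gt0.
have l0 : 0 < l by rewrite divr_gt0 // mulr_gt0.
apply: le_trans (chernoff X ((size s)%:R * tau) l0) _.
have lBE : l * B = tau / (4 * B) by rewrite /l; field; rewrite gt_eqF.
have lB : `|l| * B <= 2^-1.
  by rewrite gtr0_norm // lBE ler_pdivrMr ?mulr_gt0 //; lra.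
have hm : ('M_P X l <= (expR (2 * (l * B) ^+ 2) ^+ size s)%:E)%E.
  rewrite /mmt_gen_fun unlock; apply: le_trans (mgf_sample_sum us lB).
  rewrite le_eqVlt; apply/orP; left; apply/eqP; apply: eq_integral => w _.
  by rewrite /= [_ * l]mulrC.
apply: le_trans (lee_wpmul2r _ hm) _; first by rewrite lee_fin expR_ge0.
rewrite -EFinM lee_fin -expRM_natl -expRD ler_expR lBE /l.
rewrite le_eqVlt; apply/orP; left; apply/eqP.
by rewrite expr_div_n exprMn -mulr_natl; field; rewrite gt_eqF.
Qed.

End Concentration.

(** * Union bound and measurability of the query points *)

Lemma union_bound {R : realType} {d} {Omega : measurableType d} (P : probability Omega R)
    (K : finType) (bad : K -> set Omega) (A : set Omega) (b : R) :
  (forall k, measurable (bad k)) -> measurable A -> (forall k, (P (bad k) <= b%:E)%E) ->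
  (forall w, (forall k, ~ bad k w) -> A w) -> ((1 - #|K|%:R * b)%:E <= P A)%E.
Proof.
move=> mbad mA badb goodA.
pose U (s : seq K) := [set w | exists2 k, k \in s & bad k w].
have [mU PU] : measurable (U (enum K)) /\ (P (U (enum K)) <= ((size (enum K))%:R * b)%:E)%E.
  elim: (enum K) => [|k s [mU PU]].
    rewrite (_ : U [::] = set0) ?measure0 ?mul0r //.
    by apply/seteqP; split => // w [].
  have -> : U (k :: s) = bad k `|` U s.
    apply/seteqP; split => w.
      move=> [l]; rewrite inE => /orP[/eqP ->|ls] bw; first by left.
      by right; exists l.
    by move=> [bw|[l ls bw]]; [exists k | exists l] => //; rewrite inE ?eqxx ?ls ?orbT.
  split; first exact: measurableU.
  apply: (le_trans (measureU2 P (mbad k) mU)).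
  by rewrite /= -natr1 mulrDl mul1r addrC EFinD; exact: leeD.
apply: (@le_trans _ _ (P (~` U (enum K)))).
  rewrite probability_setC //.
  by rewrite EFinB leeB // cardE.
apply: le_measure; rewrite ?inE //; first exact: measurableC.
by move=> w hw; apply: goodA => k bk; apply: hw; exists k => //; exact: mem_enum.
Qed.

Section Adaptedness.
Context {R : realType} {n : nat} {dX dO : measure_display} {Xi : measurableType dX}
  {Omega : measurableType dO} {P : probability Omega R}.
Local Notation V := 'rV[R]_n.
Variable xi : nat -> nat -> {RV P >-> Xi}.
Local Notation before q := [set l : nat * nat | (l.1 < q)%N].

Lemma determined_coord (k q : nat) (X : Omega -> V) : (k <= q)%N ->
  determined_by (past xi k) X ->
  coord_measurable (fun w : sample_space xi (before q) => X w).
Proof.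
move=> kq dX_ j; apply: (measurability _ (RGenOpens.measurableE R)).
move=> _ [_ [a [b ->]] <-]; rewrite setTI.
have kq' : <<s sample_gen xi (before k) >> `<=` <<s sample_gen xi (before q) >>.
  apply: sub_sigma_algebra2 => B [l lk Bl]; exists l => //; exact: leq_trans lk kq.
apply: kq'; apply: past_sub.
apply: (dX_ ((fun v : V => v ord0 j) @^-1` `]a, b[%classic)).
apply: open_comp; last exact: interval_open.
by move=> v _; exact: coord_continuous.
Qed.

(** The point of query q is fixed by queries before q, so its own samples are fresh. The indices in
    [adapted] fit exactly: x_(t+1) at q = 2t+1, y_t at q = 2t. *)
Lemma query_point_measurable (p q : nat) (x0 : V) (x y : nat -> Omega -> V) :
  adapted xi x y -> coord_measurable (fun w : sample_space xi (before q) =>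
    query_point p x0 (x^~ w) (y^~ w) q).
Proof.
move=> xy; rewrite /query_point; case: eqVneq => [_ j|q0]; first exact: measurable_cst.
case: (boolP (odd q)) => [qo|qe].
  have [h _] := xy q./2.+1 isT; apply: determined_coord h.
  by rewrite -[leqRHS]odd_double_half qo doubleS /= add1n.
have q2 : (0 < q./2)%N.
  by move: q0; rewrite -[q in q != _]odd_double_half (negbTE qe) add0n; case: q./2.
have [hx hy] := xy _ q2 => j.
have qE : (q./2).*2 = q by rewrite -[RHS]odd_double_half (negbTE qe).
apply: (eq_measurable_fun (fun w : sample_space xi (before q) =>
  (1 - alpha p q./2) * x q./2 w ord0 j + alpha p q./2 * y q./2 w ord0 j)).
  by move=> w _; rewrite /vpt !mxE.
apply: measurable_funD; apply: measurable_funM; try exact: measurable_cst.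
  by apply: (determined_coord _ hx); rewrite qE leq_pred.
by apply: (determined_coord _ hy); rewrite qE.
Qed.

Lemma sublevel_measurable (k : nat) (X : Omega -> V) (f : V -> R) (c : R) :
  continuous f -> determined_by (past xi k) X -> measurable [set w | f (X w) <= c].
Proof.
move=> cf dX_.
rewrite (_ : [set w | _] = ~` (X @^-1` (f @^-1` [set r | c < r]))); last first.
  by apply/seteqP; split => w /=; rewrite leNgt => /negP.
have h : past xi k (X @^-1` (f @^-1` [set r | c < r])).
  by apply: dX_; apply: open_comp; [move=> v _; exact: cf | exact: open_gt].
exact: (measurableC (sample_sigma_measurable (past_sub h))).
Qed.

End Adaptedness.

(** * The good event and its probability *)

Section HighProbability.
Context {R : realType} {n : nat} {dX dO : measure_display} {Xi : measurableType dX}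
  {Omega : measurableType dO} {P : probability Omega R} {D : probability Xi R}.
Local Notation V := 'rV[R]_n.
Context (p : nat) (Lp sigma : R) (eta delta : nat -> R) (F : V -> Xi -> R) (f : V -> R)
  (M : nat -> R) (x0 xs : V) (Rb : R) (T : nat)
  (xi : nat -> nat -> {RV P >-> Xi}) (S : nat -> {fset nat}) (x y : nat -> Omega -> V).
Hypotheses (n_gt0 : (0 < n)%N) (p_ge2 : (2 <= p)%N) (Lp_ge0 : 0 <= Lp)
  (sigma_ge : 3 * Lp <= p%:R * sigma)
  (eta_ge3 : forall i, (2 <= i <= p)%N -> 3 <= eta i)
  (delta_gt0 : forall i, (1 <= i <= p)%N -> 0 < delta i) (Rb_gt0 : 0 < Rb)
  (T_gt0 : (0 < T)%N).
Hypotheses (F_int : forall x, D.-integrable setT (EFin \o F x))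
  (fE : forall x, (f x)%:E = ('E_D[F x])%E)
  (f_convex : convex_function setT f) (f_diff : times_differentiable p f)
  (F_diff : forall z, times_differentiable p (F^~ z))
  (f_lip : forall (s : seq V) a b, size s = p ->
    `|dseq s f a - dseq s f b| <= Lp * enorm (a - b) * \prod_(v <- s) enorm v)
  (F_noise : forall i x z, (1 <= i <= p)%N ->
       tnorm (nabla (i := i) (F^~ z) x \- nabla f x) <= M i).
Hypotheses (iid : iid_samples D xi) (xy_adapted : adapted xi x y)
  (S_gt0 : forall i, (1 <= i <= p)%N -> (0 < #|` S i|)%N)
  (run : forall w : Omega, astm_run p Lp sigma eta delta f x0
     (fun q => sample_mean F S (fun j => xi q j w)) (x^~ w) (y^~ w))
  (bounded : forall w : Omega, iterates_bounded x0 (x^~ w) (y^~ w) xs Rb).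

Let E (v : V) (z : Xi) : R := F v z - f v.
Let pt (w : Omega) (q : nat) : V := query_point p x0 (x^~ w) (y^~ w) q.

Let p_gt0 : (0 < p)%N. Proof. exact: ltnW. Qed.

Let F_meas v : measurable_fun setT (F v).
Proof. by have /measurable_int/measurable_EFinP := F_int v. Qed.

Let E_meas v : measurable_fun setT (E v).
Proof. exact: measurable_funB. Qed.

Let E_diff z : times_differentiable p (E^~ z).
Proof. exact: tdiffB. Qed.

Let E_int v : D.-integrable setT (EFin \o E v).
Proof.
rewrite (_ : EFin \o E v = (fun z => (F v z)%:E - (f v)%:E)%E).
  by apply: integrableB => //; [exact: F_int | exact: finite_measure_integrable_cst].
by apply/funext => z /=; rewrite EFinB.
Qed.

Let E_mean v : (\int[D]_z (E v z)%:E = 0)%E.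
Proof.
under eq_integral do rewrite EFinB.
rewrite integralB //; [|exact: F_int | exact: finite_measure_integrable_cst].
rewrite integral_cst //= probability_setT mule1 fE unlock subee //.
by have := fE v; rewrite unlock => <-.
Qed.

Let dseqE s z v : (size s <= p)%N -> dseq s (E^~ z) v = dseq s (F^~ z) v - dseq s f v.
Proof. by move=> sp; apply: dseqB; exact: tdiffW sp _. Qed.

Let E_bound (s : seq V) v z : (1 <= size s <= p)%N ->
  `|dseq s (E^~ z) v| <= M (size s) * \prod_(u <- s) enorm u.
Proof.
move=> sp; have /andP[_ sp'] := sp; rewrite dseqE //.
apply: (tnorm_bound _ _ (F_noise v z sp)) => //; exact: tdiffW sp' _.
Qed.

Let basis_bound (kap : seq 'I_n) v z : (1 <= size kap <= p)%N ->
  `|dseq (map bvec kap) (E^~ z) v| <= M (size kap).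
Proof.
move=> kp; have := @E_bound (map bvec kap) v z; rewrite size_map => /(_ kp).
rewrite big_map big1 ?mulr1 // => j _; exact: enorm_delta.
Qed.

(** Both signs are kept because the tail bound is one-sided. *)
Let signed (b : bool) (kap : seq 'I_n) (q : nat) (w : Omega) (z : Xi) : R :=
  (-1) ^+ b * dseq (map bvec kap) (E^~ z) (pt w q).

Let signed_meas b (kap : seq 'I_n) (q : nat) : (size kap <= p)%N ->
  measurable_fun setT (fun r : sample_space xi [set l : nat * nat | (l.1 < q)%N] * Xi =>
    signed b kap q r.1 r.2).
Proof.
move=> kp; apply: measurable_funM; first exact: measurable_cst.
have kp' : (size (map (@bvec R n) kap) <= p)%N by rewrite size_map.
have mX := query_point_measurable (q := q) p x0 xy_adapted.
exact: (measurable_dseq p_gt0 E_meas E_diff kp' mX).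
Qed.

Let signed_bound b (kap : seq 'I_n) q w z : (1 <= size kap <= p)%N ->
  `|signed b kap q w z| <= M (size kap).
Proof. by move=> kp; rewrite /signed normrM normrX normrN1 expr1n mul1r basis_bound. Qed.

Let signed_mean b (kap : seq 'I_n) q w : (size kap <= p)%N ->
  (\int[D]_z (signed b kap q w z)%:E = 0)%E.
Proof.
move=> kp; under eq_integral do rewrite EFinM.
have kp' : (size (map (@bvec R n) kap) <= p)%N by rewrite size_map.
have [i1 i2] := dseq_mean_zero p_gt0 E_meas E_diff E_int E_mean E_bound (pt w q) kp'.
by rewrite integralZl // i2 mule0.
Qed.

(** The division by n^i anticipates the factor n that [dseq_basis_bound] loses in each slot. *)
Let bad (b : bool) (kap : seq 'I_n) (q : nat) : set Omega :=
  [set w | #|` S (size kap)|%:R * (delta (size kap) / n%:R ^+ size kap)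
           <= \sum_(j <- S (size kap)) signed b kap q w (xi q j w)].

Let bad_measurable b kap q : (size kap <= p)%N -> measurable (bad b kap q).
Proof.
move=> kp.
have h := sample_sum_measurable (@signed_meas b kap q kp) (S (size kap)).
rewrite (_ : bad b kap q = setT `&` (fun w => \sum_(j <- S (size kap)) signed b kap q w (xi q j w)) @^-1`
   `[#|` S (size kap)|%:R * (delta (size kap) / n%:R ^+ size kap), +oo[%classic).
  by apply: h => //; exact: measurable_itv.
by rewrite setTI; apply/seteqP; split => w /=; rewrite in_itv /= andbT.
Qed.

Context (lam : R).
Hypothesis sample_size : forall i, (1 <= i <= p)%N ->
  lam * (8 * M i ^+ 2) <= #|` S i|%:R * (delta i / n%:R ^+ i) ^+ 2.

(** If the threshold exceeds 2 M_i the tail bound does not apply, but then the event is empty since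
    every summand is at most M_i. *)
Let bad_probability b kap q : (1 <= size kap <= p)%N -> (P (bad b kap q) <= (expR (- lam))%:E)%E.
Proof.
move=> kp; have /andP[_ kp'] := kp; rewrite /bad; set k := size kap in kp kp' *.
set t := delta k / n%:R ^+ k.
have t0 : 0 < t by rewrite divr_gt0 ?delta_gt0 // exprn_gt0 // ltr0n.
have [tM|Mt] := leP t (2 * M k).
  have M0 : 0 < M k by lra.
  apply: le_trans (sample_sum_tail iid (@signed_meas b kap q kp') _ _ (fset_uniq _) t0 M0 tM) _.
  - by move=> w z; exact: signed_bound.
  - by move=> w; exact: signed_mean.
  rewrite lee_fin ler_expR lerN2 mulrA ler_pdivlMr; last by rewrite mulr_gt0 ?exprn_gt0.
  exact: sample_size.
rewrite (_ : [set w | _] = set0) ?measure0 ?lee_fin ?expR_ge0 //.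
apply/seteqP; split => // w /=; apply/negP; rewrite -ltNge.
apply: le_lt_trans (_ : #|` S k|%:R * M k < _); last first.
  rewrite ltr_pM2l ?ltr0n ?S_gt0 //.
  apply: le_lt_trans Mt; apply: ler_peMl; last by rewrite ler1n.
  exact: le_trans (normr_ge0 _) (@signed_bound b kap q w (xi q 0 w) kp).
apply: (@le_trans _ _ (\sum_(j <- S k) M k)); last first.
  by rewrite big_const_seq count_predT iter_addr_0 mulr_natl.
apply: ler_sum => j _; apply: le_trans (ler_norm _) _.
exact: (@signed_bound b kap q w _ kp).
Qed.

(** Averaging commutes with differentiation, so the i-th derivatives of this function are the
    estimator of order i; it is the [fb] of the deterministic part. *)
Let fbar (w : Omega) (q i : nat) (v : V) : R := #|` S i|%:R^-1 * \sum_(j <- S i) F v (xi q j w).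

Let fbar_diff w q i : times_differentiable p (fbar w q i).
Proof. by apply: tdiff_sum => j; exact: F_diff. Qed.

Let good_noise w : (forall b (kap : seq 'I_n) q, (1 <= size kap <= p)%N -> (q < T.*2)%N -> ~ bad b kap q w) ->
  forall q i (s : seq V), (q < T.*2)%N -> (1 <= i <= p)%N -> size s = i ->
  `|dseq s (fbar w q i) (pt w q) - dseq s f (pt w q)| <= delta i * \prod_(u <- s) enorm u.
Proof.
move=> good q i s qT ip si; have /andP[_ ip'] := ip.
have tdf : times_differentiable i f by exact: tdiffW ip' _.
have tdb : times_differentiable i (fbar w q i) by exact: tdiffW ip' _.
have N0 : 0 < #|` S i|%:R :> R by rewrite ltr0n S_gt0.
have n0 : n%:R != 0 :> R by rewrite pnatr_eq0 -lt0n.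
rewrite -dseqB ?si //.
have key (kap : seq 'I_n) : size kap = i ->
    `|dseq (map bvec kap) (fbar w q i \- f) (pt w q)| <= delta i / n%:R ^+ i.
  move=> ki; have ki' : size (map (@bvec R n) kap) = i by rewrite size_map.
  pose X := \sum_(j <- S i) dseq (map bvec kap) (E^~ (xi q j w)) (pt w q).
  have -> : dseq (map bvec kap) (fbar w q i \- f) (pt w q) = #|` S i|%:R^-1 * X.
    rewrite dseqB ?ki' // dseq_sum; last by move=> j; rewrite ki'; exact: tdiffW ip' _.
    rewrite /X; under [in RHS]eq_bigr do rewrite dseqE ?ki' //.
    rewrite sumrB mulrBr; congr (_ - _).
    by rewrite big_const_seq count_predT iter_addr_0 -[X in _ * X]mulr_natl mulKf ?gt_eqF.
  have B1 (b : bool) : (-1) ^+ b * X < #|` S i|%:R * (delta i / n%:R ^+ i).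
    have := good b kap q; rewrite ki => /(_ ip qT) /negP; rewrite -ltNge ki.
    by rewrite /signed -mulr_sumr.
  have := B1 false; have := B1 true; rewrite expr1 expr0 mulN1r mul1r => h1 h2.
  rewrite normrM ger0_norm ?invr_ge0 ?(ltW N0) // ler_pdivrMl //.
  by rewrite ler_norml; apply/andP; split; [rewrite lerNl|]; exact: ltW.
have td : times_differentiable i (fbar w q i \- f) by exact: tdiffB.
apply: le_trans (dseq_basis_bound td key si) _.
rewrite big_split /= big_const_seq count_predT iter_mulr_1 si.
by rewrite mulrA divfK // expf_neq0.
Qed.

(** The hypothesis is the bound of [convergence] with [delta 1] in the role of [tau], so on the good
    event nothing random is left. *)
Theorem success_probability (eps : R) :
  @Aprod R p T.-1 *
    (2 * (\sum_(2 <= i < p.+1) delta i / i`!%:R * enorm (xs - x0) ^+ i)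
    + (Lp + p%:R * sigma) * enorm (xs - x0) ^+ p.+1 / (p.+1)`!%:R
    + delta 1 * (enorm (xs - x0) + Rb)
    + \sum_(2 <= i < p.+2) kappa p Lp sigma eta delta T.-1 i / i`!%:R * enorm (xs - x0) ^+ i
    + (9 * p.+1)%:R * (slack0 p sigma eta delta Rb / @Aprod R p (9 * p.+1)))
  + 5 * Rb * delta 1 + T%:R * (3 / 4 * (delta 1 ^+ 2 / delta 2)) <= eps ->
  ((1 - (4 * T * p * n ^ p)%:R * expR (- lam))%:E <= P [set w | (f (x T w) - f xs <= eps)%R])%E.
Proof.
move=> le_eps.
(* 2T queries, p orders, n^p tuples and 2 signs. All tuples have length p and order i reads the
   first i entries, so shorter tuples occur with repetition. *)
pose K : finType := ('I_(T.*2) * 'I_p * p.-tuple 'I_n * bool)%type.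
pose badK (k : K) := bad k.2 (take k.1.1.2.+1 k.1.2) k.1.1.1.
have sizeK (k : K) : size (take k.1.1.2.+1 k.1.2) = k.1.1.2.+1 by rewrite size_takel // size_tuple.
have KE : #|K| = (4 * T * p * n ^ p)%N.
  rewrite !card_prod !card_ord card_tuple card_ord card_bool -mul2n.
  by lia.
rewrite -KE; apply: (@union_bound _ _ _ P K badK).
- by move=> k; apply: bad_measurable; rewrite sizeK.
- have [h _] := xy_adapted T_gt0.
  rewrite (_ : [set w | _] = [set w | f (x T w) <= eps + f xs]); last first.
    by apply/seteqP; split => w /=; rewrite lerBlDr.
  apply: (sublevel_measurable (eps + f xs) _ h) => v.
  by apply: differentiable_continuous; exact: tdiff_differentiable p_gt0 f_diff v.
- by move=> k; apply: bad_probability; rewrite sizeK /=; case: k => [[[? []]]].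
move=> w good.
have {}good b (kap : seq 'I_n) q : (1 <= size kap <= p)%N -> (q < T.*2)%N -> ~ bad b kap q w.
  move=> /andP[k1 kp] qT.
  have st : size (kap ++ nseq (p - size kap) (Ordinal n_gt0)) == p.
    by rewrite size_cat size_nseq subnKC.
  have kp' : ((size kap).-1 < p)%N by rewrite prednK.
  have := good (Ordinal qT, Ordinal kp', Tuple st, b).
  by rewrite /badK /= prednK // take_size_cat.
apply: le_trans le_eps.
apply: (@convergence R n p Lp sigma eta delta f x0 xs Rb (delta 1) T _ _ _ (fbar w)
  p_ge2 Lp_ge0 sigma_ge eta_ge3 _ Rb_gt0 _ f_convex f_diff f_lip (fun q i _ => fbar_diff w q i)
  _ _ (run w) (bounded w) T_gt0).
- by move=> i /andP[i2 ip]; rewrite delta_gt0 // ltnW.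
- by apply/ltW/delta_gt0; rewrite p_gt0.
- move=> q v i s /andP[_ ip]; rewrite dseq_sum // => j; rewrite size_tuple.
  exact: tdiffW ip _.
- move=> q i s qT ip si; have := good_noise good qT ip si.
  by case: eqP => [->|].
Qed.

End HighProbability.

(** Rounding up costs at most a factor 2; the maximum with 1 covers small [u] and gives the final
    bounds on sample sizes and on [T] their form. *)
Lemma nat_between {R : realType} (u : R) :
  exists m : nat, [/\ (1 <= m)%N, u <= m%:R & m%:R <= Num.max 1 (2 * u)].
Proof.
have [u1|u1] := leP u 1; first by exists 1%N; split=> //; rewrite le_max lexx.
have u0 : 0 <= u by exact: le_trans (ltW u1).
exists (Num.trunc u).+1; have /andP[l1 l2] := truncn_itv u0.
split=> //; first exact: ltW.
by rewrite le_max -natr1; apply/orP; right; lra.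
Qed.

(** * Choice of horizon, tolerances and sample sizes *)

Section StepSizes.
Context {R : realType} (p n : nat) (Lp sigma : R) (eta : nat -> R) (R0 Rb : R).
Hypotheses (n_gt0 : (0 < n)%N) (p_ge2 : (2 <= p)%N) (Lp_ge0 : 0 <= Lp)
  (sigma_ge : 3 * Lp <= p%:R * sigma) (eta_ge3 : forall i, (2 <= i <= p)%N -> 3 <= eta i)
  (R0_ge0 : 0 <= R0) (Rb_gt0 : 0 < Rb).

(** Replaces real exponents by natural powers of [iteration_rate]. *)
Lemma rate_powers (eps : R) : 0 < eps ->
  [/\ 0 < iteration_rate p eps, iteration_rate p eps ^+ p.+1 = eps^-1,
      sample_rate p eps 1 = eps^-1 ^+ 2
    & forall i, (2 <= i)%N -> sample_rate p eps i = iteration_rate p eps ^+ (2 * (p.+1 - i))].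
Proof.
move=> e0.
have e1 : 0 < iteration_rate p eps by exact: powR_gt0.
have pn : p.+1%:R != 0 :> R by rewrite pnatr_eq0.
split => //.
- rewrite -powR_mulrn ?powR_ge0 // -powRrM mulNr mulVf // powR_inv1 //; exact: ltW.
- rewrite /sample_rate eqxx powRN powR_mulrn ?exprVn //; exact: ltW.
- move=> i i2; rewrite /sample_rate; case: eqP => [E|_]; first by rewrite E in i2.
  rewrite -[RHS]powR_mulrn ?powR_ge0 // /iteration_rate -powRrM; congr (_ `^ _).
  by rewrite natrM; move: ((p.+1 - i)%N%:R : R) => c; field.
Qed.

Local Notation r1 := (rate1 p eta R0 Rb).
Local Notation r2 := (rate2 p Lp sigma R0 Rb).
Local Notation r3 := (rate3 R0 Rb).

(** The lower bound by [iteration_rate] keeps the tolerances d T^i large enough for [rate_count];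
    the last, crude bound on T only enters a logarithm. *)
Lemma iteration_count (K eps : R) : 1 <= K -> 0 < eps ->
  exists T : nat, [/\ (1 <= T)%N, K / eps <= T%:R ^+ p.+1, iteration_rate p eps <= T%:R,
    T%:R <= Num.max 1 (2 * K * iteration_rate p eps)
    & T%:R <= (1 + 2 * K) * (1 + eps^-1)].
Proof.
move=> K1 e0; have [e1 e2 _ _] := rate_powers e0.
set e := iteration_rate p eps in e1 e2 *.
pose k : R := K `^ (p.+1%:R)^-1.
have kp : k ^+ p.+1 = K.
  rewrite -powR_mulrn ?powR_ge0 // -powRrM mulVf ?pnatr_eq0 // powRr1 //.
  exact: le_trans K1.
have k1 : 1 <= k.
  by rewrite -(@expr_ge1 _ p.+1 k) ?powR_ge0 // kp.
have kK : k <= K by rewrite -kp; apply: ler_eXnr.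
have eE : e <= 1 + eps^-1.
  have i0 : 0 < eps^-1 by rewrite invr_gt0.
  have [el|eg] := leP e 1; first by lra.
  have : e <= e ^+ p.+1 by apply: ler_eXnr => //; exact: ltW.
  by rewrite e2; lra.
have [T [T1 T2 T3]] := nat_between (k * e).
have kKe : k * e <= K * e by rewrite ler_pM2r.
have ke : e <= k * e by rewrite -[leLHS]mul1r ler_pM2r.
exists T; split => //.
- rewrite -kp -e2 -exprMn; apply: lerXn2r => //; rewrite nnegrE //.
  by apply: mulr_ge0; lra.
- exact: le_trans T2.
- apply: le_trans T3 _; rewrite ge_max le_max lexx /= le_max; apply/orP; right.
  by rewrite -!mulrA ler_pM2l.
apply: le_trans T3 _; rewrite ge_max; apply/andP; split.
  have i0 : 0 < eps^-1 by rewrite invr_gt0.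
  by apply: mulr_ege1; lra.
have h : K * e <= K * (1 + eps^-1) by apply: ler_wpM2l => //; lra.
have i0 : 0 < eps^-1 by rewrite invr_gt0.
by lra.
Qed.

(** [T * m] is the number of bad events. As T is polynomial in 1/eps, the union bound over them
    costs only the logarithmic factor. *)
Lemma log_count (K eps dlt Q : R) (T m : nat) : 0 < eps -> 0 < dlt -> 1 <= K -> (0 < T)%N -> (0 < m)%N ->
  T%:R <= (1 + 2 * K) * (1 + eps^-1) -> Q = m%:R * (1 + 2 * K) ->
  ln ((T * m)%:R / dlt) <= (1 + ln Q) * logfactor eps dlt.
Proof.
move=> e0 d0 K1 T0 m0 TK QE.
have ei : 0 < eps^-1 by rewrite invr_gt0.
have di : 0 < dlt^-1 by rewrite invr_gt0.
have m1 : 1 <= m%:R :> R by rewrite ler1n.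
have T1 : 0 < T%:R :> R by rewrite ltr0n.
have Q1 : 1 <= Q by rewrite QE; apply: mulr_ege1 => //; lra.
have le : (T * m)%:R / dlt <= Q * (1 + eps^-1) * (1 + dlt^-1).
  rewrite natrM; apply: ler_pM; first by apply: mulr_ge0 => //; lra.
  - exact: ltW.
  - rewrite QE -mulrA mulrC; apply: ler_wpM2l => //; lra.
  - by lra.
have pos : 0 < (T * m)%:R / dlt :> R.
  by apply: mulr_gt0 => //; rewrite ltr0n muln_gt0 T0.
have ae : 0 < 1 + eps^-1 by lra.
have ad : 0 < 1 + dlt^-1 by lra.
have Q0 : 0 < Q by lra.
apply: (@le_trans _ _ (ln (Q * (1 + eps^-1) * (1 + dlt^-1)))).
  by rewrite ler_ln ?posrE // !mulr_gt0.
rewrite !lnM ?posrE ?mulr_gt0 // /logfactor.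
have l0 : 0 <= ln Q by exact: ln_ge0.
have l1 : 0 <= ln (1 + eps^-1) by apply: ln_ge0; lra.
have l2 : 0 <= ln (1 + dlt^-1) by apply: ln_ge0; lra.
move: (ln Q) (ln (1 + eps^-1)) (ln (1 + dlt^-1)) l0 l1 l2 => u v w u0 v0 w0.
by have := mulr_ge0 u0 (addr_ge0 v0 w0); lra.
Qed.

(** Let e be the iteration rate. Since e^(p+1) = 1/eps and T >= e, the reciprocal tolerance 1/(eps
    T^i) is at most e^(p+1-i), whose square is the sample rate. Order 1 has tolerance c eps without
    a power of T, hence its exceptional exponent. *)
Lemma rate_count (a c eps : R) (T i : nat) : 0 < eps -> 0 < c -> c <= a -> (1 <= i <= p)%N ->
  iteration_rate p eps <= T%:R ->
  (n%:R ^+ i / (if i == 1%N then c * eps else a * eps * T%:R ^+ i)) ^+ 2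
    <= (n%:R ^+ p / c) ^+ 2 * sample_rate p eps i.
Proof.
move=> e0 c0 ca /andP[i1 ip] eT.
have [e1 e2 s1 s2] := rate_powers e0; set e := iteration_rate p eps in e1 e2 s2 eT.
have a0 : 0 < a by exact: lt_le_trans ca.
have n1 : 1 <= n%:R :> R by rewrite ler1n.
have n0 : 0 <= n%:R :> R by [].
have nip : n%:R ^+ i <= n%:R ^+ p :> R by apply: ler_weXn2l.
have T0 : 0 < T%:R :> R by exact: lt_le_trans eT.
case: eqP => [->|/eqP i1'].
  rewrite s1 expr1 -[leRHS]exprMn; apply: lerXn2r; rewrite ?nnegrE.
  - by apply: divr_ge0 => //; apply: mulr_ge0; exact: ltW.
  - by apply: mulr_ge0; [apply: divr_ge0; [exact: exprn_ge0 | exact: ltW] | rewrite invr_ge0 ltW].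
  - rewrite invfM mulrA ler_pM2r ?invr_gt0 // ler_pM2r ?invr_gt0 //.
    by apply: ler_eXnr => //; exact: ltnW.
have i2 : (2 <= i)%N by rewrite ltn_neqAle eq_sym i1'.
rewrite s2 // mulnC [e ^+ _]exprM -[leRHS]exprMn; apply: lerXn2r; rewrite ?nnegrE.
- by apply: divr_ge0; [exact: exprn_ge0 | apply: mulr_ge0; [apply: mulr_ge0; exact: ltW | exact/exprn_ge0/ltW]].
- by apply: mulr_ge0; [apply: divr_ge0; [exact: exprn_ge0 | exact: ltW] | exact/exprn_ge0/ltW].
have eTi : e ^+ i <= T%:R ^+ i by apply: lerXn2r; rewrite ?nnegrE // ltW.
have ei0 : 0 < e ^+ i by exact: exprn_gt0.
rewrite ler_pdivrMr; last by rewrite !mulr_gt0 // exprn_gt0.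
have E : e ^+ (p.+1 - i) * eps * e ^+ i = 1.
  by rewrite mulrAC -exprD subnK ?e2 ?mulVf ?gt_eqF // ltnW.
apply: (@le_trans _ _ (n%:R ^+ p * (a / c) * (e ^+ (p.+1 - i) * eps * e ^+ i))).
  rewrite E mulr1; apply: le_trans nip _; apply: ler_peMr; first exact: exprn_ge0.
  by rewrite ler_pdivlMr // mul1r.
rewrite (_ : n%:R ^+ p / c * _ * _ = n%:R ^+ p * (a / c) * (e ^+ (p.+1 - i) * eps * T%:R ^+ i)).
  apply: ler_wpM2l; first by rewrite !mulr_ge0 ?invr_ge0 ?exprn_ge0 // ltW.
  by apply: ler_wpM2l => //; apply: mulr_ge0; [exact/exprn_ge0/ltW | exact: ltW].
by move: (n%:R ^+ p) (e ^+ _) (T%:R ^+ i) c^-1 => *; ring.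
Qed.

Lemma parameter_choice : exists2 C : R, 0 < C & forall (eps dlt : R) (L M : nat -> R),
  0 < eps -> 0 < dlt < 1 -> (forall i, (i < p)%N -> 0 <= L i) ->
  (forall i, (1 <= i <= p)%N -> 0 <= M i) ->
  exists (N : nat -> nat) (delta : nat -> R) (T : nat) (lam : R),
    [/\ forall i, (1 <= i <= p)%N ->
          [/\ 0 < delta i, (1 <= N i)%N,
              (N i)%:R <= Num.max 1 (C * logfactor eps dlt ^+ 1
                * (L i.-1 + M i) ^+ 2 * sample_rate p eps i)
            & lam * (8 * M i ^+ 2) <= (N i)%:R * (delta i / n%:R ^+ i) ^+ 2],
        (1 <= T)%N,
        T%:R <= Num.max 1 (C * iteration_rate p eps),
        @Aprod R p T.-1 *
          (2 * (\sum_(2 <= i < p.+1) delta i / i`!%:R * R0 ^+ i)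
          + (Lp + p%:R * sigma) * R0 ^+ p.+1 / (p.+1)`!%:R
          + delta 1 * (R0 + Rb)
          + \sum_(2 <= i < p.+2) kappa p Lp sigma eta delta T.-1 i / i`!%:R * R0 ^+ i
          + (9 * p.+1)%:R * (slack0 p sigma eta delta Rb / @Aprod R p (9 * p.+1)))
        + 5 * Rb * delta 1 + T%:R * (3 / 4 * (delta 1 ^+ 2 / delta 2)) <= eps
      & (4 * T * p * n ^ p)%:R * expR (- lam) <= dlt].
Proof.
have [r1_0 r2_0 r3_0] := rate_ge0 Lp_ge0 sigma_ge eta_ge3 R0_ge0 Rb_gt0.
(* Each of the four terms of [rate_bound] gets eps/4: [K] serves rate2/T^(p+1), [a] serves rate1 d,
   and [c] serves both rate3 tau and tau^2/d. The summands 1 keep the denominators positive. *)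
pose K : R := 4 * (r2 + 1); pose a : R := (4 * (r1 + 1))^-1; pose c : R := a / (4 * (r3 + 1)).
have K1 : 1 <= K by rewrite /K; lra.
have a0 : 0 < a by rewrite invr_gt0; lra.
have c0 : 0 < c by rewrite divr_gt0 //; lra.
have a1 : a <= 4^-1 by rewrite lef_pV2 ?posrE; lra.
have ca : c <= a / 4.
  by rewrite /c ler_pM2l // lef_pV2 ?posrE; lra.
pose Q : R := 4 * p%:R * n%:R ^+ p * (1 + 2 * K).
have n1 : 1 <= n%:R ^+ p :> R by rewrite exprn_ege1 // ler1n.
have p1 : 1 <= p%:R :> R by rewrite ler1n ltnW.
have Q1 : 1 <= Q.
  rewrite /Q; apply: mulr_ege1; last by lra.
  by apply: mulr_ege1 => //; lra.
pose Cs : R := (n%:R ^+ p / c) ^+ 2.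
have Cs0 : 0 <= Cs by exact: sqr_ge0.
have lQ : 0 <= ln Q by rewrite ln_ge0.
exists (2 * K + 16 * ((1 + ln Q) * Cs)).
  by apply: ltr_pwDl; [lra | apply: mulr_ge0 => //; apply: mulr_ge0 => //; lra].
set C := (2 * K + _) => eps dlt L M e0 /andP[d0 d1] L0 M0.
have [T [T1 TK eT TC Tlog]] := iteration_count K1 e0.
have [ie0 _ s1 s2] := rate_powers e0.
set e := iteration_rate p eps in eT TC ie0 s2 *.
pose m := (4 * p * n ^ p)%N.
have m0 : (0 < m)%N by rewrite !muln_gt0 expn_gt0 n_gt0 /= (ltnW p_ge2).
(* Makes the union bound T m exp(-lam) equal to [dlt]. *)
pose lam := ln ((T * m)%:R / dlt).
have QE : Q = m%:R * (1 + 2 * K) by rewrite /m !natrM natrX.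
have lamQ : lam <= (1 + ln Q) * logfactor eps dlt by exact: log_count Tlog QE.
pose delta i := if i == 1%N then c * eps else a * eps * T%:R ^+ i.
have T0 : 0 < T%:R :> R by rewrite ltr0n.
have delta0 i : 0 < delta i.
  rewrite /delta; case: ifP => _; first exact: mulr_gt0.
  by apply: mulr_gt0; [exact: mulr_gt0 | exact: exprn_gt0].
have lf0 : 0 <= logfactor eps dlt.
  have ei : 0 < eps^-1 by rewrite invr_gt0.
  have di : 0 < dlt^-1 by rewrite invr_gt0.
  rewrite /logfactor; have l1 : 0 <= ln (1 + eps^-1) by apply: ln_ge0; lra.
  have l2 : 0 <= ln (1 + dlt^-1) by apply: ln_ge0; lra.
  by lra.
(* The condition on the sample size, solved for [N i]. *)
pose X i : R := lam * (8 * M i ^+ 2) * (n%:R ^+ i / delta i) ^+ 2.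
have [N hN] := choice (fun i => nat_between (X i)).
exists N, delta, T, lam; split => //.
- move=> i ip; have [N1 N2 N3] := hN i; split => //.
  + apply: le_trans N3 _; rewrite ge_max le_max lexx /= le_max; apply/orP; right.
    have := rate_count e0 c0 (_ : c <= a) ip eT; rewrite -/(delta i) => hs.
    have /andP[i1 ip'] := ip.
    have L0' : 0 <= L i.-1 by apply: L0; rewrite prednK.
    have {hs} : (n%:R ^+ i / delta i) ^+ 2 <= Cs * sample_rate p eps i by apply: hs; lra.
    have sr0 : 0 <= sample_rate p eps i by rewrite /sample_rate; case: ifP => _; exact: powR_ge0.
    have : M i ^+ 2 <= (L i.-1 + M i) ^+ 2.
      apply: lerXn2r; rewrite ?nnegrE ?addr_ge0 ?M0 //.
      by rewrite ler_wpDl.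
    rewrite /X expr1; move: (n%:R ^+ i / delta i) (M i ^+ 2) (L i.-1 + M i) (sqr_ge0 (M i)) => u v w v0 h1 h2.
    have h3 : lam * v <= (1 + ln Q) * logfactor eps dlt * w ^+ 2.
      apply: (@le_trans _ _ ((1 + ln Q) * logfactor eps dlt * v)); first exact: ler_wpM2r.
      by apply: ler_wpM2l => //; apply: mulr_ge0 => //; lra.
    have g0 : 0 <= (1 + ln Q) * logfactor eps dlt * w ^+ 2.
      by apply: mulr_ge0; [apply: mulr_ge0 => //; lra | exact: sqr_ge0].
    have h4 : lam * v * u ^+ 2 <= (1 + ln Q) * logfactor eps dlt * w ^+ 2 * (Cs * sample_rate p eps i).
      apply: (@le_trans _ _ ((1 + ln Q) * logfactor eps dlt * w ^+ 2 * u ^+ 2)).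
        by apply: ler_wpM2r => //; exact: sqr_ge0.
      exact: ler_wpM2l.
    have -> : 2 * (lam * (8 * v) * u ^+ 2) = 16 * (lam * v * u ^+ 2) by ring.
    apply: (@le_trans _ _ (16 * ((1 + ln Q) * logfactor eps dlt * w ^+ 2 * (Cs * sample_rate p eps i)))).
      by rewrite ler_pM2l.
    have -> : C * logfactor eps dlt * w ^+ 2 * sample_rate p eps i =
       2 * K * (logfactor eps dlt * w ^+ 2 * sample_rate p eps i) +
       16 * ((1 + ln Q) * logfactor eps dlt * w ^+ 2 * (Cs * sample_rate p eps i)).
      by rewrite /C; move: (ln Q) (logfactor eps dlt) (sample_rate p eps i) => *; ring.
    rewrite lerDr; apply: mulr_ge0; first by lra.
    by apply: mulr_ge0 => //; apply: mulr_ge0 => //; exact: sqr_ge0.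
  + have n0 : 0 < n%:R ^+ i :> R by rewrite exprn_gt0 // ltr0n.
    have := ler_wpM2r (sqr_ge0 (delta i / n%:R ^+ i)) N2; apply: le_trans.
    rewrite (_ : X i * _ = lam * (8 * M i ^+ 2)) // /X.
    move: (n%:R ^+ i) (delta i) n0 (delta0 i) => u v u0 v0.
    by field; rewrite !gt_eqF.
- apply: le_trans TC _; rewrite ge_max le_max lexx /= le_max; apply/orP; right.
  rewrite ler_pM2r // /C lerDl; apply: mulr_ge0 => //; apply: mulr_ge0 => //; lra.
- have deltaE i : (2 <= i <= p)%N -> delta i = a * eps * T%:R ^+ i.
    by move=> /andP[i2 _]; rewrite /delta; case: eqP => // E; rewrite E in i2.
  have d_gt0 : 0 < a * eps by exact: mulr_gt0.
  have t0 : 0 <= delta 1 by exact: ltW.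
  have := rate_bound p_ge2 Lp_ge0 sigma_ge eta_ge3 R0_ge0 Rb_gt0 T1 d_gt0 t0 deltaE.
  move/le_trans; apply; rewrite /delta eqxx.
  have b1 : r1 * (a * eps) <= eps / 4.
    rewrite mulrA [eps / 4]mulrC; apply: ler_wpM2r; first exact: ltW.
    by rewrite /a ler_pdivrMr; lra.
  have b2 : r2 / T%:R ^+ p.+1 <= eps / 4.
    rewrite ler_pdivrMr ?exprn_gt0 //.
    apply: (@le_trans _ _ (eps / 4 * (K / eps))); last by rewrite ler_pM2l // divr_gt0.
    by rewrite (_ : eps / 4 * (K / eps) = r2 + 1) ?lerDl // /K; field; rewrite gt_eqF.
  have b3 : r3 * (c * eps) <= eps / 4.
    have -> : r3 * (c * eps) = r3 / (r3 + 1) * (a * eps / 4).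
      by rewrite /c; field; rewrite gt_eqF //; lra.
    apply: (@le_trans _ _ (a * eps / 4)).
      apply: ler_piMl; first by rewrite divr_ge0 // ltW.
      by rewrite ler_pdivrMr; lra.
    by rewrite ler_pM2r // ler_piMl //; lra.
  have b4 : (c * eps) ^+ 2 / (a * eps) <= eps / 4.
    have -> : (c * eps) ^+ 2 / (a * eps) = c / a * c * eps.
      by field; rewrite !gt_eqF.
    have ca1 : c / a <= 1 by rewrite ler_pdivrMr //; lra.
    rewrite [_ / 4]mulrC; apply: ler_wpM2r; first exact: ltW.
    by apply: (@le_trans _ _ c); [apply: ler_piMl => //; exact: ltW | lra].
  by lra.
- have z0 : 0 < (T * m)%:R / dlt :> R by rewrite divr_gt0 // ltr0n muln_gt0 T1.
  have E : (4 * T * p * n ^ p = T * m)%N by rewrite /m !mulnA [(4 * T)%N]mulnC.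
  rewrite E; have Tm : (0 < T * m)%N by rewrite muln_gt0 T1.
  rewrite expRN lnK ?posrE //; move: (T * m)%N Tm => k k0.
  by rewrite invf_div mulrCA divff ?mulr1 // pnatr_eq0 -lt0n.
Qed.

End StepSizes.

(** * Assembly, with the zero-dimensional case apart *)

Lemma tnorm_bound_ge0 {R : realType} {n : nat} (k : nat) (g1 g2 : 'rV[R]_n -> R) a b (B : R) :
  (0 < n)%N -> times_differentiable k g1 -> times_differentiable k g2 ->
  tnorm (nabla (i := k) g1 a \- nabla g2 b) <= B -> 0 <= B.
Proof.
move=> n0 d1 d2 hB.
have := tnorm_bound d1 d2 hB (size_nseq k (bvec (Ordinal n0))).
rewrite (_ : \prod_(v <- _) enorm v = 1) ?mulr1; first exact: le_trans.
rewrite big_seq big1 // => v; rewrite mem_nseq => /andP[_ /eqP ->].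
exact: enorm_delta.
Qed.

Theorem corollary4 (R : realType) (p n : nat) (Lp sigma : R) (eta : nat -> R)
    (R0 Rbar : R)
    (p_ge2 : (2 <= p)%N)
    (sigma_ge : Num.max 1 (3 / p%:R) * Lp <= sigma)
    (eta_ge3 : forall i, (2 <= i <= p)%N -> 3 <= eta i)
    (Rbar_gt0 : 0 < Rbar) :
  (* constants hidden by O and soft O *)
  exists (C : R) (k : nat), 0 < C /\
  forall (dX : measure_display) (Xi : measurableType dX) (D : probability Xi R)
    (F : 'rV[R]_n -> Xi -> R) (f : 'rV[R]_n -> R)
    (L M : nat -> R) (x0 xs : 'rV[R]_n)
    (F_int : forall x, D.-integrable setT (EFin \o F x))
    (fE : forall x, (f x)%:E = ('E_D[F x])%E)
    (f_convex : convex_function setT f)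
    (f_diff : times_differentiable p f)
    (F_diff : forall z, times_differentiable p (F^~ z))
    (xs_min : is_argmin f xs)
    (x0_dist : enorm (x0 - xs) = R0)
    (L_p : L p = Lp)
    (f_lip : forall i x y, (i <= p)%N ->
       tnorm (nabla (i := i) f x \- nabla f y) <= L i * enorm (x - y))
    (F_noise : forall i x z, (1 <= i <= p)%N ->
       tnorm (nabla (i := i) (F^~ z) x \- nabla f x) <= M i)
    (eps dlt : R) (eps_gt0 : 0 < eps) (dlt_01 : 0 < dlt < 1),
  exists (N : nat -> nat) (delta : nat -> R) (T : nat),
    [/\ forall i, (1 <= i <= p)%N ->
          [/\ 0 < delta i, (1 <= N i)%N
            & (N i)%:R <= Num.max 1 (C * logfactor eps dlt ^+ k
                * (L i.-1 + M i) ^+ 2 * sample_rate p eps i)],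
        (1 <= T)%N,
        T%:R <= Num.max 1 (C * iteration_rate p eps)
      & forall (dO : measure_display) (Omega : measurableType dO)
          (P : probability Omega R) (xi : nat -> nat -> {RV P >-> Xi})
          (S : nat -> {fset nat}) (x y : nat -> Omega -> 'rV[R]_n)
          (xi_iid : iid_samples D xi)
          (S_card : forall i, (1 <= i <= p)%N -> #|` S i| = N i)
          (xy_adapted : adapted xi x y)
          (xy_run : forall w : Omega,
             astm_run p Lp sigma eta delta f x0
               (fun q => sample_mean F S (fun j => xi q j w))
               (fun t => x t w) (fun t => y t w))
          (xy_bounded : forall w : Omega,
             iterates_bounded x0 (fun t => x t w) (fun t => y t w) xs Rbar),
        ((1 - dlt)%:E <= P [set w | (f (x T w) - f xs <= eps)%R])%E].
Proof.
(* The constants are fixed before the problem, so the split can only concern the parameters. Should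
   it fail, a problem with these parameters exists only for n = 0, Lipschitz constants and distances
   being nonnegative otherwise; the space is then a single point. *)
have [[n_gt0 [Lp_ge0 R0_ge0]]|degenerate] := pselect ((0 < n)%N /\ 0 <= Lp /\ 0 <= R0); last first.
  exists 1, 0%N; split=> [//|dX Xi D F f L M x0 xs] F_int fE _ f_diff _ _ x0_dist L_p f_lip _ eps dlt e0 /andP[d0 _].
  have n0 : n = 0%N.
    apply/eqP; apply: contrapT => /negP; rewrite -lt0n => n_gt0; apply: degenerate; split=> //.
    split; last by rewrite -x0_dist; exact: enorm_ge0.
    have := f_lip p (bvec (Ordinal n_gt0)) 0 (leqnn p).
    by move/(tnorm_bound_ge0 n_gt0 f_diff f_diff); rewrite subr0 enorm_delta mulr1 L_p.
  exists (fun=> 1%N), (fun=> 1), 1%N; split => //; try by rewrite le_max lexx.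
    by move=> i _; split => //; rewrite le_max lexx.
  move=> dO Omega P xi S x y _ _ _ _ _.
  rewrite (_ : [set w | _] = setT) ?probability_setT ?lee_fin; first lra.
  apply/seteqP; split => // w _ /=.
  have -> : x 1%N w = xs by apply/rowP => -[j jn]; exfalso; rewrite n0 in jn.
  by rewrite subrr ltW.
have p0 : 0 < p%:R :> R by rewrite ltr0n ltnW.
have sigma_ge' : 3 * Lp <= p%:R * sigma.
  have : 3 / p%:R * Lp <= sigma.
    apply: le_trans sigma_ge; apply: ler_wpM2r => //.
    by rewrite le_max lexx orbT.
  by rewrite mulrAC ler_pdivrMr // mulrC [sigma * _]mulrC.
have [C C0 param] := parameter_choice n_gt0 p_ge2 Lp_ge0 sigma_ge' eta_ge3 R0_ge0 Rbar_gt0.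
exists C, 1%N; split=> // dX Xi D F f L M x0 xs F_int fE f_convex f_diff F_diff _ x0_dist L_p f_lip F_noise eps dlt e0 d01.
have L0 i : (i < p)%N -> 0 <= L i.
  move=> ip; have df : times_differentiable i f by exact: tdiffW (ltnW ip) _.
  have := f_lip i (bvec (Ordinal n_gt0)) 0 (ltnW ip).
  by move/(tnorm_bound_ge0 n_gt0 df df); rewrite subr0 enorm_delta mulr1.
(* A space of total mass 1 has a point, and the noise bound at any sample shows that [M i] is
   nonnegative. *)
have [z0 _] : exists z : Xi, True.
  apply: contrapT => none; have : D setT = 1%E by exact: probability_setT.
  rewrite (_ : [set: Xi] = set0) ?measure0; last by apply/seteqP; split => // z; case: none; exists z.
  by move=> /eqP; rewrite eqe eq_sym oner_eq0.
have M0 i : (1 <= i <= p)%N -> 0 <= M i.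
  move=> ip; have /andP[_ ip'] := ip.
  exact: (tnorm_bound_ge0 n_gt0 (tdiffW ip' (F_diff z0)) (tdiffW ip' f_diff) (F_noise i 0 z0 ip)).
have [N [delta [T [lam [hN T1 TC le_eps prob]]]]] := param eps dlt L M e0 d01 L0 M0.
exists N, delta, T; split => // [i /hN[]//|].
move=> dO Omega P xi S x y iid S_card xy_adapted run bounded.
have x0_dist' : enorm (xs - x0) = R0 by rewrite -x0_dist -enormN opprB.
rewrite -x0_dist' in le_eps.
have f_lip' (s : seq 'rV[R]_n) a b : size s = p ->
    `|dseq s f a - dseq s f b| <= Lp * enorm (a - b) * \prod_(v <- s) enorm v.
  by move=> sp; rewrite -L_p; exact: (tnorm_bound f_diff f_diff (f_lip p a b (leqnn p)) sp).
have delta_gt0 i : (1 <= i <= p)%N -> 0 < delta i by case/hN.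
have S_gt0 i : (1 <= i <= p)%N -> (0 < #|` S i|)%N by move=> ip; rewrite S_card //; case: (hN i ip).
have sample_size i : (1 <= i <= p)%N ->
    lam * (8 * M i ^+ 2) <= #|` S i|%:R * (delta i / n%:R ^+ i) ^+ 2.
  by move=> ip; rewrite S_card //; case: (hN i ip).
have := success_probability n_gt0 p_ge2 Lp_ge0 sigma_ge' eta_ge3 delta_gt0 Rbar_gt0 T1 F_int fE
  f_convex f_diff F_diff f_lip' F_noise iid xy_adapted S_gt0 run bounded sample_size le_eps.
by apply: le_trans; rewrite lee_fin lerB.
Qed.
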